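(* Let $K$ be an infinite field and let $n,r$ be positive integers. (1) The algebra $S(B^+,2,r)$ has finite type if and only if one of the following holds: (i) $\mathrm{char}(K)=0$; (ii) $\mathrm{char}(K)=p\ge 5$ and $r\le p$; (iii) $\mathrm{char}(K)=3$ and $r\le 4$; (iv) $\mathrm{char}(K)=2$ and $r\le 3$. (2) For $n\ge 3$, the algebra $S(B^+,n,r)$ has finite type if and only if $r=1$.
   Context: $K$ is an infinite field. The general linear group $\mathrm{GL}_n(K)$ acts on $(K^n)^{\otimes r}$ by $g(v_1\otimes\dots\otimes v_r)=gv_1\otimes\dots\otimes gv_r$; extending linearly gives an algebra homomorphism $T\colon K\mathrm{GL}_n(K)\to \mathrm{End}_K((K^n)^{\otimes r})$. Let $B^+\subset \mathrm{GL}_n(K)$ be the subgroup of all upper triangular matrices. The Borel-Schur algebra is $S(B^+,n,r):=T(KB^+)$. A finite-dimensional algebra over $K$ has finite (representation) type if it has only finitely many isomorphism classes of finite-dimensional indecomposable left modules. *)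

(* Defs.v *)
From HB Require Import structures.
From mathcomp Require Import all_boot all_order all_algebra.
From mathcomp Require Import boolp classical_sets cardinality.
From mathcomp Require Import mxtens.

Set Implicit Arguments.
Unset Strict Implicit.
Unset Printing Implicit Defensive.

Import GRing.Theory.
Local Open Scope ring_scope.

Section FiniteType.

Variables (K : fieldType) (A : algType K).

(* K acts on an A-module through the structure map c |-> c%:A. *)
Definition findim_module (M : lmodType A) : Prop :=
  exists s : seq M, forall x : M,
    exists c : 'I_(size s) -> K, x = \sum_i (c i)%:A *: s`_i.

Definition internal_direct_sum (M : lmodType A) (U W : {pred M}) : Prop :=
  (forall x : M, exists u w : M, [/\ u \in U, w \in W & x = u + w]) /\
  (forall x : M, x \in U -> x \in W -> x = 0).

Definition indecomposable_module (M : lmodType A) : Prop :=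
  (exists x : M, x != 0) /\
  (forall U W : {pred M},
     submod_closed U -> submod_closed W -> internal_direct_sum U W ->
     (forall x, x \in U -> x = 0) \/ (forall x, x \in W -> x = 0)).

Definition isomorphic_modules (M N : lmodType A) : Prop :=
  exists f : {linear M -> N}, bijective f.

(* The family N may be redundant: it only has to meet every isomorphism class
   of finite-dimensional indecomposable modules. *)
Definition finite_type : Prop :=
  exists (k : nat) (N : 'I_k -> lmodType A),
    forall M : lmodType A, findim_module M -> indecomposable_module M ->
      exists i : 'I_k, isomorphic_modules M (N i).

End FiniteType.

Lemma ntensmx_mul (K : comNzRingType) (n r : nat) (g h : 'M[K]_n) :
  (g *m h) ^t r = (g ^t r) *m (h ^t r).
Proof.
case: r => [|r]; first by rewrite !ntensmx0 mulmx1.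
by elim: r => [|r IHr]; rewrite ?ntensmx1 // !ntensmxSS IHr -tensmx_mul.
Qed.

Lemma ntensmx_id (K : comNzRingType) (n r : nat) :
  (1%:M : 'M[K]_n) ^t r = 1%:M.
Proof.
case: r => [|r]; first by rewrite ntensmx0.
elim: r => [|r IHr]; rewrite ?ntensmx1 // ntensmxSS IHr.
apply/matrixP => i j.
case: (mxtens_indexP i) => i0 i1; case: (mxtens_indexP j) => j0 j1.
by rewrite tensmxE !mxE (can_eq (@mxtens_indexK _ _)) xpair_eqE -natrM mulnb.
Qed.

(* v_0 \otimes ... \otimes v_r, with r.+1 factors; 1 ^ r.+1 is the width
   produced by *t. *)
Fixpoint pure_tensor (K : comNzRingType) (n r : nat) :
    (nat -> 'cV[K]_n) -> 'M[K]_(n ^ r.+1, 1 ^ r.+1) :=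
  match r with
  | 0 => fun v => v 0%N
  | r'.+1 => fun v => v 0%N *t pure_tensor r' (fun i => v i.+1)
  end.

Lemma ntensmx_pure_tensor (K : comNzRingType) (n r : nat) (g : 'M[K]_n)
    (v : nat -> 'cV[K]_n) :
  g ^t r.+1 *m pure_tensor r v = pure_tensor r (fun i => g *m v i).
Proof.
elim: r v => [|r IHr] v; first by rewrite ntensmx1.
by rewrite ntensmxSS /= -IHr -tensmx_mul.
Qed.

Section BorelSchur.

Variables (K : fieldType) (n r : nat).

(* End_K((K^n)^{\otimes r}), with (K^n)^{\otimes r} = K^(n ^ r) through the
   basis e_(i_1) \otimes ... \otimes e_(i_r) in lexicographic order, matrices
   acting on column vectors.  As for {'GL_n[R]}, n is replaced with n.-1.+1,
   which makes the ring nontrivial; this is n itself when n > 0. *)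
Definition tensor_end : Type := 'M[K]_(n.-1.+1 ^ r).

HB.instance Definition _ := GRing.PzRing.on tensor_end.
HB.instance Definition _ := GRing.Lmodule.on tensor_end.

Fact tensor_end_nontrivial : (1 : tensor_end) != 0.
Proof.
have N_gt0 : (0 < n.-1.+1 ^ r)%N by rewrite expn_gt0.
apply/eqP => /matrixP/(_ (Ordinal N_gt0) (Ordinal N_gt0)).
by rewrite !mxE eqxx; apply/eqP; rewrite oner_eq0.
Qed.

HB.instance Definition _ :=
  GRing.PzSemiRing_isNonZero.Build tensor_end tensor_end_nontrivial.
HB.instance Definition _ :=
  GRing.LSemiModule_isLSemiAlgebra.Build K tensor_end
    (@scalemxAl K (n.-1.+1 ^ r) (n.-1.+1 ^ r) (n.-1.+1 ^ r)).
HB.instance Definition _ :=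
  GRing.LSemiAlgebra_isSemiAlgebra.Build K tensor_end
    (fun c A B => @scalemxAr K _ _ _ c A B).

(* is_trig_mx means lower triangular, hence the transpose. *)
Definition borel : {pred 'M[K]_n.-1.+1} :=
  [pred g | (g \in unitmx) && is_trig_mx g^T].

(* T(g) = g \otimes ... \otimes g. *)
Definition tensor_rep (g : 'M[K]_n.-1.+1) : tensor_end := g ^t r.

(* T(KB^+): the values of T on the formal combinations \sum_i c_i g_i. *)
Definition borel_schur_pred : {pred tensor_end} := [pred A |
  `[< exists (k : nat) (c : 'I_k -> K) (g : 'I_k -> 'M[K]_n.-1.+1),
        (forall i, g i \in borel) /\ A = \sum_i c i *: tensor_rep (g i) >]].

Fact borel1 : 1%:M \in borel.
Proof. by rewrite inE unitmx1 trmx1 scalar_mx_is_trig. Qed.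

Fact borelM : {in borel &, forall g h, g *m h \in borel}.
Proof.
move=> g h; rewrite !inE => /andP[ug /is_trig_mxP tg] /andP[uh /is_trig_mxP th].
rewrite unitmx_mul ug uh /=; apply/is_trig_mxP => i j lt_ij.
rewrite !mxE big1 // => k _.
have [lt_kj|le_jk] := ltnP k j; last first.
  by have := th i k (leq_trans lt_ij le_jk); rewrite mxE => ->; rewrite mulr0.
by have := tg k j lt_kj; rewrite mxE => ->; rewrite mul0r.
Qed.

Fact borel_schur_gen c g : g \in borel -> c *: tensor_rep g \in borel_schur_pred.
Proof.
move=> Bg; apply/asboolP; exists 1%N, (fun=> c), (fun=> g).
by rewrite big_ord1.
Qed.

Fact borel_schur_add :
  {in borel_schur_pred &, forall A B, A + B \in borel_schur_pred}.
Proof.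
move=> _ _ /asboolP[k [c [g [Bg ->]]]] /asboolP[l [d [h [Bh ->]]]].
apply/asboolP; exists (k + l)%N.
exists (fun i => match split i with inl j => c j | inr j => d j end).
exists (fun i => match split i with inl j => g j | inr j => h j end).
split=> [i|]; first by case: (split i).
rewrite big_split_ord /=; congr (_ + _); apply: eq_bigr => i _.
  by rewrite (unsplitK (inl i)).
by rewrite (unsplitK (inr i)).
Qed.

Fact borel_schur_sum (k : nat) (F : 'I_k -> tensor_end) :
  (forall i, F i \in borel_schur_pred) -> \sum_i F i \in borel_schur_pred.
Proof.
move=> SF; apply: (big_ind (fun A => A \in borel_schur_pred)) => //.
- apply/asboolP; exists 0%N, (fun=> 0), (fun=> 1%:M).
  by split=> [[]|] //; rewrite big_ord0.
- by move=> A B; apply: borel_schur_add.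
Qed.

Lemma borel_schur_subalg : GRing.subalg_closed borel_schur_pred.
Proof.
split.
- rewrite -[1]scale1r -[1 in X in _ *: X](ntensmx_id K n.-1.+1 r).
  exact: borel_schur_gen borel1.
- move=> a _ B /asboolP[k [c [g [Bg ->]]]] SB.
  apply: borel_schur_add SB; rewrite scaler_sumr.
  by apply: borel_schur_sum => i; rewrite scalerA; apply: borel_schur_gen.
move=> _ _ /asboolP[k [c [g [Bg ->]]]] /asboolP[l [d [h [Bh ->]]]].
rewrite mulr_suml; apply: borel_schur_sum => i.
rewrite mulr_sumr; apply: borel_schur_sum => j.
rewrite -scalerAl -scalerAr scalerA.
rewrite [X in _ *: X](_ : _ = tensor_rep (g i *m h j)); last first.
  by rewrite /tensor_rep ntensmx_mul.
exact/borel_schur_gen/borelM.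
Qed.

HB.instance Definition _ :=
  GRing.isSubalgClosed.Build K tensor_end borel_schur_pred borel_schur_subalg.

(* S(B^+, n, r) *)
Record borel_schur : Type := BorelSchur {
  borel_schur_val :> tensor_end;
  _ : borel_schur_val \in borel_schur_pred }.

HB.instance Definition _ := [isSub for borel_schur_val].
HB.instance Definition _ := [Choice of borel_schur by <:].
HB.instance Definition _ := [SubChoice_isSubAlgebra of borel_schur by <:].

End BorelSchur.

(* Main.v *)
Require Import Defs.
From HB Require Import structures.
From mathcomp Require Import all_boot all_order all_algebra.
From mathcomp Require Import boolp classical_sets cardinality.
From mathcomp Require Import fintype finset mxtens.
From mathcomp Require Import zify ring.

Set Implicit Arguments.
Unset Strict Implicit.
Unset Printing Implicit Defensive.

Import GRing.Theory.
Local Open Scope ring_scope.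

(** Sort the words in two letters by their weight, the number of letters 0.
    Then S(B+, 2, r) has a basis F s t with 0 <= s <= t <= r and
    F t u * F s t = 'C(u - s, t - s) * F s u, all other products being zero.
    A module is therefore a family of spaces V_0, ..., V_r with maps
    X s t : V_s -> V_t such that X s t followed by X t u is
    'C(u - s, t - s) times X s u.  Everything depends on which of these
    binomial coefficients vanish in K.

    Finite type.  If r < p, or in characteristic zero, the steps
    V_s -> V_(s+1) generate all the maps, and a module is a representation of
    a linear quiver.  If p <= r < 2 p the maps V_s -> V_(s+p) are needed as
    well, and p consecutive steps compose to zero.  For r = p there is one
    long arrow; for (p, r) = (3, 4) and (2, 3) there are two, and they form
    commutative squares with the steps.  In each case every indecomposable
    module has a basis, of bounded size, in which the generators act by
    matrices of bounded natural numbers, and there are finitely many of those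
    ([finite_type_standard], [finite_type_graded]).  Such a basis is produced
    by [unitri_std]: vectors and functionals with unitriangular pairing span a
    direct summand as soon as the vectors are stable under the maps and the
    functionals under their transposes, and in an indecomposable module that
    summand is everything.  To find them, take a space V_s and the two
    filtrations that the maps into and out of V_s define on it; by
    [butterfly] some vector sits exactly at a jump of both filtrations, and
    so does some functional.  The position of the jumps says how far the
    vector can be pushed forward and pulled back, and the functional
    likewise.  In degree r = 1 the algebra consists of the upper triangular
    matrices, the path algebra of a linear quiver again.

    Infinite type.  It suffices to give modules M_lam, with lam in K, that
    are indecomposable and pairwise non-isomorphic ([infinite_type_family]).
    For two letters they are built from blocks placed at weights
    ([blocks_infinite_type]), and the weights are bounded, so that a family
    that exists for some r exists for every larger one.  In characteristic 2 and r >= 4 the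
    blocks are lines arranged in a hexagon of six maps, with alternating
    product lam.  In odd characteristic the maps force an endomorphism to
    preserve four lines in a plane: three fixed lines, which make it a scalar,
    and one that depends on lam, which makes lam an invariant.  For p = 3 this fits in weights
    at most 5; for p >= 5 it takes the weights 0, 1, 2, 3 and
    p - 2, p - 1, p, p + 1, where the map over a gap of p carries the plane
    from one end to the other, so r >= p + 1 is what is needed.  For at
    least three letters and r >= 2, there are modules of dimension 4 with
    weights given by the words ending in 12, 11, 02 and 01; they have the
    shape of a diamond, and lam is the ratio of its two paths. *)

(** * Modules in coordinates *)
Section Criterion.
Variables (K : fieldType) (A : algType K).

(** Matrices act on row vectors from the right, so that products are reversed. *)
Definition mxmodule n (R : A -> 'M[K]_n) : Prop :=
  [/\ forall c a b, R (c *: a + b) = c *: R a + R b, R 1 = 1%:M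
    & forall a b, R (a * b) = R b *m R a].

(** Direct sum decompositions correspond to idempotent endomorphisms. *)
Definition mxindec n (R : A -> 'M[K]_n) : Prop :=
  n <> 0%N /\ forall P : 'M[K]_n, P *m P = P ->
    (forall a, P *m R a = R a *m P) -> P = 0 \/ P = 1%:M.

Section Coordinates.
Variables (M : lmodType A).

Definition kscale (c : K) (x : M) : M := c%:A *: x.

Lemma kscaleDl c d x : kscale (c + d) x = kscale c x + kscale d x.
Proof. by rewrite /kscale scalerDl scalerDl. Qed.
Lemma kscale1 x : kscale 1 x = x.
Proof. by rewrite /kscale !scale1r. Qed.
Lemma act_kscale c (a : A) x : a *: kscale c x = kscale c (a *: x).
Proof. by rewrite /kscale !scalerA mulr_algl mulr_algr. Qed.
Lemma kscale_act c (a : A) x : (c *: a) *: x = kscale c (a *: x).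
Proof. by rewrite /kscale !scalerA mulr_algl. Qed.
Lemma kscaleA c d x : kscale c (kscale d x) = kscale (c * d) x.
Proof. by rewrite {1}/kscale act_kscale /kscale scalerA mulr_algl scalerA mulrC. Qed.
Lemma kscale_sum c (I : Type) (s : seq I) (F : I -> M) :
  kscale c (\sum_(i <- s) F i) = \sum_(i <- s) kscale c (F i).
Proof. exact: scaler_sumr. Qed.

Definition klinear n (f : 'rV[K]_n -> M) : Prop :=
  forall c u v, f (c *: u + v) = kscale c (f u) + f v.

Lemma klinear0 n (f : 'rV[K]_n -> M) : klinear f -> f 0 = 0.
Proof.
move=> lf; have := lf 1 0 0; rewrite scaler0 addr0 kscale1 => /eqP.
by rewrite -subr_eq0 opprD addrA subrr sub0r oppr_eq0 => /eqP.
Qed.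

Lemma klinearD n (f : 'rV[K]_n -> M) : klinear f ->
  forall u v, f (u + v) = f u + f v.
Proof. by move=> lf u v; have := lf 1 u v; rewrite scale1r kscale1. Qed.

Lemma klinearZ n (f : 'rV[K]_n -> M) : klinear f ->
  forall c u, f (c *: u) = kscale c (f u).
Proof. by move=> lf c u; have := lf c u 0; rewrite (klinear0 lf) !addr0. Qed.

Lemma klinear_sum n (f : 'rV[K]_n -> M) : klinear f ->
  forall I (s : seq I) (F : I -> 'rV[K]_n),
    f (\sum_(i <- s) F i) = \sum_(i <- s) f (F i).
Proof.
move=> lf I s F; elim: s => [|i s IH]; first by rewrite !big_nil (klinear0 lf).
by rewrite !big_cons (klinearD lf) IH.
Qed.

(** A linear map from K^n onto M with n minimal is injective: if it killed a
    nonzero vector u, its restriction to a complement of u would still be onto. *)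
Lemma findim_coordinates : findim_module M ->
  exists (n : nat) (f : 'rV[K]_n -> M), klinear f /\ bijective f.
Proof.
case=> s span_s.
pose spans n := `[< exists f : 'rV[K]_n -> M,
                    klinear f /\ forall x, exists u, f u = x >].
have ex_spans : exists n, spans n.
  exists (size s); apply/asboolP.
  exists (fun u : 'rV_(size s) => \sum_i kscale (u 0 i) s`_i); split.
    move=> c u v; rewrite kscale_sum -big_split; apply: eq_bigr => i _ /=.
    by rewrite !mxE kscaleDl kscaleA.
  move=> x; have [c ->] := span_s x.
  by exists (\row_i c i); apply: eq_bigr => i _; rewrite mxE.
case: (ex_minnP ex_spans) => n /asboolP[f [lf sf]] min_n.
exists n, f; split=> //.
have kf u : f u = 0 -> u = 0.
  move=> fu; apply/eqP; apply: contraT => nzu.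
  have rk_u : \rank u = 1%N by rewrite rank_rV nzu.
  have n_gt0 : (0 < n)%N by apply: leq_trans (rank_leq_col u); rewrite rk_u.
  suff /min_n : spans (\rank (u^C)%MS).
    by rewrite mxrank_compl rk_u leqNgt subn1 ltn_predL n_gt0.
  apply/asboolP; exists (fun v => f (v *m row_base (u^C)%MS)); split.
    by move=> c v w; rewrite mulmxDl -scalemxAl lf.
  move=> x; have [w <-] := sf x.
  have : (w <= u + u^C)%MS by rewrite submx_full // addsmx_compl_full.
  case/sub_addsmxP=> -[w1 w2] /= ->.
  have : (w2 *m u^C <= row_base u^C)%MS by rewrite eq_row_base submxMl.
  case/submxP=> v ->; exists v.
  rewrite [w1]mx11_scalar mul_scalar_mx (klinearD lf) (klinearZ lf) fu.
  by rewrite /kscale scaler0 add0r.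
have inj_f : injective f.
  move=> u v fuv; apply/eqP; rewrite -subr_eq0; apply/eqP/kf.
  have := klinearD lf (u - v) v; rewrite subrK fuv => /eqP.
  by rewrite -subr_eq0 opprD addrCA subrr addr0 oppr_eq0 => /eqP.
pose g x := projT1 (cid (sf x)).
have gK x : f (g x) = x by rewrite /g; case: cid.
by exists g => // u; apply: inj_f; rewrite gK.
Qed.

End Coordinates.

Lemma action_matrix (M : lmodType A) n (f : 'rV[K]_n -> M) :
  klinear f -> bijective f ->
  exists R : A -> 'M[K]_n, mxmodule R /\ forall a u, f (u *m R a) = a *: f u.
Proof.
move=> lf [g fK gK].
pose R a : 'M[K]_n := \matrix_(i < n) g (a *: f (delta_mx 0 i)).
have fR a u : f (u *m R a) = a *: f u.
  rewrite mulmx_sum_row (klinear_sum lf) [in RHS](matrix_sum_delta u).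
  rewrite big_ord1 (klinear_sum lf) scaler_sumr; apply: eq_bigr => i _.
  by rewrite rowK !(klinearZ lf) gK act_kscale.
have injR : forall X Y : 'M[K]_n, (forall u : 'rV_n, f (u *m X) = f (u *m Y)) -> X = Y.
  move=> X Y eXY; apply/row_matrixP => i; rewrite !rowE.
  by apply: (can_inj fK); apply: eXY.
exists R; split=> //; split.
- move=> c a b; apply: injR => u.
  by rewrite mulmxDr -scalemxAr lf !fR scalerDl kscale_act.
- by apply: injR => u; rewrite fR mulmx1 scale1r.
by move=> a b; apply: injR => u; rewrite fR mulmxA !fR scalerA.
Qed.

(** A commuting idempotent splits M into the vectors that it fixes and those
    that it kills. *)
Lemma mxindec_coordinates (M : lmodType A) n (f : 'rV[K]_n -> M)
  (R : A -> 'M[K]_n) : klinear f -> bijective f ->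
  (forall a u, f (u *m R a) = a *: f u) ->
  indecomposable_module M -> mxindec R.
Proof.
move=> lf [g fK gK] fR [[x nzx] indM]; split.
  move=> n0; move: nzx; rewrite -(gK x); subst n.
  by rewrite [g x]thinmx0 (klinear0 lf) eqxx.
move=> P PP cP.
have lg a y z : g (a *: y + z) = g y *m R a + g z.
  by apply: (can_inj fK); rewrite gK (klinearD lf) fR !gK.
pose U : {pred M} := [pred m | g m *m P == g m].
pose W : {pred M} := [pred m | g m *m P == 0].
have g0 : g 0 = 0 by apply: (can_inj fK); rewrite gK (klinear0 lf).
have sU : submod_closed U.
  split=> [|a y z]; rewrite !inE ?g0 ?mul0mx // => /eqP Uy /eqP Uz.
  by rewrite lg mulmxDl Uz -mulmxA -cP mulmxA Uy.
have sW : submod_closed W.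
  split=> [|a y z]; rewrite !inE ?g0 ?mul0mx // => /eqP Uy /eqP Uz.
  by rewrite lg mulmxDl Uz -mulmxA -cP mulmxA Uy mul0mx addr0.
have dUW : internal_direct_sum U W.
  split=> [y|y].
    exists (f (g y *m P)), (f (g y *m (1%:M - P))).
    rewrite !inE !fK -(klinearD lf) -mulmxDr (addrC P) subrK mulmx1 gK.
    by rewrite -!mulmxA PP mulmxBl mul1mx PP subrr mulmx0 !eqxx.
  rewrite !inE => /eqP yP; rewrite yP => /eqP y0.
  by rewrite -(gK y) y0 (klinear0 lf).
have PE (Q : 'M[K]_n) : (forall u : 'rV_n, f (u *m Q) = 0) -> Q = 0.
  move=> Q0; apply/row_matrixP => i; rewrite rowE row0.
  by apply: (can_inj fK); rewrite Q0 (klinear0 lf).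
case: (indM U W sU sW dUW) => H; [left|right].
  by apply: PE => u; apply: H; rewrite inE !fK -mulmxA PP.
apply/eqP; rewrite -subr_eq0 -oppr_eq0 opprB; apply/eqP/PE => u; apply: H.
by rewrite inE !fK -mulmxA mulmxBl mul1mx PP subrr mulmx0.
Qed.

Lemma isomorphic_coordinates (M M' : lmodType A) n n' (f : 'rV[K]_n -> M)
    (f' : 'rV[K]_n' -> M') (R : A -> 'M[K]_n) (R' : A -> 'M[K]_n')
    (T : 'M[K]_(n, n')) (S : 'M[K]_(n', n)) :
  klinear f -> bijective f -> (forall a u, f (u *m R a) = a *: f u) ->
  klinear f' -> bijective f' -> (forall a u, f' (u *m R' a) = a *: f' u) ->
  T *m S = 1%:M -> S *m T = 1%:M -> (forall a, R a *m T = T *m R' a) ->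
  isomorphic_modules M M'.
Proof.
move=> lf [g fK gK] fR lf' [g' fK' gK'] fR' TS ST RT.
pose h x := f' (g x *m T).
have lh : linear h.
  move=> a x y; rewrite /h -fR' -mulmxA -RT -(klinearD lf') mulmxA -mulmxDl.
  by congr (f' (_ *m _)); apply: (can_inj fK); rewrite gK (klinearD lf) fR !gK.
pose mixin := GRing.isLinear.Build A M M' *:%R h lh.
pose hL : {linear M -> M'} := HB.pack h mixin.
exists hL; exists (fun y => f (g' y *m S)) => x /=; rewrite /h ?fK ?fK' -mulmxA.
  by rewrite TS mulmx1 gK.
by rewrite ST mulmx1 gK'.
Qed.

Definition standard_basis (I : finType) (g : I -> A) (N : nat) n (R : A -> 'M[K]_n) :=
  exists2 p : nat, (p <= N)%N & exists T : 'M[K]_(p, n), exists S : 'M[K]_(n, p),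
   [/\ T *m S = 1%:M, S *m T = 1%:M
     & forall i, exists2 B : 'M[nat]_p, (forall j k, B j k <= N)%N &
         T *m R (g i) *m S = \matrix_(j, k) (B j k)%:R].

Definition generates (I : Type) (g : I -> A) : Prop :=
  forall P : A -> Prop, P 1 -> (forall c a b, P a -> P b -> P (c *: a + b)) ->
   (forall a b, P a -> P b -> P (a * b)) -> (forall i, P (g i)) -> forall a, P a.

(** The matrices of the generators determine a module up to isomorphism, and
    there are finitely many labels: a dimension p <= N and a p x p matrix with
    entries in 0, ..., N for each generator.  One module is picked for each label
    that occurs. *)
Lemma finite_type_standard (I : finType) (g : I -> A) (N : nat) :
  generates g ->
  (forall n (R : A -> 'M[K]_n), mxmodule R -> mxindec R ->
     standard_basis g N R) ->
  finite_type A.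
Proof.
move=> gen_g stdR.
pose L := {p : 'I_N.+1 & {ffun I -> 'M['I_N.+1]_p}}.
pose lab (l : L) (M : lmodType A) :=
  exists n (f : 'rV[K]_n -> M) (R : A -> 'M[K]_n)
     (T : 'M[K]_(tag l, n)) (S : 'M[K]_(n, tag l)),
    [/\ klinear f, bijective f, mxmodule R & forall a u, f (u *m R a) = a *: f u] /\
    [/\ T *m S = 1%:M, S *m T = 1%:M
     & forall i, T *m R (g i) *m S = \matrix_(j, k) (tagged l i j k)%:R].
pose Nl (l : L) : lmodType A :=
  match pselect (exists M, lab l M) with
  | left h => projT1 (cid h)
  (* an arbitrary module, for the labels that no module has *)
  | right _ => A^o end.
exists #|{: L}|, (fun i => Nl (enum_val i)) => M fM iM.
have [n [f [lf bf]]] := findim_coordinates fM.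
have [R [mR fR]] := action_matrix lf bf.
have iR := mxindec_coordinates lf bf fR iM.
have [p lepN [T [S [TS ST std]]]] := stdR n R mR iR.
have /choice[B BE] : forall i, exists B : 'M['I_N.+1]_p,
    T *m R (g i) *m S = \matrix_(j, k) (B j k)%:R.
  move=> i; have [B leB ->] := std i; exists (\matrix_(j, k) inord (B j k)).
  by apply/matrixP => j k; rewrite !mxE inordK ?ltnS.
pose l : L := @Tagged _ (Ordinal (lepN : p < N.+1)%N)
   (fun p : 'I_N.+1 => {ffun I -> 'M['I_N.+1]_p}) [ffun i => B i].
exists (enum_rank l); rewrite enum_rankK.
have labM : lab l M.
  exists n, f, R, T, S; split; split=> // i; rewrite BE.
  by apply/matrixP => j k; rewrite !mxE ffunE.
rewrite /Nl; case: pselect => [h|[]]; last by exists M.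
case: cid => M' /= [n' [f' [R' [T' [S' [[lf' bf' mR' fR'] [TS' ST' std']]]]]]].
apply: (@isomorphic_coordinates M M' n n' f f' R R' (S *m T') (S' *m T)) => //.
- by rewrite mulmxA -(mulmxA S) TS' mulmx1.
- by rewrite mulmxA -(mulmxA S') TS mulmx1.
have [linR R1 RM] := mR; have [linR' R1' RM'] := mR'.
apply: gen_g.
- by rewrite R1 R1' mul1mx mulmx1.
- move=> c a b ha hb; rewrite linR linR' mulmxDl mulmxDr.
  by rewrite -scalemxAl -scalemxAr ha hb.
- by move=> a b ha hb; rewrite RM RM' -mulmxA ha mulmxA hb mulmxA.
move=> i; have : T *m R (g i) *m S = T' *m R' (g i) *m S'.
  by rewrite std' BE; apply/matrixP => j k; rewrite !mxE ffunE.
move=> e.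
have -> : R (g i) = S *m (T *m R (g i) *m S) *m T.
  by rewrite -!mulmxA ST mulmx1 mulmxA ST mul1mx.
by rewrite e -!mulmxA (mulmxA T) TS mul1mx ST' mulmx1.
Qed.

End Criterion.

(** * Graded modules and their summands *)
Section GradedRep.
Variables (K : fieldType) (Q : rel nat).

Definition natmx m n (B : 'M[nat]_(m, n)) : 'M[K]_(m, n) :=
  \matrix_(i, j) (B i j)%:R.

Section Rep.
Variables (d : nat -> nat) (X : forall s t, 'M[K]_(d s, d t)).

(** Q selects the arrows, that is, the maps that generate the others; only
    these have to commute with the idempotents. *)
Definition rep_indec : Prop :=
  (exists v, d v <> 0%N) /\
  forall P : forall v, 'M[K]_(d v), (forall v, P v *m P v = P v) ->
    (forall s t, Q s t -> P s *m X s t = X s t *m P t) ->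
    (forall v, P v = 0) \/ (forall v, P v = 1%:M).

Definition rep_std N : Prop :=
  exists k : nat -> nat, (forall v, (k v <= N)%N) /\
  exists (T : forall v, 'M[K]_(k v, d v)) (S : forall v, 'M[K]_(d v, k v)),
    [/\ forall v, T v *m S v = 1%:M, forall v, S v *m T v = 1%:M
      & forall s t, Q s t -> exists2 B : 'M[nat]_(k s, k t),
          (forall i j, B i j <= N)%N & T s *m X s t = natmx B *m T t].

Lemma rep_std_leq N N' : (N <= N')%N -> rep_std N -> rep_std N'.
Proof.
move=> le [k [kN [T [S [TS ST TX]]]]]; exists k; split=> [v|].
  exact: leq_trans le.
exists T, S; split=> // s t /TX[B leB TE]; exists B => // i j.
exact: leq_trans le.
Qed.

Definition comb01 n (xs : seq 'rV[K]_n) (x : 'rV[K]_n) : Prop :=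
  exists c : nat -> bool, x = \sum_(i < size xs) (c i)%:R *: xs`_i.

Definition cspan n (fs : seq 'cV[K]_n) (f : 'cV[K]_n) : Prop :=
  exists c : nat -> K, f = \sum_(i < size fs) c i *: fs`_i.

Fixpoint kills n (x : 'rV[K]_n) (fs : seq 'cV[K]_n) : Prop :=
  if fs is f :: fs' then x *m f = 0 /\ kills x fs' else True.

(** The pairing of xs with fs is triangular with ones on the diagonal.  The
    recursive form lets concrete lists be checked by computation. *)
Fixpoint unitri n (xs : seq 'rV[K]_n) (fs : seq 'cV[K]_n) : Prop :=
  match xs, fs with
  | [::], [::] => True
  | x :: xs', f :: fs' => [/\ x *m f = 1%:M, kills x fs' & unitri xs' fs']
  | _, _ => False
  end.

Lemma kills_nth n (x : 'rV[K]_n) fs i : kills x fs -> x *m fs`_i = 0.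
Proof.
elim: fs i => [|f fs IH] [|i] /=; rewrite ?mulmx0 //; first by case.
by case=> _ /IH.
Qed.

Lemma unitri_size n (xs : seq 'rV[K]_n) fs : unitri xs fs -> size fs = size xs.
Proof. by elim: xs fs => [|x xs IH] [|f fs] //= [_ _ /IH->]. Qed.

Lemma unitri_diag n (xs : seq 'rV[K]_n) fs i :
  unitri xs fs -> (i < size xs)%N -> xs`_i *m fs`_i = 1%:M.
Proof.
elim: xs fs i => [|x xs IH] [|f fs] [|i] //=; first by case.
by case=> _ _ tri lti; apply: IH.
Qed.

Lemma unitri_upper n (xs : seq 'rV[K]_n) fs i j :
  unitri xs fs -> (i < j)%N -> xs`_i *m fs`_j = 0.
Proof.
elim: xs fs i j => [|x xs IH] [|f fs] [|i] [|j] //= tri lt_ij;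
  rewrite ?mul0mx //; case: tri => _ kx tri; first exact: kills_nth.
exact: IH tri _.
Qed.

Definition rowsmx n (xs : seq 'rV[K]_n) : 'M[K]_(size xs, n) :=
  \matrix_(i < size xs) xs`_i.
Definition colsmx k n (fs : seq 'cV[K]_n) : 'M[K]_(n, k) :=
  \matrix_(i < n, j < k) fs`_j i 0.

Lemma unitri_unitmx n (xs : seq 'rV[K]_n) fs : unitri xs fs ->
  rowsmx xs *m colsmx (size xs) fs \in unitmx.
Proof.
move=> tri; have E i j : (rowsmx xs *m colsmx (size xs) fs) i j = (xs`_i *m fs`_j) 0 0.
  by rewrite !mxE; apply: eq_bigr => k _; rewrite !mxE.
rewrite unitmxE det_trig.
  by rewrite big1 ?unitr1 // => i _; rewrite E unitri_diag // mxE.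
by apply/is_trig_mxP => i j lt_ij; rewrite E (unitri_upper tri) // mxE.
Qed.

(** Let U have the vectors as rows, Phi the functionals as columns, and let
    G = U Phi be their pairing, which is invertible.  Then
    P = Phi G^-1 U is an idempotent with the row space of U, and the two stability
    hypotheses make P commute with the arrows.  As P is nonzero,
    indecomposability gives P = 1, so the vectors form bases of all the
    spaces. *)
Theorem unitri_std N (xs : forall v, seq 'rV[K]_(d v)) (fs : forall v, seq 'cV[K]_(d v)) :
  rep_indec -> (forall v, unitri (xs v) (fs v)) -> (exists v, xs v <> [::]) ->
  (forall v, (size (xs v) <= N)%N) ->
  (forall s t, Q s t -> forall x, x \in xs s -> comb01 (xs t) (x *m X s t)) ->
  (forall s t, Q s t -> forall f, f \in fs t -> cspan (fs s) (X s t *m f)) ->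
  rep_std N.
Proof.
move=> [_ indec] tri [v0 nz] szN cx cf.
pose k v := size (xs v).
pose U v : 'M_(k v, d v) := rowsmx (xs v).
pose Phi v : 'M_(d v, k v) := colsmx (k v) (fs v).
pose G v := U v *m Phi v.
have uG v : G v \in unitmx by apply: unitri_unitmx.
have N_gt0 : (0 < N)%N by apply: leq_trans (szN v0); case: (xs v0) nz.
have UX s t : Q s t -> exists2 B : 'M[nat]_(k s, k t),
    (forall i j, B i j <= N)%N & U s *m X s t = natmx B *m U t.
  move=> Qst; have /choice[c cE] : forall i : 'I_(k s), exists c : nat -> bool,
      (xs s)`_i *m X s t = \sum_(j < k t) (c j)%:R *: (xs t)`_j.
    by move=> i; apply: cx => //; apply: mem_nth.
  exists (\matrix_(i, j) nat_of_bool (c i j)) => [i j|].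
    by rewrite mxE (leq_trans (leq_b1 _)).
  apply/row_matrixP => i.
  rewrite !row_mul rowK cE mulmx_sum_row; apply: eq_bigr => j _.
  by rewrite rowK !mxE.
have XPhi s t : Q s t -> exists D : 'M_(k s, k t), X s t *m Phi t = Phi s *m D.
  move=> Qst; have /choice[c cE] : forall j : 'I_(k t), exists c : nat -> K,
      X s t *m (fs t)`_j = \sum_(i < k s) c i *: (fs s)`_i.
    move=> j; have [c e] : cspan (fs s) (X s t *m (fs t)`_j).
      by apply: cf => //; apply: mem_nth; rewrite (unitri_size (tri t)).
    by exists c; rewrite e (unitri_size (tri s)).
  exists (\matrix_(i, j) c j i); apply/matrixP => a j.
  have /matrixP/(_ a 0) := cE j; rewrite !mxE summxE.
  under eq_bigr do rewrite -[fs t]/(fs t).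
  move=> e; transitivity (\sum_j0 X s t a j0 * (fs t)`_j j0 0).
    by apply: eq_bigr => b _; rewrite !mxE.
  by rewrite e; apply: eq_bigr => i _; rewrite !mxE mulrC.
pose P v : 'M_(d v) := Phi v *m invmx (G v) *m U v.
have PP v : P v *m P v = P v.
  rewrite /P -!mulmxA (mulmxA (U v)) -/(G v) (mulmxA (invmx (G v)) (G v)).
  by rewrite mulVmx // mul1mx.
have PX s t : Q s t -> P s *m X s t = X s t *m P t.
  move=> Qst; have [B _ UB] := UX s t Qst; have [D XD] := XPhi s t Qst.
  rewrite /P -!mulmxA UB [X s t *m _]mulmxA XD -mulmxA; congr (_ *m _).
  have e : natmx B *m G t = G s *m D by rewrite /G mulmxA -UB -!mulmxA XD.
  rewrite !mulmxA; congr (_ *m _).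
  apply: (can_inj (mulKmx (uG s))); rewrite !mulmxA mulmxV // mul1mx.
  by rewrite -e mulmxK.
case: (indec P PP PX) => [P0 | P1].
  have k_gt0 : (0 < k v0)%N by rewrite /k; case: (xs v0) nz.
  have : G v0 *m (invmx (G v0) *m G v0) = 0.
    have -> : G v0 *m (invmx (G v0) *m G v0) = U v0 *m P v0 *m Phi v0.
      by rewrite /G /P !mulmxA.
    by rewrite P0 mulmx0 mul0mx.
  rewrite mulVmx // mulmx1 => G0; have := uG v0; rewrite G0 => u0.
  have := mulmxV u0; rewrite mul0mx => /matrixP/(_ (Ordinal k_gt0) (Ordinal k_gt0)).
  by rewrite !mxE eqxx => /eqP; rewrite eq_sym oner_eq0.
exists k; split=> //; exists U, (fun v => Phi v *m invmx (G v)); split=> // v.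
by rewrite mulmxA -/(G v) mulmxV.
Qed.

End Rep.

Lemma comb01_0 n (s : seq 'rV[K]_n) : comb01 s 0.
Proof. by exists (fun=> false); rewrite big1 // => i _; rewrite scale0r. Qed.

Lemma comb01_cons n y (s : seq 'rV[K]_n) (b : bool) x :
  comb01 s (x - b%:R *: y) -> comb01 (y :: s) x.
Proof.
case=> c e; exists (fun i => if i is j.+1 then c j else b).
by rewrite big_ord_recl /= -e addrC subrK.
Qed.

Lemma comb01_mem n (s : seq 'rV[K]_n) x : x \in s -> comb01 s x.
Proof.
elim: s => // y s IH; rewrite inE => /predU1P[->|/IH h].
  by apply: (@comb01_cons _ _ _ true); rewrite scale1r subrr; apply: comb01_0.
by apply: (@comb01_cons _ _ _ false); rewrite scale0r subr0.
Qed.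

Lemma cspan_0 n (s : seq 'cV[K]_n) : cspan s 0.
Proof. by exists (fun=> 0); rewrite big1 // => i _; rewrite scale0r. Qed.

Lemma cspan_cons n y (s : seq 'cV[K]_n) c x :
  cspan s (x - c *: y) -> cspan (y :: s) x.
Proof.
case=> a e; exists (fun i => if i is j.+1 then a j else c).
by rewrite big_ord_recl /= -e addrC subrK.
Qed.

Lemma cspan_mem n (s : seq 'cV[K]_n) x : x \in s -> cspan s x.
Proof.
elim: s => // y s IH; rewrite inE => /predU1P[->|/IH h].
  by apply: (@cspan_cons _ _ _ 1); rewrite scale1r subrr; apply: cspan_0.
by apply: (@cspan_cons _ _ _ 0); rewrite scale0r subr0.
Qed.

End GradedRep.

Section Bridge.
Variables (K : fieldType) (A : algType K) (r : nat) (F : nat -> nat -> A).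
Variables (gamma : nat -> nat -> nat -> K) (Q : rel nat).

(** F s t is a basis of the morphisms from s to t in a linear category with
    objects 0, ..., r and gamma gives the composition. *)
Record graded_basis : Prop := GradedBasis {
  gb_orth : forall s t u v, t != u -> F u v * F s t = 0;
  gb_comp : forall s t u, (s <= t <= u)%N -> F t u * F s t = gamma s t u *: F s u;
  gb_out : forall s t, ~~ (s <= t <= r)%N -> F s t = 0;
  gb_one : \sum_(s < r.+1) F s s = 1;
  gb_unitl : forall s t, gamma s s t = 1;
  gb_unitr : forall s t, gamma s t t = 1 }.

Definition arrows (st : 'I_r.+1 * 'I_r.+1) : A :=
  if (st.1 == st.2) || Q st.1 st.2 then F st.1 st.2 else 0.

Definition graded_rep (d : nat -> nat) (X : forall s t, 'M[K]_(d s, d t)) :=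
  [/\ forall v, (r < v)%N -> d v = 0%N, forall s, X s s = 1%:M
    & forall s t u, (s <= t <= u)%N -> X s t *m X t u = gamma s t u *: X s u].

(** The idempotents F v v cut a module into weight spaces, with I_ v the
    inclusion and J_ v the projection of the v-th one.  A compatible family of
    idempotents on the weight spaces is assembled into one of the whole
    module, and bases of the weight spaces into a basis of it. *)
Theorem finite_type_graded N :
  graded_basis -> generates arrows -> (forall s t, Q s t -> (s < t)%N) ->
  (forall d X, @graded_rep d X -> rep_indec Q X -> rep_std Q X N) ->
  finite_type A.
Proof.
move=> [orth comp out one ul ur] gen Qlt std.
apply: (finite_type_standard (N := r.+1 * N) gen) => n R [linR R1 RM] [n_gt0 indR].
have R0 : R 0 = 0.
  have := linR (-1) 0 0; rewrite scaler0 addr0 => e.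
  by rewrite e scaleN1r addNr.
have Rsum I (s : seq I) (f : I -> A) : R (\sum_(i <- s) f i) = \sum_(i <- s) R (f i).
  elim: s => [|i s IH]; first by rewrite !big_nil.
  by rewrite !big_cons -[f i]scale1r linR IH !scale1r.
have RZ c a : R (c *: a) = c *: R a by rewrite -[c *: a]addr0 linR R0 addr0.
pose e v := R (F v v).
pose d v := \rank (e v).
pose I_ v : 'M_(d v, n) := row_base (e v).
pose J_ v : 'M_(n, d v) := e v *m pinvmx (I_ v).
have FF s t : F t t * F s t = F s t.
  have [lest|] := boolP (s <= t <= r)%N; last by move/out->; rewrite mulr0.
  by have /andP[le_st _] := lest; rewrite comp ?ur ?scale1r // le_st leqnn.
have FF' s t : F s t * F s s = F s t.
  have [lest|] := boolP (s <= t <= r)%N; last by move/out->; rewrite mul0r.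
  by have /andP[le_st _] := lest; rewrite comp ?ul ?scale1r // le_st leqnn.
have ee v : e v *m e v = e v by rewrite /e -RM FF.
have eF s t : e s *m R (F s t) = R (F s t) by rewrite /e -RM FF'.
have Fe s t : R (F s t) *m e t = R (F s t) by rewrite /e -RM FF.
have Ie v : I_ v *m e v = I_ v.
  have /submxP[D ->] : (I_ v <= e v)%MS by rewrite eq_row_base.
  by rewrite -mulmxA ee.
have IJ v : I_ v *m J_ v = 1%:M.
  rewrite /J_ mulmxA Ie.
  by have := mulmxKp (row_base_free (e v)) 1%:M; rewrite mul1mx.
have JI v : J_ v *m I_ v = e v.
  by rewrite /J_ mulmxKpV // eq_row_base.
have eJ v : e v *m J_ v = J_ v by rewrite /J_ mulmxA ee.
have IJ0 v w : v != w -> I_ v *m J_ w = 0.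
  move=> ne; rewrite -Ie -eJ -mulmxA (mulmxA (e v)) /e -RM orth //.
  by rewrite R0 mul0mx mulmx0.
clearbody J_; clearbody I_.
pose X s t := I_ s *m R (F s t) *m J_ t.
have RX s t : R (F s t) = J_ s *m X s t *m I_ t.
  by rewrite /X !mulmxA JI eF -mulmxA JI Fe.
have d_out v : (r < v)%N -> d v = 0%N.
  move=> ltv; rewrite /d /e out ?R0 ?mxrank0 //.
  by rewrite negb_and -!ltnNge ltv orbT.
have rX : graded_rep X.
  split=> // [s|s t u le_stu]; first by rewrite /X Ie IJ.
  rewrite /X -!mulmxA.
  rewrite (mulmxA (J_ t)) JI (mulmxA (R _) (e t)) Fe.
  by rewrite (mulmxA (R _) (R _)) -RM comp // RZ -scalemxAl -scalemxAr.
clearbody X.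
have eI : \sum_(v < r.+1) J_ v *m I_ v = 1%:M.
  by rewrite -R1 -one Rsum; apply: eq_bigr => v _; rewrite JI.
have iX : rep_indec Q X.
  split.
    apply: contrapT => /forallNP d0; apply: n_gt0.
    have e0 v : e v = 0.
      apply/eqP; rewrite -mxrank_eq0; apply/eqP.
      by have /contrapT := d0 v.
    have : (1%:M : 'M[K]_n) = 0.
      by rewrite -eI big1 // => v _; rewrite JI e0.
    move/matrixP; case: (n) => // m /(_ ord0 ord0); rewrite !mxE eqxx => /eqP.
    by rewrite oner_eq0.
  move=> P PP PX.
  pose BP := \sum_(v < r.+1) J_ v *m P v *m I_ v.
  have IBP (v : 'I_r.+1) : I_ v *m BP = P v *m I_ v.
    rewrite /BP mulmx_sumr (bigD1 v) //= big1 ?addr0 => [|w ne].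
      by rewrite !mulmxA IJ mul1mx.
    by rewrite !mulmxA IJ0 ?mul0mx // eq_sym.
  have BPJ (v : 'I_r.+1) : BP *m J_ v = J_ v *m P v.
    rewrite /BP mulmx_suml (bigD1 v) //= big1 ?addr0 => [|w ne].
      by rewrite -!mulmxA IJ mulmx1.
    by rewrite -!mulmxA IJ0 ?mulmx0.
  have BPBP : BP *m BP = BP.
    rewrite {1}/BP mulmx_suml; apply: eq_bigr => v _.
    by rewrite -!mulmxA IBP (mulmxA (P v)) PP.
  have small v (Y Z : 'M_(d v)) : (r < v)%N -> Y = Z.
    by move=> ltv; apply/matrixP => -[i lti]; exfalso; rewrite d_out in lti.
  have BPR a : BP *m R a = R a *m BP.
    move: a; apply: gen.
    - by rewrite R1 mulmx1 mul1mx.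
    - move=> c a b ha hb; rewrite linR mulmxDl mulmxDr.
      by rewrite -scalemxAl -scalemxAr ha hb.
    - by move=> a b ha hb; rewrite RM mulmxA hb -mulmxA ha mulmxA.
    move=> [s t]; rewrite /arrows /=; case: ifP => [|_]; last first.
      by rewrite R0 mul0mx mulmx0.
    move=> Qst; rewrite RX !mulmxA BPJ -!mulmxA IBP !mulmxA; congr (_ *m _).
    rewrite -!mulmxA; congr (_ *m _).
    case/orP: Qst => [/eqP e_st|]; last by move/PX.
    by rewrite -e_st; case: rX => _ -> _; rewrite mulmx1 mul1mx.
  have PE (v : 'I_r.+1) : P v = I_ v *m BP *m J_ v.
    by rewrite IBP -mulmxA IJ mulmx1.
  case: (indR BP BPBP BPR) => BPE; [left|right] => v.
    have [ltv|lev] := ltnP r v; first exact: small.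
    by rewrite (PE (Ordinal (lev : v < r.+1)%N)) BPE mulmx0 mul0mx.
  have [ltv|lev] := ltnP r v; first exact: small.
  by rewrite (PE (Ordinal (lev : v < r.+1)%N)) BPE mulmx1 IJ.
have [k [kN [T [S [TS ST QX]]]]] := std d X rX iX.
exists (\sum_(v < r.+1) k v)%N.
  apply: (@leq_trans (\sum_(v < r.+1) N)%N); first exact: leq_sum.
  by rewrite sum_nat_const card_ord.
exists (\mxcol_(v < r.+1) (T v *m I_ v)), (\mxrow_(v < r.+1) (J_ v *m S v)).
split.
- rewrite mul_mxcol_mxrow -mxdiagZ; apply: eq_mxblock => v w.
  have [<-|ne] := eqVneq v w.
    by rewrite conform_mx_id -mulmxA (mulmxA (I_ v)) IJ mul1mx TS.
  by rewrite -mulmxA (mulmxA (I_ v)) IJ0 // mul0mx mulmx0.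
- rewrite mul_mxrow_mxcol -eI; apply: eq_bigr => v _.
  by rewrite -mulmxA (mulmxA (S v)) ST mul1mx.
move=> [s t].
have : exists2 B : 'M[nat]_(k s, k t),
    (forall i j, B i j <= N)%N & T s *m I_ s *m R (arrows (s, t)) *m (J_ t *m S t) = natmx K B.
  rewrite /arrows /=; case: ifP => [|_]; last first.
    exists (const_mx 0%N) => [i j|]; first by rewrite mxE.
    by rewrite R0 mulmx0 mul0mx; apply/matrixP => i j; rewrite !mxE.
  rewrite RX => /orP[/eqP e_st|/QX[B leB TB]]; last first.
    exists B => //; rewrite -!mulmxA (mulmxA (I_ t)) IJ mul1mx (mulmxA (I_ s)) IJ mul1mx.
    by rewrite mulmxA TB -mulmxA TS mulmx1.
  exists (\matrix_(i, j) nat_of_bool (val i == val j)) => [i j|].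
    rewrite mxE (leq_trans (leq_b1 _)) // (leq_trans _ (kN s)) //.
    exact: leq_ltn_trans (leq0n i) (ltn_ord i).
  rewrite -e_st; case: rX => _ -> _; rewrite -!mulmxA mul1mx.
  rewrite (mulmxA (I_ s)) IJ mul1mx (mulmxA (I_ s)) IJ mul1mx TS.
  by apply/matrixP => i j; rewrite !mxE.
case=> B leB TB.
suff H : forall i j, exists2 b : nat, (b <= N)%N &
    (\mxcol_(v < r.+1) (T v *m I_ v) *m R (arrows (s, t)) *m
     \mxrow_(v < r.+1) (J_ v *m S v)) i j = b%:R.
  exists (\matrix_(i, j) s2val (cid2 (H i j))) => [i j|].
    by rewrite mxE; case: cid2 => b /= le_b _; rewrite (leq_trans le_b) ?leq_pmull.
  by apply/matrixP => i j; rewrite [RHS]mxE [in RHS]mxE; case: cid2.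
move=> i j; rewrite mxcol_mul mul_mxcol_mxrow mxE.
move: (tagnat.sig2 i) (tagnat.sig2 j).
move: (tagnat.sig1 i) (tagnat.sig1 j) => v w i' j'.
have [evs|nvs] := eqVneq v s; last first.
  exists 0%N => //; rewrite /arrows /=; case: ifP => _; last by rewrite R0 mulmx0 mul0mx mxE.
  by rewrite RX !mulmxA -(mulmxA _ (I_ v)) IJ0 // mulmx0 !mul0mx mxE.
have [ewt|nwt] := eqVneq w t; last first.
  exists 0%N => //; rewrite /arrows /=; case: ifP => _; last by rewrite R0 mulmx0 mul0mx mxE.
  by rewrite RX -!mulmxA (mulmxA (I_ t)) IJ0 ?mul0mx ?mulmx0 ?mxE // eq_sym.
by move: i' j'; rewrite evs ewt => i' j'; exists (B i' j') => //; rewrite TB mxE.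
Qed.

End Bridge.

(** * Filtrations, linear quivers and one long arrow *)
Section LinearAlgebra.
Variable K : fieldType.

Lemma thin_col n (x y : 'cV[K]_n) : n = 0%N -> x = y.
Proof. by move=> n0; apply/colP => -[i lti]; exfalso; rewrite n0 in lti. Qed.

(** The columns of the cokernel of U are functionals killing U whose common
    kernel is U. *)
Lemma functional_sep m n (x : 'rV[K]_n) (U : 'M[K]_(m, n)) :
  ~~ (x <= U)%MS -> exists f : 'cV[K]_n, x *m f = 1%:M /\ U *m f = 0.
Proof.
rewrite submxE => /rV0Pn[j nz]; set c := _ 0 j in nz.
exists (c^-1 *: col j (cokermx U)); split.
  rewrite -scalemxAr colE mulmxA -colE [col j _]mx11_scalar mxE -/c.
  by rewrite scale_scalar_mx mulVf.
by rewrite -scalemxAr colE mulmxA mulmx_coker mul0mx scaler0.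
Qed.

Lemma functional_sep0 n (x : 'rV[K]_n) :
  x != 0 -> exists f : 'cV[K]_n, x *m f = 1%:M.
Proof.
move=> nzx; have nx : ~~ (x <= (0 : 'M_n))%MS by rewrite submx0.
by have [f [xf _]] := functional_sep nx; exists f.
Qed.

(** The functional psi descends to the image of C, and extends from there. *)
Lemma functional_ext m n (C : 'M[K]_(m, n)) (psi : 'cV[K]_m) :
  (forall u : 'rV_m, u *m C = 0 -> u *m psi = 0) ->
  exists phi : 'cV[K]_n, C *m phi = psi.
Proof.
move=> kC; exists (pinvmx C *m psi).
apply/eqP; rewrite mulmxA -subr_eq0 -{2}[psi]mul1mx -mulmxBl; apply/eqP.
apply/row_matrixP => i; rewrite row_mul row0; apply: kC.
by rewrite -row_mul mulmxBl mul1mx mulmxKpV // subrr row0.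
Qed.

Definition preim_mx m n k (X : 'M[K]_(m, n)) (S : 'M[K]_(k, n)) : 'M[K]_m :=
  kermx (X *m cokermx S).

Lemma sub_preim l m n k (Y : 'M[K]_(l, m)) (X : 'M[K]_(m, n)) (S : 'M[K]_(k, n)) :
  (Y <= preim_mx X S)%MS = (Y *m X <= S)%MS.
Proof. by rewrite /preim_mx sub_kermx mulmxA submxE. Qed.

Lemma sub_ker l m n (Y : 'M[K]_(l, m)) (X : 'M[K]_(m, n)) :
  (Y <= kermx X)%MS -> Y *m X = 0.
Proof. by move/sub_kermxP. Qed.

(** Dual form of taking preimages: a functional that kills the preimage of S
    under X is pulled back from one that kills S. *)
Lemma functional_preim m n k (X : 'M[K]_(m, n)) (S : 'M[K]_(k, n)) (eta : 'cV[K]_m) :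
  preim_mx X S *m eta = 0 ->
  exists psi : 'cV[K]_n, S *m psi = 0 /\ X *m psi = eta.
Proof.
move=> kS; have [u uC|phi e] := @functional_ext _ _ (X *m cokermx S) eta.
  have /submxP[D ->] : (u <= preim_mx X S)%MS by apply/sub_kermxP.
  by rewrite -mulmxA kS mulmx0.
by exists (cokermx S *m phi); rewrite mulmxA mulmx_coker mul0mx mulmxA.
Qed.

Lemma functional_ker m n (X : 'M[K]_(m, n)) (eta : 'cV[K]_m) :
  kermx X *m eta = 0 -> exists psi : 'cV[K]_n, X *m psi = eta.
Proof.
move=> kX; have [u /sub_kermxP/submxP[D ->]|psi e] := @functional_ext _ _ X eta.
  by rewrite -mulmxA kX mulmx0.
by exists psi.
Qed.

Lemma sub_kills l m n (Y : 'M[K]_(l, n)) (U : 'M[K]_(m, n)) (f : 'cV[K]_n) :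
  (Y <= U)%MS -> U *m f = 0 -> Y *m f = 0.
Proof. by case/submxP=> D -> Uf; rewrite -mulmxA Uf mulmx0. Qed.

(** Choose i minimal, then j minimal, such that F_i and G_j share a vector x
    outside F_0 + G_0.  If x were in F_(i-1) + G_(j-1), one of its two
    components would contradict minimality.  So some functional f kills
    F_(i-1) and G_(j-1) but not x: both x and f sit at the jumps of the two
    filtrations. *)
Lemma butterfly n (F G : nat -> 'M[K]_n) a b :
  (forall i, (F i <= F i.+1)%MS) -> (forall j, (G j <= G j.+1)%MS) ->
  F a = 1%:M -> G b = 1%:M -> ~~ (1%:M <= F 0%N + G 0%N)%MS ->
  exists i j (x : 'rV[K]_n) (f : 'cV[K]_n),
   [/\ (i < a)%N, (j < b)%N, (x <= F i.+1)%MS, (x <= G j.+1)%MS &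
    [/\ x *m f = 1%:M, F i *m f = 0 & G j *m f = 0]].
Proof.
move=> mF mG Fa Gb.
pose E i j := `[< exists x : 'rV_n, [/\ (x <= F i)%MS, (x <= G j)%MS & ~~ (x <= F 0%N + G 0%N)%MS] >].
move=> nfull; have [i0 nx0] := row_subPn nfull.
have exi : exists i, `[< exists j, E i j >].
  exists a; apply/asboolP; exists b; apply/asboolP; exists (row i0 1%:M).
  by rewrite Fa Gb !submx1.
case: (ex_minnP exi) => i /asboolP exj min_i.
have Ea : E a b by apply/asboolP; exists (row i0 1%:M); rewrite Fa Gb !submx1.
have lia_ : (i <= a)%N by apply: min_i; apply/asboolP; exists b.
case: (ex_minnP exj) => j Eij min_j.
move/asboolP: (Eij) => [x [xF xG nx]].
have mF0 k : (F 0%N <= F k)%MS by elim: k => // k IH; apply: submx_trans (mF k).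
case: i => [|i] in exj min_i lia_ Eij min_j xF *.
  by case/negP: nx; apply: submx_trans xF (addsmxSl _ _).
case: j => [|j] in Eij min_j xG *.
  by case/negP: nx; apply: submx_trans xG (addsmxSr _ _).
have ltjb : (j < b)%N.
  apply: min_j; apply/asboolP; exists x; split=> //.
  by rewrite Gb submx1.
have nxij : ~~ (x <= F i + G j)%MS.
  apply/negP => /sub_addsmxP[[u w] /= xE].
  have uF : (u *m F i <= F i)%MS by rewrite submxMl.
  have wG : (w *m G j <= G j)%MS by rewrite submxMl.
  have u0 : (u *m F i <= F 0%N + G 0%N)%MS.
    apply/negP => /negP nu.
    suff /min_i : `[< exists j, E i j >] by rewrite ltnn.
    apply/asboolP; exists j.+1; apply/asboolP; exists (u *m F i); split=> //.
    have -> : u *m F i = x - w *m G j by rewrite xE addrK.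
    by apply: addmx_sub => //; rewrite eqmx_opp (submx_trans wG).
  have w0 : (w *m G j <= F 0%N + G 0%N)%MS.
    apply/negP => /negP nw.
    suff /min_j : E i.+1 j by rewrite ltnn.
    apply/asboolP; exists (w *m G j); split=> //.
    have -> : w *m G j = x - u *m F i by rewrite xE addrC addKr.
    by apply: addmx_sub => //; rewrite eqmx_opp (submx_trans uF).
  by case/negP: nx; rewrite xE addmx_sub.
have [f [xf ]] := functional_sep nxij.
move=> FGf; exists i, j, x, f; split=> //; split=> //.
  by apply: sub_kills FGf; apply: addsmxSl.
by apply: sub_kills FGf; apply: addsmxSr.
Qed.

End LinearAlgebra.

(* Pth s t stands for the composite of the steps from s to t. *)
Section Chains.
Variables (K : fieldType) (d : nat -> nat) (X Pth : forall s t, 'M[K]_(d s, d t)).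
Variable r : nat.
Hypothesis d_out : forall v, (r < v)%N -> d v = 0%N.
Hypothesis Pth1 : forall s, Pth s s = 1%:M.
Hypothesis PthM : forall s t u, (s <= t <= u)%N -> Pth s t *m Pth t u = Pth s u.
Hypothesis XP : forall s, X s s.+1 = Pth s s.+1.

(** Take the first nonzero space V_i, a vector in it that survives as long as
    possible, say to V_j, and a functional on V_j not killing its image.  The
    images of the vector and the pullbacks of the functional give a summand. *)
Theorem linear_std (Q : rel nat) :
  (forall s t, Q s t -> t = s.+1 \/ X s t = 0) ->
  rep_indec Q X -> rep_std Q X 1.
Proof.
move=> QX iX; have [[v0 nv0] _] := iX.
have exi : exists v, d v != 0%N by exists v0; apply/eqP.
case: (ex_minnP exi) => i ndi min_i.
have le_ir : (i <= r)%N by rewrite leqNgt; apply/negP => /d_out/eqP; rewrite (negPf ndi).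
have lt_d v : (v < i)%N -> d v = 0%N.
  by move=> lt; apply/eqP; apply: contraTT lt => /min_i; rewrite -leqNgt.
have exj : exists j, (i <= j)%N && (Pth i j != 0).
  exists i; rewrite leqnn Pth1 /=; apply/eqP => /matrixP e.
  have di : (0 < d i)%N by rewrite lt0n.
  by have := e (Ordinal di) (Ordinal di); rewrite !mxE eqxx => /eqP; rewrite oner_eq0.
have bndj j : (i <= j)%N && (Pth i j != 0) -> (j <= r)%N.
  case/andP=> _; apply: contraR; rewrite -ltnNge => ltrj.
  by apply/eqP/matrixP => a [b ltb]; exfalso; rewrite d_out in ltb.
case: (ex_maxnP exj bndj) => j /andP[le_ij nPij] max_j.
have [a na] : exists a, row a (Pth i j) != 0.
  have /row_subPn[a] : ~~ (Pth i j <= (0 : 'M_(d j)))%MS by rewrite submx0.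
  by rewrite submx0; exists a.
pose x : 'rV[K]_(d i) := delta_mx 0 a.
have nx : x *m Pth i j != 0 by rewrite -rowE.
have [f xf] := functional_sep0 nx.
pose on v := (i <= v <= j)%N.
apply: (@unitri_std _ _ _ _ 1 (fun v => if on v then [:: x *m Pth i v] else [::])
   (fun v => if on v then [:: Pth v j *m f] else [::])) => //.
- move=> v; rewrite /on; case: ifP => //= /andP[le1 le2]; split=> //.
  by rewrite -mulmxA (mulmxA (Pth i v)) PthM ?le1 // mulmxA.
- by exists i; rewrite /on leqnn le_ij.
- by move=> v; case: ifP.
- move=> s t /QX Qst y; rewrite {1}/on; case: ifP => //= /andP[le1 le2].
  rewrite inE => /eqP->; case: Qst => [->|->]; last by rewrite mulmx0; apply: comb01_0.
  rewrite XP -mulmxA PthM ?le1 //=; rewrite /on (leqW le1) /=.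
  have [lt|le] := ltnP s j; first by apply: comb01_mem; rewrite inE.
  have -> : Pth i s.+1 = 0; last by rewrite mulmx0; apply: comb01_0.
  apply/eqP; apply: contraT => n; have := max_j s.+1; rewrite n leqW // => /(_ isT).
  by rewrite leqNgt ltnS le.
move=> s t /QX Qst y; rewrite {1}/on; case: ifP => //= /andP[le1 le2].
rewrite inE => /eqP->; case: Qst => [e|->]; last by rewrite mul0mx; apply: cspan_0.
subst t; rewrite XP mulmxA PthM ?leqnSn //.
rewrite /on; have [le|lt] := leqP i s; last first.
  rewrite andFb; rewrite [X in cspan _ X](@thin_col _ _ _ 0) ?lt_d //.
  exact: cspan_0.
by rewrite (ltnW le2) andTb; apply: cspan_mem; rewrite inE.
Qed.

Definition arrow p : rel nat :=
  fun s t => (t <= r)%N && ((t == s.+1) || (t == (s + p)%N)).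

(** When the long arrow b : V_0 -> V_r is not zero, take the least j such that
    b is not zero on the kernel of V_0 -> V_j, a vector x there, and the least
    i such that b x is in the image of V_i -> V_r, say of z.  The summand is
    the string x -> ... -> V_(j-1) and z -> ... -> b x, joined by b. *)
Theorem loop_std : (1 < r)%N -> Pth 0 r = 0 ->
  rep_indec (arrow r) X -> rep_std (arrow r) X 2.
Proof.
move=> r_gt1 P0r iX; pose b := X 0%N r.
have [b0|nb] := eqVneq b 0.
  apply: (@rep_std_leq _ _ _ _ 1) => //.
  apply: linear_std iX => s t /andP[le_tr /orP[/eqP->|/eqP e]]; first by left.
  have s0 : s = 0%N by lia.
  by right; rewrite s0 in e *; rewrite add0n in e; rewrite e.
have exj : exists j, `[< exists x : 'rV_(d 0), x *m Pth 0 j = 0 /\ x *m b != 0 >].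
  exists r; apply/asboolP.
  have [a na] : exists a, row a b != 0.
    apply: contrapT => /forallNP h; case/negP: nb; apply/eqP/row_matrixP => a.
    by rewrite row0; apply/eqP; apply: contraT => /(h a).
  by exists (delta_mx 0 a); rewrite P0r mulmx0 -rowE.
case: (ex_minnP exj) => j /asboolP[x [xj nxb]] min_j.
have le_jr : (j <= r)%N.
  apply: min_j; apply/asboolP; exists x; by rewrite P0r mulmx0.
case: j => [|j] in xj min_j le_jr *.
  by move: xj nxb; rewrite Pth1 mulmx1 => ->; rewrite mul0mx eqxx.
have exi : exists i, (i <= r)%N && (x *m b <= Pth i r)%MS.
  by exists r; rewrite leqnn Pth1 submx1.
case: (ex_minnP exi) => i /andP[le_ir xbi] min_i.
case: i => [|i] in le_ir xbi min_i *.
  by case/submxP: xbi => D; rewrite P0r mulmx0 => e; rewrite e eqxx in nxb.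
have [z zE] := submxP xbi.
(* i is now one less than the minimum, so x b is not in the image of V_i *)
have [|psi [xpsi Ppsi]] := @functional_sep _ _ _ (x *m b) (Pth i r).
  by apply/negP => h; have := min_i i; rewrite h ltnW // ltnn => /(_ isT).
(* j is now one less than the minimum, so b vanishes on the kernel of V_0 -> V_j *)
have [u uj|phi phiE] := @functional_ext _ _ _ (Pth 0 j) (b *m psi).
  rewrite mulmxA; suff -> : u *m b = 0 by rewrite mul0mx.
  apply/eqP; apply: contraT => nub; have := min_j j.
  by rewrite ltnn => -> //; apply/asboolP; exists u.
pose xs v := (if (v <= j)%N then [:: x *m Pth 0 v] else [::]) ++
             (if (i < v <= r)%N then [:: z *m Pth i.+1 v] else [::]).
pose fs v := (if (v <= j)%N then [:: Pth v j *m phi] else [::]) ++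
             (if (i < v <= r)%N then [:: Pth v r *m psi] else [::]).
apply: (@unitri_std _ _ _ _ 2 xs fs) => //.
- move=> v; rewrite /xs /fs.
  have e1 : (v <= j)%N -> x *m Pth 0 v *m (Pth v j *m phi) = 1%:M.
    move=> le_vj; rewrite -mulmxA (mulmxA (Pth 0 v)) PthM ?le_vj // phiE.
    by rewrite mulmxA.
  have e2 : (i < v <= r)%N -> z *m Pth i.+1 v *m (Pth v r *m psi) = 1%:M.
    move=> le_v; rewrite -mulmxA (mulmxA (Pth i.+1 v)) PthM ?le_v //.
    by rewrite mulmxA -zE.
  have e3 : (i < v <= r)%N -> x *m Pth 0 v *m (Pth v r *m psi) = 0.
    case/andP=> _ le_vr.
    by rewrite -mulmxA (mulmxA (Pth 0 v)) PthM ?le_vr // P0r mul0mx mulmx0.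
  by case: ifP => h1; case: ifP => h2 /=; split=> //; rewrite ?e1 ?e2 ?e3.
- by exists 0%N.
- by move=> v; rewrite /xs; case: ifP; case: ifP.
- move=> s t /andP[le_tr /orP[/eqP e|/eqP e]] y; last first.
    have s0 : s = 0%N by lia.
    subst s; rewrite add0n in e; subst t; rewrite {1}/xs /= inE => /eqP->.
    rewrite Pth1 mulmx1 -/b zE; apply: comb01_mem.
    by rewrite /xs mem_cat le_ir leqnn /= ?inE eqxx orbT.
  subst t; rewrite {1}/xs mem_cat => /orP[].
    case: ifP => // le_sj; rewrite inE => /eqP->.
    rewrite XP -mulmxA PthM ?leqnSn //.
    have [lt|le] := ltnP s j.
      by apply: comb01_mem; rewrite /xs mem_cat lt /= ?inE eqxx.
    have -> : s = j by apply/eqP; rewrite eqn_leq le_sj.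
    by rewrite xj; apply: comb01_0.
  case: ifP => // /andP[lt_is le_sr]; rewrite inE => /eqP->.
  rewrite XP -mulmxA PthM ?leqnSn ?lt_is //.
  apply: comb01_mem; rewrite /xs mem_cat; apply/orP; right.
  by rewrite ltnS (ltnW lt_is) le_tr inE.
move=> s t /andP[le_tr /orP[/eqP e|/eqP e]] y; last first.
  have s0 : s = 0%N by lia.
  subst s; rewrite add0n in e; subst t; rewrite {1}/fs mem_cat => /orP[].
    by case: ifP => // h; lia.
  case: ifP => // _; rewrite inE => /eqP->.
  rewrite -/b Pth1 mul1mx -phiE; apply: cspan_mem.
  by rewrite /fs mem_cat /= ?inE eqxx.
subst t; rewrite {1}/fs mem_cat => /orP[].
  case: ifP => // lt_sj; rewrite inE => /eqP->.
  rewrite XP mulmxA PthM ?leqnSn //.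
  by apply: cspan_mem; rewrite /fs mem_cat ltnW //= ?inE eqxx.
case: ifP => // /andP[lt_is le_sr]; rewrite inE => /eqP->.
rewrite XP mulmxA PthM ?leqnSn //.
have [lt|le] := ltnP i s.
  apply: cspan_mem; rewrite /fs mem_cat; apply/orP; right.
  by rewrite lt (ltnW le_tr) inE.
have -> : s = i by apply/eqP; rewrite eqn_leq le.
by rewrite Ppsi; apply: cspan_0.
Qed.

End Chains.

(** * Two long arrows: the arms of the pentagon *)
Section Lists.
Variable K : fieldType.

(** The predicate is in Prop; on a concrete list it unfolds to a conjunction. *)
Fixpoint alls T (P : T -> Prop) (s : seq T) : Prop :=
  if s is x :: s' then P x /\ alls P s' else True.

Lemma alls_mem (T : eqType) (P : T -> Prop) s :
  alls P s -> forall x, x \in s -> P x.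
Proof.
elim: s => // y s IH /= [Py Ps] x; rewrite inE => /predU1P[->|] //.
exact: IH.
Qed.

Lemma alls_impl T (P P' : T -> Prop) s : (forall x, P x -> P' x) -> alls P s -> alls P' s.
Proof. by move=> PP'; elim: s => //= x s IH [/PP' ? /IH]. Qed.

Lemma alls_cat T (P : T -> Prop) s t : alls P s -> alls P t -> alls P (s ++ t).
Proof. by elim: s => //= x s IH [? ?] ?; split=> //; apply: IH. Qed.

Lemma comb01_catr n (s t : seq 'rV[K]_n) x : comb01 t x -> comb01 (s ++ t) x.
Proof.
by move=> h; elim: s => //= y s IH; apply: (@comb01_cons _ _ _ _ false); rewrite scale0r subr0.
Qed.

Lemma comb01_catl n (s t : seq 'rV[K]_n) x : comb01 s x -> comb01 (s ++ t) x.
Proof.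
elim: s x => [|y s IH] x [c] /=; first by rewrite big_ord0 => ->; apply: comb01_0.
rewrite big_ord_recl => ->; apply: (@comb01_cons _ _ _ _ (c 0%N)).
by apply: IH; exists (fun i => c i.+1); rewrite addrC addKr.
Qed.

Lemma cspan_catr n (s t : seq 'cV[K]_n) x : cspan t x -> cspan (s ++ t) x.
Proof.
by move=> h; elim: s => //= y s IH; apply: (@cspan_cons _ _ _ _ 0); rewrite scale0r subr0.
Qed.

Lemma cspan_catl n (s t : seq 'cV[K]_n) x : cspan s x -> cspan (s ++ t) x.
Proof.
elim: s x => [|y s IH] x [c] /=; first by rewrite big_ord0 => ->; apply: cspan_0.
rewrite big_ord_recl => ->; apply: (@cspan_cons _ _ _ _ (c 0%N)).
by apply: IH; exists (fun i => c i.+1); rewrite addrC addKr.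
Qed.

Lemma comb01_tl n y (t : seq 'rV[K]_n) x : comb01 t x -> comb01 (y :: t) x.
Proof. exact: (@comb01_catr _ [:: y]). Qed.
Lemma cspan_tl n y (t : seq 'cV[K]_n) x : cspan t x -> cspan (y :: t) x.
Proof. exact: (@cspan_catr _ [:: y]). Qed.
Lemma comb01_hd n y (t : seq 'rV[K]_n) : comb01 (y :: t) y.
Proof. by apply: comb01_mem; rewrite inE eqxx. Qed.
Lemma cspan_hd n y (t : seq 'cV[K]_n) : cspan (y :: t) y.
Proof. by apply: cspan_mem; rewrite inE eqxx. Qed.

Lemma kills_cat n (x : 'rV[K]_n) s t : kills x s -> kills x t -> kills x (s ++ t).
Proof. by elim: s => //= f s IH [? ?] ?; split=> //; apply: IH. Qed.

Lemma kills_alls n (P : 'cV[K]_n -> Prop) (x : 'rV[K]_n) s :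
  (forall f, P f -> x *m f = 0) -> alls P s -> kills x s.
Proof. by move=> h; elim: s => //= f s IH [/h ? /IH]. Qed.

Lemma unitri_cat n (s t : seq 'rV[K]_n) (f g : seq 'cV[K]_n) :
  unitri s f -> unitri t g -> alls (fun x => kills x g) s ->
  unitri (s ++ t) (f ++ g).
Proof.
elim: s f => [|x s IH] [|y f] //= [xy kx tri] tri' [kg all_s]; split=> //.
  exact: kills_cat.
exact: IH.
Qed.

Lemma unitri1 n (x : 'rV[K]_n) f : x *m f = 1%:M -> unitri [:: x] [:: f].
Proof. by []. Qed.

End Lists.

Section Pentagon.
Variable K : fieldType.

(** The quiver has steps a0, a1, a2, a3 and long arrows b0 : 0 -> 3 and
    b1 : 1 -> 4.  A vector x of V_1 can be continued to the left of the
    pentagon, along b1 and back up the arrows a3, a2 that end at the same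
    place, or to the right, along a1 a2 and back up b0 and then down a0, a1. *)
Section Arms.
Variables m0 m1 m2 m3 m4 : nat.
Variables (a0 : 'M[K]_(m0, m1)) (a1 : 'M[K]_(m1, m2)) (a2 : 'M[K]_(m2, m3)).
Variables (a3 : 'M[K]_(m3, m4)) (b0 : 'M[K]_(m0, m3)) (b1 : 'M[K]_(m1, m4)).
Hypothesis a012 : a0 *m a1 *m a2 = 0.
Hypothesis a123 : a1 *m a2 *m a3 = 0.
Hypothesis ab : a0 *m b1 = b0 *m a3.

(** How far up the steps the vector x b1 can be lifted: after 0, the levels are
    x b1 = 0, x b1 in the image of V_2, x b1 in the image of V_3, and no
    condition. *)
Definition lchain i : 'M[K]_m1 :=
  nth 1%:M [:: 0; kermx b1; preim_mx b1 (a2 *m a3); preim_mx b1 a3] i.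

Lemma lchain_homo i : (lchain i <= lchain i.+1)%MS.
Proof.
case: i => [|[|[|[|i]]]] /=; rewrite /lchain /= ?sub0mx ?submx1 //.
- by rewrite sub_preim mulmx_ker sub0mx.
have : (preim_mx b1 (a2 *m a3) *m b1 <= a2 *m a3)%MS by rewrite -sub_preim.
by rewrite sub_preim => /submx_trans -> //; apply: submxMl.
Qed.

(** The part of the summand that hangs on b1, for x and eta at a jump of lchain:
    the L are vectors and the M the dual functionals. *)
Lemma left_arm (i : nat) (x : 'rV[K]_m1) (eta : 'cV[K]_m1) : (i < 4)%N ->
  (x <= lchain i.+1)%MS -> lchain i *m eta = 0 -> x *m eta = 1%:M -> a0 *m eta = 0 ->
  exists (L2 : seq 'rV[K]_m2) (L3 : seq 'rV[K]_m3) (L4 : seq 'rV[K]_m4)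
         (M2 : seq 'cV[K]_m2) (M3 : seq 'cV[K]_m3) (M4 : seq 'cV[K]_m4),
  [/\ [/\ unitri L2 M2, unitri L3 M3 & unitri L4 M4],
      [/\ size L2 <= 1, size L3 <= 1 & size L4 <= 1]%N,
      [/\ comb01 L4 (x *m b1), alls (fun u => comb01 L3 (u *m a2)) L2
        & alls (fun w => comb01 L4 (w *m a3)) L3]
    & [/\ alls (fun f => cspan [:: eta] (b1 *m f) /\ cspan M3 (a3 *m f)) M4,
          alls (fun f => [/\ b0 *m f = 0, cspan M2 (a2 *m f) & exists g, f = a3 *m g]) M3
        & alls (fun f => a1 *m f = 0 /\ exists g, f = a2 *m (a3 *m g)) M2]].
Proof.
move=> lti xF Feta xeta a0eta.
have kb0 psi : b1 *m psi = eta -> b0 *m (a3 *m psi) = 0.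
  by move=> e; rewrite mulmxA -ab -mulmxA e.
case: i => [|[|[|[|//]]]] in lti xF Feta *; rewrite /lchain /= in xF Feta.
- exists [::], [::], [::], [::], [::], [::]; split; split=> //=.
  by rewrite (sub_ker xF); apply: comb01_0.
- have [psi pE] := functional_ker Feta.
  have := xF; rewrite sub_preim => /submxP[u uE].
  have p1 : u *m a2 *m a3 *m psi = 1%:M by rewrite -(mulmxA u) -uE -mulmxA pE.
  exists [:: u], [:: u *m a2], [:: x *m b1],
    [:: a2 *m (a3 *m psi)], [:: a3 *m psi], [:: psi].
  split; split=> //=; rewrite ?unitri1 //; try (split=> //).
  + by rewrite !mulmxA p1.
  + by rewrite !mulmxA p1.
  + by rewrite -mulmxA pE.
  + exact: comb01_hd.
  + exact: comb01_hd.
  + by rewrite uE mulmxA; apply: comb01_hd.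
  + by rewrite pE; split; apply: cspan_hd.
  + by split; [apply: kb0|apply: cspan_hd|exists psi].
  by split; [rewrite !mulmxA a123 mul0mx|exists psi].
- have [psi [ap bp]] := functional_preim Feta.
  have := xF; rewrite sub_preim => /submxP[w wE].
  have p1 : w *m a3 *m psi = 1%:M by rewrite -wE -mulmxA bp.
  exists [::], [:: w], [:: x *m b1], [::], [:: a3 *m psi], [:: psi].
  split; split=> //=; try (split=> //).
  + by rewrite !mulmxA p1.
  + by rewrite -mulmxA bp.
  + exact: comb01_hd.
  + by rewrite wE; apply: comb01_hd.
  + by rewrite bp; split; apply: cspan_hd.
  by split; [apply: kb0|rewrite mulmxA ap; apply: cspan_0|exists psi].
have [psi [ap bp]] := functional_preim Feta.
exists [::], [::], [:: x *m b1], [::], [::], [:: psi].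
split; split=> //=; try (split=> //).
+ by rewrite -mulmxA bp.
+ exact: comb01_hd.
by rewrite bp ap; split; [apply: cspan_hd|apply: cspan_0].
Qed.

Let phi := a1 *m a2.

(** Whether phi x can be lifted along b0, and how long the lift k survives
    along a0 and a1: the levels are phi x = 0, a lift killed by a0, a lift
    killed by a0 a1, some lift, and no condition. *)
Definition rchain j : 'M[K]_m1 :=
  nth 1%:M [:: kermx phi; preim_mx phi (kermx a0 *m b0);
               preim_mx phi (kermx (a0 *m a1) *m b0); preim_mx phi b0] j.

Lemma preim_homo l n k k' (Y : 'M[K]_(l, n)) (S : 'M_(k, n)) (S' : 'M_(k', n)) :
  (S <= S')%MS -> (preim_mx Y S <= preim_mx Y S')%MS.
Proof.
move=> SS'; rewrite sub_preim; apply: submx_trans SS'.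
by rewrite -sub_preim.
Qed.

Lemma ker_sub_preim l n k (Y : 'M[K]_(l, n)) (S : 'M_(k, n)) :
  (kermx Y <= preim_mx Y S)%MS.
Proof. by rewrite sub_preim mulmx_ker sub0mx. Qed.

Lemma rchain_homo j : (rchain j <= rchain j.+1)%MS.
Proof.
case: j => [|[|[|[|j]]]]; rewrite /rchain /=.
- exact: ker_sub_preim.
- apply: preim_homo; apply: submxMr; apply/sub_kermxP.
  by rewrite mulmxA mulmx_ker mul0mx.
- by apply: preim_homo; apply: submxMl.
- exact: submx1.
by rewrite nth_nil submx1.
Qed.

(** The part of the summand that hangs on phi x, for x and eta at a jump of rchain;
    eta3 is the functional on V_3 that pulls back to eta. *)
Lemma right_arm (j : nat) (x : 'rV[K]_m1) (eta : 'cV[K]_m1) : (j < 4)%N ->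
  (x <= rchain j.+1)%MS -> rchain j *m eta = 0 -> x *m eta = 1%:M ->
  exists (eta3 : 'cV[K]_m3)
         (R0 : seq 'rV[K]_m0) (R1 : seq 'rV[K]_m1) (R2 : seq 'rV[K]_m2)
         (N0 : seq 'cV[K]_m0) (N1 : seq 'cV[K]_m1) (N2 : seq 'cV[K]_m2),
  [/\ [/\ unitri R0 N0, unitri R1 N1, unitri R2 N2 & a1 *m (a2 *m eta3) = eta],
      [/\ size R0 <= 1, size R1 <= 1 & size R2 <= 1]%N,
      [/\ alls (fun k => comb01 R1 (k *m a0) /\ k *m b0 = x *m a1 *m a2) R0,
          alls (fun u => [/\ comb01 R2 (u *m a1), u *m b1 = 0 & u *m a1 *m a2 = 0]) R1
        & alls (fun t => t *m a2 = 0) R2]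
    & [/\ cspan N0 (b0 *m eta3), alls (fun f => cspan N0 (a0 *m f)) N1
        & alls (fun f => cspan N1 (a1 *m f)) N2]].
Proof.
move=> ltj xG Geta xeta.
have kb1 k : k *m b0 = x *m a1 *m a2 -> k *m a0 *m b1 = 0.
  by move=> e; rewrite -mulmxA ab mulmxA e -!mulmxA (mulmxA a1) a123 mulmx0.
have E0 k : k *m a0 *m a1 *m a2 = 0 :> 'M_(1, _) by rewrite -!mulmxA (mulmxA a0) a012 mulmx0.
case: j => [|[|[|[|//]]]] in ltj xG Geta *; rewrite /rchain /= in xG Geta.
- have [eta3 eE] := functional_ker Geta.
  have := xG; rewrite sub_preim mulmxA => /submxP[k' kE].
  pose k := k' *m kermx a0.
  have ka : k *m a0 = 0 by rewrite -mulmxA mulmx_ker mulmx0.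
  have kb : k *m b0 = x *m a1 *m a2 by rewrite kE mulmxA.
  exists eta3, [:: k], [::], [::], [:: b0 *m eta3], [::], [::].
  split; split=> //=; try (split=> //).
  + by rewrite mulmxA kb -!mulmxA (mulmxA a1) eE.
  + by rewrite mulmxA.
  + by rewrite ka; split=> //; apply: comb01_0.
  exact: cspan_hd.
- have [eta3 [ke eE]] := functional_preim Geta.
  have [|eta1 e1] := @functional_ker K _ _ a0 (b0 *m eta3); first by rewrite mulmxA.
  have := xG; rewrite sub_preim mulmxA => /submxP[k' kE].
  pose k := k' *m kermx (a0 *m a1).
  have ka : k *m a0 *m a1 = 0 by rewrite -(mulmxA k) /k -(mulmxA k') mulmx_ker mulmx0.
  have kb : k *m b0 = x *m a1 *m a2 by rewrite kE mulmxA.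
  have p1 : k *m b0 *m eta3 = 1%:M by rewrite kb -!mulmxA (mulmxA a1) eE.
  exists eta3, [:: k], [:: k *m a0], [::], [:: b0 *m eta3], [:: eta1], [::].
  split; split=> //=; try (split=> //).
  + by rewrite mulmxA.
  + by rewrite -mulmxA e1 mulmxA.
  + by rewrite mulmxA.
  + by split=> //; apply: comb01_hd.
  + by rewrite kb1 // ka mul0mx; split=> //; apply: comb01_0.
  + exact: cspan_hd.
  by rewrite e1; apply: cspan_hd.
- have [eta3 [ke eE]] := functional_preim Geta.
  have [|eta2 e2] := @functional_ker K _ _ (a0 *m a1) (b0 *m eta3); first by rewrite mulmxA.
  have := xG; rewrite sub_preim mulmxA => /submxP[k kE].
  have kb : k *m b0 = x *m a1 *m a2 by rewrite kE.
  have p1 : k *m b0 *m eta3 = 1%:M by rewrite kb -!mulmxA (mulmxA a1) eE.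
  have p2 : k *m a0 *m a1 *m eta2 = 1%:M by rewrite -!mulmxA (mulmxA a0) e2 mulmxA.
  exists eta3, [:: k], [:: k *m a0], [:: k *m a0 *m a1], [:: b0 *m eta3], [:: a1 *m eta2], [:: eta2].
  split; split=> //=; try (split=> //).
  + by rewrite mulmxA.
  + by rewrite mulmxA.
  + by rewrite mulmxA.
  + by split=> //; apply: comb01_hd.
  + by rewrite kb1 // E0; split=> //; apply: comb01_hd.
  + exact: cspan_hd.
  + by rewrite mulmxA e2; apply: cspan_hd.
  exact: cspan_hd.
have [eta3 [be eE]] := functional_preim Geta.
exists eta3, [::], [::], [::], [::], [::], [::].
split; split=> //=; first by rewrite mulmxA.
by rewrite be; apply: cspan_0.
Qed.

End Arms.
End Pentagon.

(** * Two long arrows: the pentagon with a nonzero path or square *)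
(** Naming a product turns it into a variable, so that a list of equations
    between named vectors rewrites to normal forms. *)
Lemma named T (a : T) : exists y, a = y.
Proof. by exists a. Qed.

Lemma pairing (K : fieldType) m n (x : 'rV[K]_m) (a : 'M[K]_(m, n)) y (f : 'cV_m) (g : 'cV_n) :
  x *m a = y -> a *m g = f -> x *m f = y *m g.
Proof. by move=> <- <-; rewrite mulmxA. Qed.

(** [in_comb] finds a vector that is zero or an entry of the list; [leaf E] closes
    the hypotheses of a concrete summand by rewriting with the equations E
    between its vectors and functionals. *)
Ltac in_comb :=
  first [ exact: comb01_0 | exact: comb01_hd | apply: comb01_tl; in_comb
        | exact: cspan_0 | exact: cspan_hd | apply: cspan_tl; in_comb ].

Ltac leaf E := rewrite /= ?E; repeat split; rewrite ?E; first [done | in_comb].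

Section Pentagon.
Variables (K : fieldType) (d : nat -> nat) (X : forall s t, 'M[K]_(d s, d t)).
Hypothesis iX : rep_indec (arrow 4 3) X.
Local Notation a0 := (X 0%N 1%N).
Local Notation a1 := (X 1%N 2%N).
Local Notation a2 := (X 2%N 3%N).
Local Notation a3 := (X 3%N 4%N).
Local Notation b0 := (X 0%N 3%N).
Local Notation b1 := (X 1%N 4%N).
Local Notation std := (rep_std (arrow 4 3) X 3).

Lemma std_pentagon (x0 : seq 'rV[K]_(d 0)) (x1 : seq 'rV[K]_(d 1))
   (x2 : seq 'rV[K]_(d 2)) (x3 : seq 'rV[K]_(d 3)) (x4 : seq 'rV[K]_(d 4))
   (f0 : seq 'cV[K]_(d 0)) (f1 : seq 'cV[K]_(d 1))
   (f2 : seq 'cV[K]_(d 2)) (f3 : seq 'cV[K]_(d 3)) (f4 : seq 'cV[K]_(d 4)) :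
  [/\ unitri x0 f0, unitri x1 f1, unitri x2 f2, unitri x3 f3 & unitri x4 f4] ->
  (0 < size x0 + size x1 + size x3)%N ->
  [&& size x0 <= 3, size x1 <= 3, size x2 <= 3, size x3 <= 3 & size x4 <= 3]%N ->
  [/\ alls (fun x => comb01 x1 (x *m a0) /\ comb01 x3 (x *m b0)) x0,
      alls (fun x => comb01 x2 (x *m a1) /\ comb01 x4 (x *m b1)) x1,
      alls (fun x => comb01 x3 (x *m a2)) x2
    & alls (fun x => comb01 x4 (x *m a3)) x3] ->
  [/\ alls (fun f => cspan f0 (a0 *m f)) f1,
      alls (fun f => cspan f1 (a1 *m f)) f2,
      alls (fun f => cspan f0 (b0 *m f) /\ cspan f2 (a2 *m f)) f3
    & alls (fun f => cspan f1 (b1 *m f) /\ cspan f3 (a3 *m f)) f4] ->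
  std.
Proof.
move=> [t0 t1 t2 t3 t4] nz /and5P[s0 s1 s2 s3 s4] [c0 c1 c2 c3] [g1 g2 g3 g4].
pose xs v : seq 'rV[K]_(d v) :=
  match v with 0%N => x0 | 1%N => x1 | 2%N => x2 | 3%N => x3 | 4%N => x4 | _ => [::] end.
pose fs v : seq 'cV[K]_(d v) :=
  match v with 0%N => f0 | 1%N => f1 | 2%N => f2 | 3%N => f3 | 4%N => f4 | _ => [::] end.
apply: (@unitri_std _ _ _ _ 3 xs fs) => //.
- by case=> [|[|[|[|[|v]]]]].
- apply: contrapT => /forallNP h; move: nz.
  have -> : x0 = [::] by have /contrapT := h 0%N.
  have -> : x1 = [::] by have /contrapT := h 1%N.
  by have -> : x3 = [::] by have /contrapT := h 3%N.
- by case=> [|[|[|[|[|v]]]]].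
- move=> s t /andP[le_t /orP[]/eqP e] x; subst t.
    case: s le_t x => [|[|[|[|s]]]] // _ x xin; rewrite /= in xin *.
    + exact: (alls_mem c0 xin).1.
    + exact: (alls_mem c1 xin).1.
    + exact: (alls_mem c2 xin).
    exact: (alls_mem c3 xin).
  case: s le_t x => [|[|s]] le_t x xin; last by exfalso; lia.
    exact: (alls_mem c0 xin).2.
  exact: (alls_mem c1 xin).2.
move=> s t /andP[le_t /orP[]/eqP e] x; subst t.
  case: s le_t x => [|[|[|[|s]]]] // _ x xin; rewrite /= in xin *.
  + exact: (alls_mem g1 xin).
  + exact: (alls_mem g2 xin).
  + exact: (alls_mem g3 xin).2.
  exact: (alls_mem g4 xin).2.
case: s le_t x => [|[|s]] le_t x xin; last by exfalso; lia.
  exact: (alls_mem g3 xin).1.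
exact: (alls_mem g4 xin).1.
Qed.

Hypothesis a012 : a0 *m a1 *m a2 = 0.
Hypothesis a123 : a1 *m a2 *m a3 = 0.
Hypothesis ab : a0 *m b1 = b0 *m a3.

(** A vector of V_1 at a jump of both lchain and rchain carries the two arms at
    once; they do not interfere because a0 a1 a2 = 0 and a1 a2 a3 = 0. *)
Lemma pentagon_phi : a1 *m a2 != 0 -> std.
Proof.
move=> nz.
have [] := @butterfly K _ (lchain a2 a3 b1) (rchain a0 a1 a2 b0) 4 4 (lchain_homo a2 a3 b1)
     (rchain_homo a0 a1 a2 b0) erefl erefl.
  apply: contra nz => h; rewrite -[a1]mul1mx -mulmxA; apply/eqP.
  have : (1%:M <= kermx (a1 *m a2))%MS.
    by apply: submx_trans h _; rewrite addsmx_sub sub0mx /=.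
  by move/sub_ker.
move=> i [j [x [eta [lti ltj xF xG [xeta Feta Geta]]]]].
have a0eta : a0 *m eta = 0.
  apply: sub_kills Geta; apply: (@submx_trans _ _ _ _ _ _ (kermx (a1 *m a2))).
    by apply/sub_kermxP; rewrite mulmxA.
  by elim: j {ltj xG} => [|j IH]; [exact: submx_refl|apply: submx_trans IH (rchain_homo _ _ _ _ _)].
have [L2 [L3 [L4 [M2 [M3 [M4 [[tL2 tL3 tL4] [sL2 sL3 sL4] [cb cL2 cL3] [gM4 gM3 gM2]]]]]]]] :=
  left_arm a123 ab lti xF Feta xeta a0eta.
have [eta3 [R0 [R1 [R2 [N0 [N1 [N2 [[tR0 tR1 tR2 eta3E] [sR0 sR1 sR2] [cR0 cR1 cR2] [gE gN1 gN2]]]]]]]]] :=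
  right_arm a012 a123 ab ltj xG Geta xeta.
have qa3 : x *m a1 *m a2 *m a3 = 0 by rewrite -!mulmxA (mulmxA a1) a123 mulmx0.
have kM2 t : t *m a2 = 0 -> kills t M2.
  move=> ta; apply: kills_alls gM2 => f [_ [g ->]]; by rewrite mulmxA ta mul0mx.
apply: (@std_pentagon R0 (R1 ++ [:: x]) (R2 ++ x *m a1 :: L2) (x *m a1 *m a2 :: L3) L4
   N0 (N1 ++ [:: eta]) (N2 ++ a2 *m eta3 :: M2) (eta3 :: M3) M4).
- split=> //.
  + apply: unitri_cat => //; apply: alls_impl cR1 => u [_ _ ua]; split=> //.
    by rewrite -eta3E !mulmxA ua mul0mx.
  + apply: unitri_cat => //=; last first.
      apply: alls_impl cR2 => t ta; split; first by rewrite mulmxA ta mul0mx.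
      exact: kM2.
    split=> //; first by rewrite -xeta -eta3E !mulmxA.
    by apply: kills_alls gM2 => f [_ [g ->]]; rewrite !mulmxA qa3 mul0mx.
  split=> //; first by rewrite -xeta -eta3E !mulmxA.
  by apply: kills_alls gM3 => f [_ _ [g ->]]; rewrite mulmxA qa3 mul0mx.
- by rewrite !size_cat /=; lia.
- rewrite !size_cat /= ; apply/and5P; split; lia.
- split=> //.
  + apply: alls_impl cR0 => k [k1 ->]; split; first exact: comb01_catl.
    exact: comb01_hd.
  + apply: alls_cat; first apply: alls_impl cR1 => u [u1 -> _].
      by split; [apply: comb01_catl|apply: comb01_0].
    by split=> //; split=> //; apply: comb01_catr; apply: comb01_hd.
  + apply: alls_cat; first by apply: alls_impl cR2 => t ->; apply: comb01_0.
    split; first exact: comb01_hd.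
    by apply: alls_impl cL2 => u; apply: comb01_tl.
  by split=> //; rewrite qa3; apply: comb01_0.
split.
- apply: alls_cat => //; split=> //; rewrite a0eta; exact: cspan_0.
- apply: alls_cat; first by apply: alls_impl gN2 => f; apply: cspan_catl.
  split; first by rewrite eta3E; apply/cspan_catr/cspan_hd.
  by apply: alls_impl gM2 => f [-> _]; apply: cspan_0.
- split; first by split=> //; apply/cspan_catr/cspan_hd.
  apply: alls_impl gM3 => f [-> h _]; split; first exact: cspan_0.
  by apply/cspan_catr/cspan_tl.
apply: alls_impl gM4 => f [h1 h2]; split; first exact: cspan_catr.
exact: cspan_tl.
Qed.

(** The commutative square over c = a0 b1 = b0 a3 spanned by a vector x of V_0,
    and the square of functionals pulled back from psi. *)
Lemma square_setup (x : 'rV[K]_(d 0)) (psi : 'cV[K]_(d 4)) :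
  exists (y1 : 'rV_(d 1)) (y3 : 'rV_(d 3)) (y4 : 'rV_(d 4))
         (g0 : 'cV_(d 0)) (g1 : 'cV_(d 1)) (g3 : 'cV_(d 3)),
  [/\ [/\ x *m a0 = y1, x *m b0 = y3, y1 *m b1 = y4, y3 *m a3 = y4
        & x *m (a0 *m b1) = y4],
      [/\ b1 *m psi = g1, a3 *m psi = g3, a0 *m g1 = g0, b0 *m g3 = g0
        & a0 *m b1 *m psi = g0]
    & x *m (a0 *m b1) *m psi = 1%:M ->
      [/\ y4 *m psi = 1%:M, y1 *m g1 = 1%:M, y3 *m g3 = 1%:M & x *m g0 = 1%:M]].
Proof.
exists (x *m a0), (x *m b0), (x *m (a0 *m b1)).
exists (a0 *m b1 *m psi), (b1 *m psi), (a3 *m psi); split.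
- by split=> //; rewrite -?mulmxA // ab.
- by split=> //; rewrite ?mulmxA // ab.
move=> p; split=> //; rewrite !mulmxA ?(mulmxA _ a0) -?p ?mulmxA //.
by rewrite -(mulmxA x) -ab mulmxA.
Qed.

(** A vector x of V_0 with x c nonzero spans, with a functional psi on V_4, a copy
    of the square.  What has to be added to it at V_1 and V_2 is independent of
    what has to be added at V_3 and V_2: the former dies under a2 and the
    latter is dual to functionals pulled back along a2, while a1 a2 = 0. *)
Section SquareArms.
Hypothesis a12 : a1 *m a2 = 0.
Local Notation c := (a0 *m b1).
Local Notation SA := (kermx a1 *m b1).
Local Notation SB := (a2 *m a3).

(** The part of the summand in V_1, and the part of V_2 that continues it. *)
Definition arm1 (x : 'rV[K]_(d 0)) (psi : 'cV[K]_(d 4)) : Prop :=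
  exists (x1 : seq 'rV[K]_(d 1)) (f1 : seq 'cV[K]_(d 1))
         (x2 : seq 'rV[K]_(d 2)) (f2 : seq 'cV[K]_(d 2)),
  [/\ [/\ unitri x1 f1, unitri x2 f2, size x1 <= 2 & size x2 <= 1]%N,
      [/\ comb01 x1 (x *m a0),
          alls (fun v => comb01 x2 (v *m a1) /\ comb01 [:: x *m c] (v *m b1)) x1
        & alls (fun v => v *m a2 = 0) x2]
    & [/\ alls (fun f => cspan [:: c *m psi] (a0 *m f)) f1,
          alls (fun f => cspan f1 (a1 *m f)) f2 & cspan f1 (b1 *m psi)]].

(** The part of the summand in V_3, and the part of V_2 that maps to it. *)
Definition arm3 (x : 'rV[K]_(d 0)) (psi : 'cV[K]_(d 4)) : Prop :=
  exists (x3 : seq 'rV[K]_(d 3)) (f3 : seq 'cV[K]_(d 3))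
         (x2 : seq 'rV[K]_(d 2)) (f2 : seq 'cV[K]_(d 2)),
  [/\ [/\ unitri x3 f3, unitri x2 f2, size x3 <= 2 & size x2 <= 1]%N,
      [/\ comb01 x3 (x *m b0), alls (fun v => comb01 [:: x *m c] (v *m a3)) x3
        & alls (fun v => comb01 x3 (v *m a2)) x2]
    & [/\ alls (fun f => cspan [:: c *m psi] (b0 *m f) /\ cspan f2 (a2 *m f)) f3,
          alls (fun f => exists g, f = a2 *m g) f2 & cspan f3 (a3 *m psi)]].

Lemma square_arms x psi : x *m c *m psi = 1%:M -> arm1 x psi -> arm3 x psi -> std.
Proof.
move=> px [x1 [f1 [x2 [f2 [[t1 t2 s1 s2] [cx1 c1 c2] [g1 g2 gpsi]]]]]].
move=> [x3 [f3 [x2' [f2' [[t3 t2' s3 s2'] [cx3 c3 c2'] [g3 g2' gpsi']]]]]].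
apply: (@std_pentagon [:: x] x1 (x2 ++ x2') x3 [:: x *m c]
  [:: c *m psi] f1 (f2 ++ f2') f3 [:: psi]) => //.
- split=> //; first by split=> //; rewrite mulmxA.
  apply: unitri_cat => //; apply: alls_impl c2 => v va.
  by apply: kills_alls g2' => _ [g ->]; rewrite mulmxA va mul0mx.
- by rewrite size_cat; apply/and5P; split=> //; lia.
- split=> //.
  + by apply: alls_impl c1 => v [h1 h2]; split=> //; apply: comb01_catl.
  apply: alls_cat => //; apply: alls_impl c2 => v ->; exact: comb01_0.
split=> //.
- apply: alls_cat => //; apply: alls_impl g2' => _ [g ->].
  by rewrite mulmxA a12 mul0mx; apply: cspan_0.
by apply: alls_impl g3 => f [h1 h2]; split=> //; apply: cspan_catr.
Qed.

Variables (x : 'rV[K]_(d 0)) (psi : 'cV[K]_(d 4)).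
Hypothesis px : x *m c *m psi = 1%:M.

(** Closes the conditions of an arm once the pairings and relations E are known. *)
Ltac arm E := do !split=> //=; rewrite ?mulmxA ?E; first [done | in_comb].

Lemma square_pairing :
  (x *m a0 *m b1 *m psi = 1%:M) * (x *m b0 *m a3 *m psi = 1%:M) *
  (x *m b0 *m a3 = x *m a0 *m b1) * (b0 *m a3 = a0 *m b1).
Proof.
have p : x *m a0 *m b1 *m psi = 1%:M by rewrite -px !mulmxA.
by rewrite -(mulmxA x b0) -ab mulmxA p.
Qed.
Local Notation E := square_pairing.

Lemma arm1_ker : x *m a0 *m a1 = 0 -> arm1 x psi.
Proof.
move=> xa; exists [:: x *m a0], [:: b1 *m psi], [::], [::].
arm (xa, E).
Qed.

(** The arm continues to x a0 a1, and b1 psi is pulled back along a1: it vanishes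
    on the kernel of a1. *)
Lemma arm1_sep : SA *m psi = 0 -> arm1 x psi.
Proof.
rewrite -mulmxA => /functional_ker[tau tauE].
exists [:: x *m a0], [:: b1 *m psi], [:: x *m a0 *m a1], [:: tau].
have p : x *m a0 *m a1 *m tau = 1%:M by rewrite -(mulmxA _ a1) tauE mulmxA E.
have q : x *m a0 *m a1 *m a2 = 0 by rewrite -mulmxA a12 mulmx0.
arm (p, q, tauE, E).
Qed.

(** Here x c also comes from a vector v in the kernel of a1, which pairs with
    b1 psi; what pairs with x a0 is pulled back from V_2. *)
Lemma arm1_lift : (x *m c <= SA)%MS -> kermx (a0 *m a1) *m (c *m psi) = 0 -> arm1 x psi.
Proof.
case/submxP=> v' vE /functional_ker[tau tauE]; set v := v' *m kermx a1.
have va : v *m a1 = 0 by rewrite -mulmxA mulmx_ker mulmx0.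
have vb : v *m b1 = x *m a0 *m b1 by rewrite /v -(mulmxA v') -vE mulmxA.
exists [:: v; x *m a0], [:: b1 *m psi; a1 *m tau], [:: x *m a0 *m a1], [:: tau].
have p : x *m a0 *m a1 *m tau = 1%:M by rewrite -!(mulmxA x) tauE !mulmxA E.
have q : x *m a0 *m a1 *m a2 = 0 by rewrite -mulmxA a12 mulmx0.
have vt : v *m a1 *m tau = 0 by rewrite va mul0mx.
arm (va, vb, vt, p, q, tauE, E).
Qed.

Lemma arm3_preim : (x *m b0 <= a2)%MS -> arm3 x psi.
Proof.
case/submxP=> u uE; exists [:: x *m b0], [:: a3 *m psi], [:: u], [:: a2 *m a3 *m psi].
have g : exists g, a2 *m a3 *m psi = a2 *m g by exists (a3 *m psi); rewrite mulmxA.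
arm (esym uE, E).
Qed.

(** The arm stops at x b0, since a3 psi vanishes on the image of a2. *)
Lemma arm3_sep : SB *m psi = 0 -> arm3 x psi.
Proof.
move=> h; exists [:: x *m b0], [:: a3 *m psi], [::], [::].
arm (h, E).
Qed.

(** Here x c also comes from u in V_2, and al is a functional on V_3 that
    pairs with x b0 but kills the image of a2. *)
Lemma arm3_lift : (x *m c <= SB)%MS -> preim_mx b0 a2 *m (c *m psi) = 0 -> arm3 x psi.
Proof.
case/submxP=> u uE /functional_preim[al [a2al b0al]].
exists [:: u *m a2; x *m b0], [:: a3 *m psi; al], [:: u], [:: a2 *m a3 *m psi].
have g : exists g, a2 *m a3 *m psi = a2 *m g by exists (a3 *m psi); rewrite mulmxA.
have ua : u *m a2 *m a3 = x *m a0 *m b1 by rewrite -mulmxA -uE mulmxA.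
have ual : u *m a2 *m al = 0 by rewrite -mulmxA a2al mulmx0.
have xal : x *m b0 *m al = 1%:M by rewrite -mulmxA b0al !mulmxA E.
arm (ua, ual, xal, a2al, b0al, E).
Qed.

End SquareArms.

(** The arms available to x are governed by F, the kernel of a0 a1, and G, the
    preimage under b0 of the image of a2, both in V_0, and by SA and SB, the
    vectors of V_4 that come from the kernel of a1 and from V_2.  Each branch
    picks x with arms as short as the module allows, and the failure of the
    previous branches provides the functionals that are needed.  Two branches
    are not of this form: a vector of F and a vector of G may have the same
    image under c, and x c may be a sum of two vectors from SA and SB. *)
Lemma pentagon_square : a1 *m a2 = 0 -> a0 *m b1 != 0 -> std.
Proof.
move=> a12 nzc; set c := a0 *m b1.
pose G := preim_mx b0 a2.
pose SA := kermx a1 *m b1.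
pose SB := a2 *m a3.
have xa12 k (x : 'M_(k, _)) : x *m a1 *m a2 = 0 by rewrite -mulmxA a12 mulmx0.
have a12x k (x : 'M_(_, k)) : a1 *m (a2 *m x) = 0 by rewrite mulmxA a12 mul0mx.
have Gb (w : 'rV_(d 0)) : (w *m G *m b0 <= a2)%MS by rewrite -sub_preim submxMl.
have arms := square_arms a12.
(* x in both F and G *)
have [[x [xF xG nx]]|FGH] := pselect (exists x : 'rV_(d 0),
    [/\ x *m a0 *m a1 = 0, (x *m b0 <= a2)%MS & x *m c != 0]).
  have [psi px] := functional_sep0 nx.
  by apply: (arms _ _ px); [apply: arm1_ker|apply: arm3_preim].
(* c maps some x in F and some x' in G to the same nonzero vector: two
   squares are glued along V_4 *)
have [[x [x' [xF xG nx cE]]]|FG] := pselect (exists x x' : 'rV_(d 0),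
    [/\ x *m a0 *m a1 = 0, (x' *m b0 <= a2)%MS, x *m c != 0 & x *m c = x' *m c]).
  have [u uE] := submxP xG.
  have [psi px] := functional_sep0 nx.
  have px' : x' *m c *m psi = 1%:M by rewrite -cE.
  have [y1 [y3 [y4 [g0 [g1 [g3 [[e1 e3 e14 e34 e4] [h1 h3 h01 h03 h0]]]]]]]] := square_setup x psi.
  case/(_ px) => p4 p1 p3 p0.
  have [z1 [z3 [z4 [g0' [g1' [g3' [[e1' e3' e14' e34' e4'] [h1' h3' h01' h03' h0']]]]]]]] := square_setup x' psi.
  rewrite -h1' h1 in h01'; rewrite -h3' h3 in h03'.
  have eg0 : g0' = g0 by rewrite -h01' h01.
  have eg1 : g1' = g1 by rewrite -h1' h1.
  have eg3 : g3' = g3 by rewrite -h3' h3.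
  have ez4 : z4 = y4 by rewrite -e4' -e4.
  rewrite eg0 eg1 eg3 => /(_ px')[_ p1' p3' p0']; rewrite ez4 in e14' e34'.
  have [w wE|tau tauE] := @functional_ext _ _ _ (G *m (a0 *m a1)) (G *m g0).
    rewrite mulmxA -h0 mulmxA; suff -> : w *m G *m c = 0 by rewrite mul0mx.
    apply/eqP; apply: contraT => n; case: FGH; exists (w *m G).
    by split=> //; rewrite -wE !mulmxA.
  have [t1 h12'] := named (a1 *m tau).
  have [zeta hz] := named (a0 *m t1).
  have GE (w : 'rV_(d 0)) : (w *m b0 <= a2)%MS -> w *m zeta = w *m g0.
    rewrite -sub_preim => /submxP[D ->]; rewrite -!(mulmxA D) -/G -tauE.
    by rewrite -hz -h12' !mulmxA.
  have [|sig [h2s h0s]] := @functional_preim K _ _ _ b0 a2 (g0 - zeta).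
    apply/row_matrixP => i; rewrite row_mul row0 mulmxBr GE ?subrr //.
    by rewrite -sub_preim row_sub.
  have [kap hk] := named (b0 *m sig).
  have [z2 e12'] := named (z1 *m a1).
  have [g2 h23] := named (a2 *m g3).
  have h12 : a1 *m g2 = 0 by rewrite -h23 a12x.
  have e12 : y1 *m a1 = 0 by rewrite -e1.
  have e2' : z2 *m a2 = 0 by rewrite -e12' xa12.
  have e23 : u *m a2 = z3 by rewrite -uE.
  have hzk : zeta = g0 - kap by rewrite -hk h0s opprB addrC subrK.
  have p1t : z1 *m t1 = 1%:M by rewrite -(pairing e1' hz) GE // p0'.
  have q1 : y1 *m t1 = 0 by rewrite -h12' mulmxA e12 mul0mx.
  have pk' : x' *m kap = 0 by rewrite -hk h0s mulmxBr GE // subrr.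
  have pk : x *m kap = 1%:M.
    by rewrite -hk h0s mulmxBr p0 -hz mulmxA e1 q1 subr0.
  have p2 : u *m g2 = 1%:M by rewrite (pairing e23 h23).
  have p2' : z2 *m tau = 1%:M by rewrite -(pairing e12' h12').
  have q2 : z2 *m g2 = 0 by rewrite -h23 mulmxA e2' mul0mx.
  have ps : y3 *m sig = 1%:M by rewrite -(pairing e3 hk).
  have qs : z3 *m sig = 0 by rewrite -(pairing e3' hk).
  pose E := (e1, e3, e14, e34, (e1', e3', e14', e34'), (h1, h3, h01, h03), (h23, h12, e23, e12, e12', e2', h12'),
     (p0, p1, p2, p3, p4), (p0', p1', p2', p3', p1t, q1, pk, pk', q2, ps, qs), (hk, hz, h2s)).
  apply: (@std_pentagon [:: x'; x] [:: y1; z1] [:: z2; u] [:: z3; y3] [:: y4]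
    [:: g0; kap] [:: g1; t1] [:: tau; g2] [:: g3; sig] [:: psi]) => //; [leaf E|].
  rewrite /= !E; repeat split; try in_comb.
  apply: (@cspan_cons _ _ _ _ 1); rewrite scale1r hzk addrC addKr.
  by apply: (@cspan_cons _ _ _ _ (-1)); rewrite scaleN1r opprK addNr; apply: cspan_0.
(* x in F only; the images of F and G under c are now independent *)
have [[x [xF nx]]|FH] := pselect (exists x : 'rV_(d 0), x *m a0 *m a1 = 0 /\ x *m c != 0).
  have [yB|nyB] := boolP (x *m c <= SB)%MS.
    have [|psi [px cpsi]] := @functional_sep K _ _ (x *m c) (G *m c).
      apply/negP => /submxP[w wE]; case: FG; exists x, (w *m G); split=> //.
      by rewrite wE mulmxA.
    by apply: (arms _ _ px); [apply: arm1_ker|apply: arm3_lift => //; rewrite mulmxA].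
  have [psi [px Bpsi]] := functional_sep nyB.
  by apply: (arms _ _ px); [apply: arm1_ker|apply: arm3_sep].
have kF : kermx (a0 *m a1) *m c = 0.
  apply/row_matrixP => i; rewrite row_mul row0; apply/eqP; apply: contraT => n.
  case: FH; exists (row i (kermx (a0 *m a1))); split=> //.
  by rewrite -mulmxA -row_mul mulmx_ker row0.
have kF' psi : kermx (a0 *m a1) *m (c *m psi) = 0 :> 'cV_ _ by rewrite mulmxA kF mul0mx.
(* x in G only; c now vanishes on F *)
have [[x [xG nx]]|GH] := pselect (exists x : 'rV_(d 0), (x *m b0 <= a2)%MS /\ x *m c != 0).
  have [yA|nyA] := boolP (x *m c <= SA)%MS.
    have [psi px] := functional_sep0 nx.
    by apply: (arms _ _ px); [apply: arm1_lift|apply: arm3_preim].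
  have [psi [px Apsi]] := functional_sep nyA.
  by apply: (arms _ _ px); [apply: arm1_sep|apply: arm3_preim].
have kG psi : preim_mx b0 a2 *m (c *m psi) = 0 :> 'cV_ _.
  rewrite mulmxA; suff -> : preim_mx b0 a2 *m c = 0 by rewrite mul0mx.
  apply/row_matrixP => i; rewrite row_mul row0; apply/eqP; apply: contraT => n.
  by case: GH; exists (row i (preim_mx b0 a2)); split=> //; rewrite -sub_preim row_sub.
(* c vanishes on F and on G; x c has both kinds of lifts *)
have [[x [nx xA xB]]|nAB] := pselect (exists x : 'rV_(d 0),
    [/\ x *m c != 0, (x *m c <= SA)%MS & (x *m c <= SB)%MS]).
  have [psi px] := functional_sep0 nx.
  by apply: (arms _ _ px); [apply: arm1_lift|apply: arm3_lift].
(* x c has only one kind of lift *)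
have [[x [nx xA]]|nA] := pselect (exists x : 'rV_(d 0), x *m c != 0 /\ (x *m c <= SA)%MS).
  have [|psi [px Bpsi]] := @functional_sep K _ _ (x *m c) SB.
    by apply/negP => xB; case: nAB; exists x.
  by apply: (arms _ _ px); [apply: arm1_lift|apply: arm3_sep].
have [[x [nx xB]]|nB] := pselect (exists x : 'rV_(d 0), x *m c != 0 /\ (x *m c <= SB)%MS).
  have [|psi [px Apsi]] := @functional_sep K _ _ (x *m c) SA.
    by apply/negP => xA; case: nA; exists x.
  by apply: (arms _ _ px); [apply: arm1_sep|apply: arm3_lift].
(* x c has no lift, even modulo the sum of the two kinds *)
have [[x nxAB]|AB] := pselect (exists x : 'rV_(d 0), ~~ (x *m c <= SA + SB)%MS).
  have [psi [px ABpsi]] := functional_sep nxAB.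
  have Apsi : SA *m psi = 0 by apply: sub_kills ABpsi; apply: addsmxSl.
  have Bpsi : SB *m psi = 0 by apply: sub_kills ABpsi; apply: addsmxSr.
  by apply: (arms _ _ px); [apply: arm1_sep|apply: arm3_sep].
(* x c is the sum of two vectors with one lift each, but no image under c
   has a lift; V_4 needs two basis vectors *)
have [x nx] : exists x : 'rV_(d 0), x *m c != 0.
  apply: contrapT => /forallNP h; case/negP: nzc; apply/eqP/row_matrixP => i.
  by rewrite row0 rowE; apply/eqP; apply: contraT => /(h _).
have /sub_addsmxP[[v' u] /= yE] : (x *m c <= SA + SB)%MS.
  by apply: contraT => n; case: AB; exists x.
have [psi px] := functional_sep0 nx.
have xSA (w : 'rV_(d 0)) : (w *m c <= SA)%MS -> w *m c = 0.
  by move=> h; apply/eqP; apply: contraT => n; case: nA; exists w.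
have xSB (w : 'rV_(d 0)) : (w *m c <= SB)%MS -> w *m c = 0.
  by move=> h; apply/eqP; apply: contraT => n; case: nB; exists w.
have [|psi1 [B1 c1]] := @functional_preim K _ _ _ c SB (c *m psi).
  apply/row_matrixP => i; rewrite row_mul row0 mulmxA xSB ?mul0mx //.
  by rewrite -sub_preim row_sub.
have [|psi2 [A2 c2]] := @functional_preim K _ _ _ c SA (c *m psi).
  apply/row_matrixP => i; rewrite row_mul row0 mulmxA xSA ?mul0mx //.
  by rewrite -sub_preim row_sub.
have px1 : x *m c *m psi1 = 1%:M by rewrite -mulmxA c1 mulmxA.
have px2 : x *m c *m psi2 = 1%:M by rewrite -mulmxA c2 mulmxA.
have [y1 [y3 [y4 [g0 [g1 [g3 [[e1 e3 e14 e34 e4] [h1 h3 h01 h03 h0]]]]]]]] := square_setup x psi1.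
case/(_ px1) => _ p1 p3 p0.
have [_ [_ [_ [g0' [g1' [g3' [[<- <- <- _ _] [h1' h3' h01' h03' h0']]]]]]]] := square_setup x psi2.
case/(_ px2) => _ p1' p3' p0'; rewrite e1 in p1' p3'; rewrite e3 in p3'.
have eg0 : g0' = g0 by rewrite -h0' -h0 c1 c2.
rewrite eg0 in h01' h03' p0'.
have [v hv] := named (v' *m kermx a1).
have va : v *m a1 = 0 by rewrite -hv -mulmxA mulmx_ker mulmx0.
have [s4 es] := named (v *m b1).
have [w3 e23] := named (u *m a2).
have [t4 et] := named (w3 *m a3).
have yst : y4 = s4 + t4 by rewrite -e4 yE -es -et -hv -e23 !mulmxA.
have q4s : s4 *m psi2 = 0 by rewrite -es -hv -(mulmxA v') -mulmxA A2 mulmx0.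
have q4t : t4 *m psi1 = 0 by rewrite -et -e23 -(mulmxA u) -mulmxA B1 mulmx0.
have p4s : s4 *m psi1 = 1%:M.
  by have := px1; rewrite e4 yst mulmxDl q4t addr0.
have p4t : t4 *m psi2 = 1%:M.
  by have := px2; rewrite e4 yst mulmxDl q4s add0r.
have [|tau tauE] := @functional_ker K _ _ a1 (b1 *m psi2); first by rewrite mulmxA.
rewrite h1' in tauE.
have [g2 h23'] := named (a2 *m g3').
have h23 : a2 *m g3 = 0 by rewrite -h3 mulmxA.
have h12 : a1 *m g2 = 0 by rewrite -h23' a12x.
have [y2 e12] := named (y1 *m a1).
have e2 : y2 *m a2 = 0 by rewrite -e12 xa12.
have pv : v *m g1 = 1%:M by rewrite (pairing es h1).
have qv : v *m g1' = 0 by rewrite (pairing es h1').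
have pw : w3 *m g3' = 1%:M by rewrite (pairing et h3').
have qw : w3 *m g3 = 0 by rewrite (pairing et h3).
have py2 : y2 *m tau = 1%:M by rewrite -(pairing e12 tauE).
have qy2 : y2 *m g2 = 0 by rewrite -h23' mulmxA e2 mul0mx.
have p2 : u *m g2 = 1%:M by rewrite (pairing e23 h23').
pose E := (e1, e3, e14, e34, (h1, h3, h01, h03), (h1', h3', h01', h03'), (h23, h23', h12, e12, e2, e23),
  (p0, p1, p3, p1', p3'), (va, es, et, q4s, q4t, p4s, p4t), (tauE, pv, qv, pw, qw, py2, qy2, p2)).
apply: (@std_pentagon [:: x] [:: v; y1] [:: y2; u] [:: w3; y3] [:: s4; t4]
      [:: g0] [:: g1; g1'] [:: tau; g2] [:: g3'; g3] [:: psi1; psi2]) => //; [|leaf E].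
have cst : comb01 [:: s4; t4] (s4 + t4).
  by apply: (@comb01_cons _ _ _ _ true); rewrite scale1r addrC addKr; apply: comb01_hd.
by rewrite /= !E yst; repeat split; try in_comb.
Qed.

End Pentagon.

(** * Two long arrows: the remaining strings, and the square *)
Section Chain.
Variable K : fieldType.

(** A finite chain of subspaces, continued by the whole space. *)
Definition flag n (s : seq 'M[K]_n) i : 'M[K]_n := nth 1%:M s i.

Lemma flag_homo n (s : seq 'M[K]_n) :
  (forall i, (i.+1 < size s)%N -> (s`_i <= s`_i.+1)%MS) ->
  forall i, (flag s i <= flag s i.+1)%MS.
Proof.
move=> h i; have [lt|le] := ltnP i.+1 (size s).
  by rewrite /flag !(set_nth_default 0) ?h // ltnW.
by rewrite /flag [nth _ _ i.+1]nth_default // submx1.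
Qed.

Lemma not_full m n (a : 'M[K]_(m, n)) : a != 0 ->
  ~~ (1%:M <= kermx a + (0 : 'M_m))%MS.
Proof.
apply: contra => h; have : (1%:M <= kermx a)%MS.
  by apply: submx_trans h _; rewrite addsmx_sub submx_refl sub0mx.
by move/sub_ker; rewrite mul1mx => ->.
Qed.

End Chain.

Section PentagonStrings.
Variables (K : fieldType) (d : nat -> nat) (X : forall s t, 'M[K]_(d s, d t)).
Hypothesis iX : rep_indec (arrow 4 3) X.
Local Notation a0 := (X 0%N 1%N).
Local Notation a1 := (X 1%N 2%N).
Local Notation a2 := (X 2%N 3%N).
Local Notation a3 := (X 3%N 4%N).
Local Notation b0 := (X 0%N 3%N).
Local Notation b1 := (X 1%N 4%N).
Local Notation std := (rep_std (arrow 4 3) X 3).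
Hypothesis a12 : a1 *m a2 = 0.
Hypothesis ab1 : a0 *m b1 = 0.
Hypothesis ab : a0 *m b1 = b0 *m a3.

(** Without nonzero paths a1 a2 and squares, the summand is a string through a
    vector x of V_1, with the left arm on one side and x a1 on the other. *)
Lemma pentagon_b1 : b1 != 0 -> std.
Proof.
move=> nz.
have a123 : a1 *m a2 *m a3 = 0 by rewrite a12 mul0mx.
have homoG : forall i, (flag [:: 0; kermx a1] i <= flag [:: 0; kermx a1] i.+1)%MS.
  by apply: flag_homo => -[|i] //= _; apply: sub0mx.
have [|i [j [x [eta [lti ltj xF xG [xeta Feta Geta]]]]]] :=
   @butterfly K _ (fun i => lchain a2 a3 b1 i.+1) (flag [:: 0; kermx a1]) 3 2
   (fun i => lchain_homo a2 a3 b1 i.+1) homoG erefl erefl.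
  exact: not_full.
have a0eta : a0 *m eta = 0.
  apply: sub_kills Feta; apply: (@submx_trans _ _ _ _ _ _ (kermx b1)); first exact/sub_kermxP.
  elim: i {lti xF} => [|i IH]; first exact: submx_refl.
  exact: submx_trans IH (lchain_homo _ _ _ _).
have [L2 [L3 [L4 [M2 [M3 [M4 [[tL2 tL3 tL4] [sL2 sL3 sL4] [cb cL2 cL3] [gM4 gM3 gM2]]]]]]]] :=
  left_arm a123 ab (lti : (i.+1 < 4)%N) xF Feta xeta a0eta.
have gM4' : alls (fun f => cspan [:: eta] (b1 *m f) /\ cspan M3 (a3 *m f)) M4 by [].
have gM3' : alls (fun f => cspan [::] (b0 *m f) /\ cspan M2 (a2 *m f)) M3.
  by apply: alls_impl gM3 => f [-> h _]; split=> //; apply: cspan_0.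
case: j => [|[|//]] in ltj xG Geta *; rewrite /flag /= in xG Geta.
  apply: (@std_pentagon K d X iX [::] [:: x] L2 L3 L4 [::] [:: eta] M2 M3 M4) => //.
  - by apply/and5P; split=> //; lia.
  - by split=> //=; rewrite (sub_ker xG); do !split=> //; apply: comb01_0.
  split=> //=; first by rewrite a0eta; split=> //; apply: cspan_0.
  by apply: alls_impl gM2 => f [-> _]; apply: cspan_0.
have [eta2 eta2E] := functional_ker Geta.
have q : x *m a1 *m a2 = 0 by rewrite -mulmxA a12 mulmx0.
apply: (@std_pentagon K d X iX [::] [:: x] (x *m a1 :: L2) L3 L4 [::] [:: eta] (eta2 :: M2) M3 M4) => //.
- split=> //; split=> //; first by rewrite -mulmxA eta2E.
  by apply: kills_alls gM2 => f [_ [g ->]]; rewrite mulmxA q mul0mx.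
- by apply/and5P; split=> //=; lia.
- split=> //=; first by split=> //; split=> //; apply: comb01_hd.
  by rewrite q; split=> //; apply: comb01_0.
split=> //=; first by rewrite a0eta; split=> //; apply: cspan_0.
- rewrite eta2E; split; first exact: cspan_hd.
  by apply: alls_impl gM2 => f [-> _]; apply: cspan_0.
by apply: alls_impl gM3' => f [? h]; split=> //; apply: cspan_tl.
Qed.

(** The strings through a vector x of V_0, with x, x a0, x a0 a1 on one side and
    x b0 with a lift to V_2 on the other. *)
Lemma pentagon_b0 : b1 = 0 -> b0 != 0 -> std.
Proof.
move=> b10 nz.
have xb1 m (y : 'M_(m, _)) : y *m b1 = 0 by rewrite b10 mulmx0.
have homoF : forall i, (flag [:: kermx b0; preim_mx b0 a2] i <= flag [:: kermx b0; preim_mx b0 a2] i.+1)%MS.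
  by apply: flag_homo => -[|i] //= _; apply: ker_sub_preim.
have homoG : forall i, (flag [:: 0; kermx a0; kermx (a0 *m a1)] i <= flag [:: 0; kermx a0; kermx (a0 *m a1)] i.+1)%MS.
  apply: flag_homo => -[|[|i]] //= _; first exact: sub0mx.
  by apply/sub_kermxP; rewrite mulmxA mulmx_ker mul0mx.
have [|i [j [x [eta [lti ltj xF xG [xeta Feta Geta]]]]]] :=
   @butterfly K _ _ _ 2 3 homoF homoG erefl erefl.
  exact: not_full.
have [R1 [R2 [N1 [N2 [[tR1 tR2 sR1 sR2] [cx cR1 cR2] [gN1 gN2]]]]]] :
  exists (R1 : seq 'rV[K]_(d 1)) (R2 : seq 'rV[K]_(d 2))
         (N1 : seq 'cV[K]_(d 1)) (N2 : seq 'cV[K]_(d 2)),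
   [/\ [/\ unitri R1 N1, unitri R2 N2, size R1 <= 1 & size R2 <= 1]%N,
       [/\ comb01 R1 (x *m a0), alls (fun u => comb01 R2 (u *m a1)) R1
         & alls (fun t => t *m a2 = 0) R2]
     & alls (fun f => cspan [:: eta] (a0 *m f)) N1 /\
       alls (fun f => cspan N1 (a1 *m f)) N2].
  case: j => [|[|[|//]]] in ltj xG Geta *; rewrite /flag /= in xG Geta.
  - exists [::], [::], [::], [::]; split=> //; split=> //.
    by rewrite (sub_ker xG); apply: comb01_0.
  - have [eta1 e1] := functional_ker Geta.
    have xa : x *m a0 *m a1 = 0 by rewrite -mulmxA (sub_ker xG).
    exists [:: x *m a0], [::], [:: eta1], [::].
    split; split=> //=.
    + by split=> //; rewrite -mulmxA e1.
    + exact: comb01_hd.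
    + by rewrite xa; split=> //; apply: comb01_0.
    by rewrite e1; split=> //; apply: cspan_hd.
  have [eta2 e2] := functional_ker Geta.
  exists [:: x *m a0], [:: x *m a0 *m a1], [:: a1 *m eta2], [:: eta2].
  have p : x *m (a0 *m a1) *m eta2 = 1%:M by rewrite -mulmxA e2.
  split; split=> //=.
  + by split=> //; rewrite -p !mulmxA.
  + by split=> //; rewrite -p !mulmxA.
  + exact: comb01_hd.
  + by split=> //; apply: comb01_hd.
  + by split=> //; rewrite -mulmxA a12 mulmx0.
  + by rewrite mulmxA e2; split=> //; apply: cspan_hd.
  by split=> //; apply: cspan_hd.
have qa3 : x *m b0 *m a3 = 0 by rewrite -mulmxA -ab ab1 mulmx0.
have cR1' (R : seq 'rV_(d 2)) : alls (fun u => comb01 (R2 ++ R) (u *m a1) /\ comb01 [::] (u *m b1)) R1.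
  by apply: alls_impl cR1 => u h; rewrite xb1; split; [apply: comb01_catl|apply: comb01_0].
have gN1' : alls (fun f => cspan [:: eta] (a0 *m f)) N1 by [].
case: i => [|[|//]] in lti xF Feta *; rewrite /flag /= in xF Feta.
  have [eta3 e3] := functional_ker Feta.
  move: xF; rewrite sub_preim => /submxP[u uE].
  have p : x *m b0 *m eta3 = 1%:M by rewrite -mulmxA e3.
  apply: (@std_pentagon K d X iX [:: x] R1 (R2 ++ [:: u]) [:: x *m b0] [::]
     [:: eta] N1 (N2 ++ [:: a2 *m eta3]) [:: eta3] [::]) => //.
  - split=> //; apply: unitri_cat => //=; first by split=> //; rewrite mulmxA -uE.
    by apply: alls_impl cR2 => t ta; split=> //; rewrite mulmxA ta mul0mx.
  - by rewrite size_cat; apply/and5P; split=> //=; lia.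
  - split=> //=.
    + by do 2!split=> //; apply: comb01_hd.
    + apply: alls_cat => //=; last by rewrite -uE; split=> //; apply: comb01_hd.
      by apply: alls_impl cR2 => t ->; apply: comb01_0.
    by rewrite qa3; split=> //; apply: comb01_0.
  split=> //=.
  - apply: alls_cat => //=; rewrite mulmxA a12 mul0mx; split=> //; exact: cspan_0.
  rewrite e3; do 2!split=> //; first exact: cspan_hd.
  by apply/cspan_catr/cspan_hd.
have [eta3 [a2e e3]] := functional_preim Feta.
have p : x *m b0 *m eta3 = 1%:M by rewrite -mulmxA e3.
apply: (@std_pentagon K d X iX [:: x] R1 (R2 ++ [::]) [:: x *m b0] [::]
     [:: eta] N1 N2 [:: eta3] [::]) => //; rewrite ?cats0 //.
- by apply/and5P; split=> //=; lia.
- split=> //=.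
  + by do 2!split=> //; apply: comb01_hd.
  + by have := cR1' [::]; rewrite cats0.
  + by apply: alls_impl cR2 => t ->; apply: comb01_0.
  by rewrite qa3; split=> //; apply: comb01_0.
by split=> //=; rewrite e3 a2e; do 2!split=> //; [apply: cspan_hd|apply: cspan_0].
Qed.

End PentagonStrings.

Section PentagonConclusion.
Variables (K : fieldType) (d : nat -> nat) (X : forall s t, 'M[K]_(d s, d t)).

(** The alternative b0 = b1 = 0 leaves a linear quiver. *)
Theorem pentagon_std : rep_indec (arrow 4 3) X ->
  X 0 1 *m X 1 2 *m X 2 3 = 0 -> X 1 2 *m X 2 3 *m X 3 4 = 0 ->
  X 0 1 *m X 1 4 = X 0 3 *m X 3 4 ->
  X 1 4 = 0 /\ X 0 3 = 0 \/ rep_std (arrow 4 3) X 3.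
Proof.
move=> iX a012 a123 ab.
have [b10|nb1] := eqVneq (X 1 4) 0; last right.
  have [b00|nb0] := eqVneq (X 0 3) 0; [by left|right].
  have [phi0|nphi] := eqVneq (X 1 2 *m X 2 3) 0; last exact: pentagon_phi.
  have ab0 : X 0 1 *m X 1 4 = 0 by rewrite b10 mulmx0.
  exact: pentagon_b0.
have [phi0|nphi] := eqVneq (X 1 2 *m X 2 3) 0; last exact: pentagon_phi.
have [c0|nc] := eqVneq (X 0 1 *m X 1 4) 0; last exact: pentagon_square.
exact: pentagon_b1.
Qed.

End PentagonConclusion.

Section Square.
Variables (K : fieldType) (d : nat -> nat) (X : forall s t, 'M[K]_(d s, d t)).

(** The vertex of the square behind a vertex of the pentagon. *)
Definition collapse v := if v is v'.+3 then v'.+2 else v.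

(** For p = 2 and r = 3 there is one square, with two consecutive steps composing
    to zero.  Doubling the vertex 2 turns such a module into one of the
    pentagon, with the vertices 2 and 3 joined by an identity map.  The basis
    found there at 3 serves for the vertex 2; the map 1 -> 2 is then given by a
    product of two matrices of size at most 3 with entries at most 3, whence
    the bound 27. *)
Theorem square_std : rep_indec (arrow 3 2) X -> X 2 2 = 1%:M ->
  X 0 1 *m X 1 2 = 0 -> X 1 2 *m X 2 3 = 0 -> X 0 1 *m X 1 3 = X 0 2 *m X 2 3 ->
  X 1 3 = 0 /\ X 0 2 = 0 \/ rep_std (arrow 3 2) X 27.
Proof.
move=> [[v nv] indec] X22 a01 a12 ab.
pose X' s t : 'M[K]_(d (collapse s), d (collapse t)) := X (collapse s) (collapse t).
have iX' : rep_indec (arrow 4 3) X'.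
  split.
    case: v nv => [|[|[|v]]] nv; [by exists 0%N|by exists 1%N|by exists 2|].
    by exists v.+4.
  move=> P' PP PX.
  pose P v : 'M[K]_(d v) :=
    match v with 0%N => P' 0%N | 1%N => P' 1%N | 2%N => P' 2 | v'.+3 => P' v'.+4 end.
  have P23 : P' 2 = P' 3.
    by have := PX 2 3 isT; rewrite /X' /= X22 mulmx1 mul1mx.
  have [|s t|P0|P1] := indec P.
  - by case=> [|[|[|u]]]; [exact: (PP 0%N)|exact: (PP 1%N)|exact: (PP 2)|exact: (PP u.+4)].
  - case/andP=> le_t /orP[]/eqP e; subst t.
      case: s le_t => [|[|[|s]]] //= _; [exact: (PX 0%N 1%N)|exact: (PX 1%N 2)|].
      by rewrite P23; apply: (PX 3 4).
    case: s le_t => [|[|s]] le_t; last by exfalso; lia.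
      by rewrite /= P23; apply: (PX 0%N 3).
    exact: (PX 1%N 4).
  - left=> -[|[|[|[|u]]]]; [exact: (P0 0%N)|exact: (P0 1%N)|exact: (P0 2)| |exact: (P0 u.+3)].
    by rewrite -P23; apply: (P0 2).
  right=> -[|[|[|[|u]]]]; [exact: (P1 0%N)|exact: (P1 1%N)|exact: (P1 2)| |exact: (P1 u.+3)].
  by rewrite -P23; apply: (P1 2).
have [|||[]|[k [kN [T [S [TS ST TX]]]]]] := pentagon_std iX'.
- by rewrite /X' /= a01 mul0mx.
- by rewrite /X' /= X22 mulmx1.
- exact: ab.
- by left.
right; pose e v := if v is v'.+2 then v'.+3 else v.
pose T' v : 'M_(k (e v), d v) :=
  match v with 0%N => T 0%N | 1%N => T 1%N | v'.+2 => T v'.+3 end.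
pose S' v : 'M_(d v, k (e v)) :=
  match v with 0%N => S 0%N | 1%N => S 1%N | v'.+2 => S v'.+3 end.
have big (B : nat) : (B <= 3 -> B <= 27)%N by move/leq_trans; apply.
exists (k \o e); split=> [u|]; first exact: big (kN _).
exists T', S'; split=> [u|u|s t].
- by case: u => [|[|u]]; [exact: (TS 0%N)|exact: (TS 1%N)|exact: (TS u.+3)].
- by case: u => [|[|u]]; [exact: (ST 0%N)|exact: (ST 1%N)|exact: (ST u.+3)].
case/andP=> le_t /orP[]/eqP et; subst t; last first.
  case: s le_t => [|[|s]] le_t; last by exfalso; lia.
    by have [B leB TE] := TX 0%N 3 isT; exists B => // i j; apply: big.
  by have [B leB TE] := TX 1%N 4 isT; exists B => // i j; apply: big.
case: s le_t => [|[|[|s]]] //= _.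
- by have [B leB TE] := TX 0%N 1%N isT; exists B => // i j; apply: big.
- have [B leB TE] := TX 1%N 2 isT; have [C leC TE'] := TX 2 3 isT.
  rewrite /X' /= X22 mulmx1 in TE'.
  exists (\matrix_(i, j) \sum_l (B i l * C l j)%N) => [i j|].
    rewrite mxE; apply: (@leq_trans (\sum_(l < k 2) 9)%N).
      by apply: leq_sum => l _; apply: (@leq_mul _ _ 3 3).
    by rewrite sum_nat_const card_ord (@leq_mul _ _ 3 9).
  rewrite -[LHS]/(T 1%N *m X' 1%N 2) TE TE' mulmxA; congr (_ *m _).
  apply/matrixP => i j; rewrite !mxE natr_sum; apply: eq_bigr => l _.
  by rewrite !mxE natrM.
by have [B leB TE] := TX 3 4 isT; exists B => // i j; apply: big.
Qed.

End Square.

(** * The basis of S(B+, 2, r) *)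
Section InfiniteField.
Variable K : fieldType.
Hypothesis infK : infinite_set [set: K]%classic.

Lemma infinite_notin (s : seq K) : exists x, x \notin s.
Proof.
apply: contrapT => /forallNP h; apply: infK.
apply: (@sub_finite_set _ _ [set` s]%classic); last exact: finite_seq.
by move=> x _ /=; apply: contrapT => /negP; apply: h.
Qed.

Lemma infinite_uniq (s : seq K) n : exists t : seq K,
  [/\ size t = n, uniq t & forall x, x \in t -> x \notin s].
Proof.
elim: n => [|n [t [st ut nt]]]; first by exists [::].
have [x] := infinite_notin (s ++ t); rewrite mem_cat negb_or => /andP[xs xt].
exists (x :: t); split=> /=; rewrite ?st // ?xt //.
by move=> y; rewrite inE => /predU1P[->|/nt].
Qed.

Lemma infinite_nonroot (p : {poly K}) : p != 0 -> exists x, p.[x] != 0.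
Proof.
move=> nzp; have [t [st ut _]] := infinite_uniq [::] (size p).
apply: contrapT => /forallNP h.
have al : all (root p) t.
  apply/allP => x _; apply/rootP.
  by apply: contrapT => n; apply: (h x); apply/eqP.
by have := max_poly_roots nzp al ut; rewrite st ltnn.
Qed.

(** The powers of c separate the weights below n; such a c exists because it only
    has to avoid the roots of a nonzero polynomial. *)
Lemma generic_torus n : exists2 c : K, c != 0 &
  forall s t, (s < n)%N -> (t < n)%N -> c ^+ s = c ^+ t -> s = t.
Proof.
pose p : {poly K} := 'X * \prod_(1 <= m < n) ('X^m - 1%:P).
have nzp : p != 0.
  rewrite mulf_neq0 ?polyX_eq0 // prodf_seq_neq0; apply/allP => m.
  rewrite mem_index_iota => /andP[m0 _] /=; rewrite -size_poly_eq0 size_XnsubC //.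
have [c] := infinite_nonroot nzp; rewrite /p hornerM hornerX mulf_eq0 negb_or.
move=> /andP[nzc]; rewrite horner_prod prodf_seq_neq0 => /allP h.
exists c => //.
have main s t : (s < t)%N -> (t < n)%N -> c ^+ s <> c ^+ t.
  move=> lt_st lt_tn e; have /= := h (t - s)%N.
  rewrite mem_index_iota subn_gt0 lt_st (leq_ltn_trans (leq_subr _ _)) //.
  move=> /(_ isT); rewrite hornerD hornerN hornerC hornerXn subr_eq0 => /eqP; apply.
  apply: (mulfI (expf_neq0 s nzc)).
  by rewrite -exprD subnKC ?mulr1 // ltnW.
move=> s t lts ltt e; case: (ltngtP s t) => // lt.
  by case: (main s t).
by case: (main t s).
Qed.

End InfiniteField.

Section Words.
Variables (K : fieldType) (n : nat).

(** Indices of n x ... x n are words; the standard encoding by pairs gives them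
    letter by letter. *)
Fixpoint letter r : 'I_(n ^ r.+1) -> nat -> 'I_n :=
  match r with
  | 0 => fun i _ => i
  | r'.+1 => fun i k => if k is k'.+1 then letter (mxtens_unindex i).2 k'
                        else (mxtens_unindex i).1
  end.

Fixpoint word r : (nat -> 'I_n) -> 'I_(n ^ r.+1) :=
  match r with
  | 0 => fun f => f 0%N
  | r'.+1 => fun f => mxtens_index (f 0%N, word r' (fun k => f k.+1))
  end.

Lemma letter_word r f k : (k <= r)%N -> letter (word r f) k = f k.
Proof.
elim: r f k => [|r IH] f k le_k; first by case: k le_k.
have K1 := mxtens_indexK (f 0%N, word r (fun k => f k.+1)).
case: k le_k => [|k] le_k; first by move/(congr1 fst): K1.
transitivity (letter (word r (fun k => f k.+1)) k); last exact: IH.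
exact: (congr1 (fun w => letter w k) (congr1 snd K1)).
Qed.

Lemma letter_inj r (i j : 'I_(n ^ r.+1)) :
  (forall k, (k <= r)%N -> letter i k = letter j k) -> i = j.
Proof.
elim: r i j => [|r IH] i j e; first exact: (e 0%N).
rewrite -[i]mxtens_unindexK -[j]mxtens_unindexK.
have e1 : (mxtens_unindex i).1 = (mxtens_unindex j).1 := e 0%N isT.
have e2 : (mxtens_unindex i).2 = (mxtens_unindex j).2.
  by apply: IH => k le_k; apply: (e k.+1).
by rewrite [mxtens_unindex i]surjective_pairing e1 e2 -surjective_pairing.
Qed.

Lemma ntensmxE (g : 'M[K]_n) r i j :
  (g ^t r.+1) i j = \prod_(k < r.+1) g (letter i k) (letter j k).
Proof.
elim: r i j => [|r IH] i j; first by rewrite big_ord1 ntensmx1.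
by rewrite ntensmxSS big_ord_recl /tensmx mxE IH.
Qed.

End Words.

Lemma borel_schur_val_sum (K : fieldType) n r (J : Type) (s : seq J)
    (f : J -> borel_schur K n r) :
  borel_schur_val (\sum_(j <- s) f j) = \sum_(j <- s) borel_schur_val (f j).
Proof. by elim: s => [|j s IH]; rewrite ?big_nil // !big_cons -IH. Qed.

Section Rank2.
Variables (K : fieldType) (r : nat).
Hypothesis infK : infinite_set [set: K]%classic.
Local Notation A := (borel_schur K 2 r.+1).
Local Notation E := (tensor_end K 2 r.+1).
Local Notation S := (@borel_schur_pred K 2 r.+1).
Local Notation I := 'I_(2 ^ r.+1).
Local Notation R := r.+1.

Definition zeros (i : I) : {set 'I_R} := [set k : 'I_R | letter i k == ord0].
Definition setword (Z : {set 'I_R}) : I :=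
  word r (fun k => if inord k \in Z then ord0 else ord_max).

Lemma setwordK : cancel setword zeros.
Proof.
move=> Z; apply/setP => k; rewrite in_set /setword.
rewrite (@letter_word 2 r); last by rewrite -ltnS ltn_ord.
by rewrite inord_val; case: ifP.
Qed.

Lemma zerosK : cancel zeros setword.
Proof.
move=> i; apply: letter_inj => k le_k; rewrite /setword (@letter_word 2 r) //.
rewrite /zeros in_set inordK //.
case: eqP => [-> //|]; move: (letter i k) => l nl; apply/val_inj.
by case: l nl => [[|[|l]] lt] // nl; case: nl; apply/val_inj.
Qed.

(** The sum of the matrix units from words of weight s to words of weight t that
    arise by turning letters 1 into letters 0. *)
Definition Fmx s t : E :=
  \matrix_(i, j) [&& zeros j \subset zeros i, #|zeros j| == s & #|zeros i| == t]%:R.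

Lemma count_between (X Y : {set 'I_R}) m : X \subset Y -> (#|X| <= m)%N ->
  #|[set Z : {set 'I_R} | [&& X \subset Z, Z \subset Y & #|Z| == m]]|
    = 'C(#|Y| - #|X|, m - #|X|).
Proof.
move=> sXY leXm.
have -> : (#|Y| - #|X|)%N = #|Y :\: X| by rewrite cardsD (setIidPr sXY).
pose D := [set B : {set 'I_R} | (B \subset Y :\: X) && (#|B| == (m - #|X|)%N)].
rewrite -cards_draws -/D.
suff imD : [set B :|: X | B in D] =
    [set Z : {set 'I_R} | [&& X \subset Z, Z \subset Y & #|Z| == m]].
  rewrite -imD card_in_imset // => B B'.
  rewrite !inE !subsetD => /andP[/andP[_ d1] _] /andP[/andP[_ d2] _] e.
  have h (C : {set 'I_R}) : [disjoint C & X] -> (C :|: X) :\: X = C.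
    by move=> d; rewrite setDUl setDv setU0; apply/setDidPl.
  by rewrite -(h B) // e h.
apply/setP => Z; rewrite [in RHS]inE; apply/imsetP/idP; last first.
    case/and3P=> sXZ sZY /eqP cZ; exists (Z :\: X); last first.
      by rewrite -[LHS](setID Z X) (setIidPr sXZ) setUC.
    by rewrite inE setSD //= cardsD (setIidPr sXZ) cZ eqxx.
  case=> B; rewrite inE subsetD => /andP[/andP[sBY dBX] /eqP cB] ->.
  rewrite subsetUr subUset sBY sXY /= cardsU.
  have -> : B :&: X = set0 by apply/eqP; rewrite setI_eq0.
  by rewrite cards0 subn0 cB subnK.
Qed.

Lemma Fmx_orth s t u v : t != u -> Fmx u v *m Fmx s t = 0.
Proof.
move=> ne; apply/matrixP => i j; rewrite !mxE big1 // => k _; rewrite !mxE.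
case: (#|zeros k| =P u) => [->|_]; rewrite /= ?andbF ?mul0r //.
by rewrite (eq_sym u) (negPf ne) !andbF mulr0.
Qed.

(** The coefficient counts the sets of size t between the zero sets of the two
    words. *)
Lemma Fmx_comp s t u : (s <= t <= u)%N ->
  Fmx t u *m Fmx s t = 'C(u - s, t - s)%:R *: Fmx s u.
Proof.
case/andP=> le_st le_tu; apply/matrixP => i j; rewrite !mxE.
transitivity (\sum_k [&& zeros j \subset zeros k, zeros k \subset zeros i & #|zeros k| == t]%:R
   * ((#|zeros j| == s) && (#|zeros i| == u))%:R : K).
  apply: eq_bigr => k _; rewrite !mxE -!natrM !mulnb; congr (nat_of_bool _)%:R.
  by do !case: (_ \subset _); do !case: (_ == _).
rewrite -mulr_suml -natr_sum.
have [/andP[/eqP es /eqP eu]|_] := boolP ((#|zeros j| == s) && _); last first.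
  by rewrite !andbF !mulr0.
rewrite andbT mulr1.
have [sji|nsji] := boolP (zeros j \subset zeros i); last first.
  rewrite mulr0 big1 // => k _; case: and3P => // -[h1 h2 _].
  by rewrite (subset_trans h1 h2) in nsji.
rewrite mulr1; congr (_%:R).
rewrite -es -eu -count_between ?es // -sum1_card.
rewrite [RHS](reindex zeros) /=; last by exists setword => ? _; rewrite ?zerosK ?setwordK.
rewrite [RHS]big_mkcond /=; apply: eq_bigr => k _; rewrite inE.
by case: (_ && _).
Qed.

Lemma Fmx_out s t : ~~ (s <= t <= R)%N -> Fmx s t = 0.
Proof.
move=> h; apply/matrixP => i j; rewrite !mxE.
case: and3P => // -[sji /eqP es /eqP et]; case/negP: h; rewrite -es -et.
by rewrite subset_leq_card // -[R in (_ <= R)%N]card_ord max_card.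
Qed.

Lemma zeros_inj : injective zeros. Proof. exact: can_inj zerosK. Qed.

Lemma Fmx_diag i j s : Fmx s s i j = ((i == j) && (#|zeros i| == s))%:R.
Proof.
rewrite mxE; congr (nat_of_bool _)%:R; apply/and3P/andP.
  case=> sji /eqP ej /eqP ei; split; last exact/eqP.
  by rewrite eq_sym -(inj_eq zeros_inj) eqEcard sji ej ei leqnn.
by case=> /eqP-> ->.
Qed.

Lemma card_zeros_lt (i : I) : (#|zeros i| < R.+1)%N.
Proof. by rewrite ltnS -[R in (_ <= R)%N]card_ord max_card. Qed.

Lemma Fmx_one : \sum_(s < R.+1) Fmx s s = 1%:M :> E.
Proof.
apply/matrixP => i j; rewrite summxE.
under eq_bigr do rewrite Fmx_diag.
rewrite (bigD1 (Ordinal (card_zeros_lt i))) //= big1 ?addr0.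
  by rewrite eqxx andbT !mxE.
move=> s ne; suff /negPf-> : #|zeros i| != s by rewrite andbF.
by rewrite eq_sym; move: ne; rewrite -val_eqE.
Qed.

(** A letter 0 of the column word forces a letter 0 of the row word, as g is
    upper triangular, and the other letters contribute g01 or g11. *)
Lemma tensor_rep_Fmx (g : 'M[K]_2) : g \in @borel K 2 ->
  @tensor_rep K 2 R g = \sum_(s < R.+1) \sum_(t < R.+1)
     (g 0 0 ^+ s * g 0 1 ^+ (t - s) * g 1 1 ^+ (R - t)) *: Fmx s t.
Proof.
rewrite inE => /andP[_ /is_trig_mxP trig].
have g10 : g 1 0 = 0 by have := trig 0 1 isT; rewrite mxE.
apply/matrixP => i j; rewrite /tensor_rep ntensmxE summxE.
under [RHS]eq_bigr do rewrite summxE.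
rewrite (bigD1 (Ordinal (card_zeros_lt j))) //= [X in _ = _ + X]big1 ?addr0; last first.
  move=> s ne; apply: big1 => t _; rewrite !mxE.
  suff /negPf-> : #|zeros j| != s by rewrite andbF mulr0.
  by rewrite eq_sym; move: ne; rewrite -val_eqE.
rewrite (bigD1 (Ordinal (card_zeros_lt i))) //= [X in _ = _ + X]big1 ?addr0; last first.
  move=> t ne; rewrite !mxE.
  suff /negPf-> : #|zeros i| != t by rewrite !andbF mulr0.
  by rewrite eq_sym; move: ne; rewrite -val_eqE.
rewrite !mxE !eqxx !andbT.
have L (l : 'I_2) : l = if l == ord0 then 0 else 1.
  by case: l => [[|[|l]] lt] //; apply/val_inj.
have [sji|/subsetPn[k kj ki]] := boolP (zeros j \subset zeros i); last first.
  rewrite mulr0 (bigD1 k) //= (L (letter i k)) (L (letter j k)).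
  by move: kj ki; rewrite !inE => -> /negPf ->; rewrite g10 mul0r.
rewrite mulr1 (bigID (mem (zeros j))) /=.
rewrite (eq_bigr (fun=> g 0 0)); last first.
  move=> k kj; rewrite (L (letter i k)) (L (letter j k)).
  by move/subsetP/(_ k kj): sji; move: kj; rewrite !inE => -> ->.
rewrite prodr_const -mulrA; congr (_ * _).
rewrite (bigID (mem (zeros i))) /=; congr (_ * _).
  rewrite (eq_bigr (fun=> g 0 1)); last first.
    move=> k /andP[kj ki]; rewrite (L (letter i k)) (L (letter j k)).
    by move: kj ki; rewrite !inE => /negPf-> ->.
  rewrite prodr_const; congr (_ ^+ _).
  have <- : #|zeros i :\: zeros j| = (#|zeros i| - #|zeros j|)%N.
    by rewrite cardsD (setIidPr sji).
  by apply: eq_card => k; rewrite [in RHS]inE.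
rewrite (eq_bigr (fun=> g 1 1)); last first.
  move=> k /andP[kj ki]; rewrite (L (letter i k)) (L (letter j k)).
  by move: kj ki; rewrite !inE => /negPf-> /negPf->.
rewrite prodr_const; congr (_ ^+ _).
have <- : #|~: zeros i| = (R - #|zeros i|)%N by rewrite cardsCs setCK card_ord.
apply: eq_card => k; rewrite [in RHS]inE !unfold_in.
apply/andP/idP => [[] //|ki]; split=> //; apply: contraNN ki.
exact: (subsetP sji).
Qed.

Lemma subalgS : GRing.subalg_closed S. Proof. exact: borel_schur_subalg. Qed.

Definition upper2 (a b c : K) : 'M[K]_2 :=
  \matrix_(i, j) if i == j then (if i == 0 then a else c) else if i == 0 then b else 0.

Lemma upper2_borel a b c : a != 0 -> c != 0 -> upper2 a b c \in @borel K 2.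
Proof.
move=> nza nzc; rewrite inE; apply/andP; split; last first.
  apply/is_trig_mxP => i j lt_ij; rewrite !mxE.
  case: eqP => [e|_]; first by rewrite e ltnn in lt_ij.
  by case: eqP => // e; rewrite e in lt_ij.
rewrite unitmxE -det_tr det_trig; last first.
  apply/is_trig_mxP => i j lt_ij; rewrite !mxE.
  case: eqP => [e|_]; first by rewrite e ltnn in lt_ij.
  by case: eqP => // e; rewrite e in lt_ij.
by rewrite unitfE prodf_seq_neq0; apply/allP => i _ /=; rewrite !mxE eqxx; case: ifP.
Qed.

Lemma Smul (a b : E) : a \in S -> b \in S -> (a *m b : E) \in S.
Proof. by case: subalgS => _ _; apply. Qed.

Lemma Fmx_idl s t : Fmx t t *m Fmx s t = Fmx s t.
Proof.
have [le_st|nle] := boolP (s <= t <= R)%N; last by rewrite (Fmx_out nle) mulmx0.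
have /andP[le_st' _] := le_st.
by rewrite Fmx_comp ?le_st' ?leqnn // binn scale1r.
Qed.

Lemma Fmx_idr s t : Fmx s t *m Fmx s s = Fmx s t.
Proof.
have [le_st|nle] := boolP (s <= t <= R)%N; last by rewrite (Fmx_out nle) mul0mx.
have /andP[le_st' _] := le_st.
by rewrite Fmx_comp ?le_st' ?leqnn // subnn bin0 scale1r.
Qed.

Lemma S_lin c (a b : E) : a \in S -> b \in S -> c *: a + b \in S.
Proof. by case: subalgS => _ h _; apply: h. Qed.

Lemma S0 : (0 : E) \in S.
Proof.
case: subalgS => h1 h _; have := h (-1) _ _ h1 h1.
by rewrite scaleN1r addNr.
Qed.

Lemma S_scale c (a : E) : a \in S -> c *: a \in S.
Proof. by move=> h; rewrite -[c *: a]addr0; apply: S_lin => //; apply: S0. Qed.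

Lemma S_sum (J : Type) (s : seq J) (P : pred J) (f : J -> E) :
  (forall j, P j -> f j \in S) -> \sum_(j <- s | P j) f j \in S.
Proof.
move=> h; apply: (big_ind (fun a : E => a \in S)) => //; first exact: S0.
by move=> a b ha hb; rewrite -[a]scale1r; apply: S_lin.
Qed.

Lemma tensor_rep_mem g : g \in @borel K 2 -> @tensor_rep K 2 R g \in S.
Proof. by move=> hg; rewrite -[tensor_rep _ _]scale1r; apply: borel_schur_gen. Qed.

Lemma torus_mem c : c != 0 -> \sum_(s < R.+1) c ^+ s *: Fmx s s \in S.
Proof.
move=> nzc; have := tensor_rep_mem (upper2_borel 0 nzc (oner_neq0 K)).
rewrite tensor_rep_Fmx ?upper2_borel ?oner_neq0 //.
congr (_ \in S); apply: eq_bigr => s _; rewrite (bigD1 s) //= big1 ?addr0.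
  by rewrite !mxE /= subnn expr0 mulr1 expr1n mulr1.
move=> t ne; rewrite !mxE /=; have [lt|le] := ltnP s t.
  by rewrite expr0n subn_eq0 leqNgt lt mulr0 mul0r scale0r.
rewrite Fmx_out ?scaler0 // negb_and -ltnNge ltn_neqAle le andbT.
by rewrite -val_eqE in ne; rewrite /= ne.
Qed.

(** Lagrange interpolation: the torus element diag(c, 1) acts on weight s by c^s,
    and these values are distinct for a generic c. *)
Lemma Fmx_mem_diag s : Fmx s s \in S.
Proof.
have [lt|le] := ltnP s R.+1; last first.
  by rewrite Fmx_out ?S0 // negb_and -!ltnNge le orbT.
have [c nzc inj_c] := generic_torus infK R.+1.
pose p : {poly K} := \prod_(m < R.+1 | val m != s) ('X - (c ^+ m)%:P).
have pE t : (t < R.+1)%N -> (p.[c ^+ t] == 0) = (t != s).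
  move=> ltt; rewrite horner_prod; apply/idP/idP.
    apply: contraLR; rewrite negbK => /eqP->; apply/prodf_neq0 => m ne.
    rewrite hornerXsubC subr_eq0; apply: contra ne => /eqP e.
    by rewrite (inj_c s m).
  move=> ne; rewrite (bigD1 (Ordinal ltt)) //= hornerXsubC subrr mul0r //.
have nz : p.[c ^+ s] != 0 by rewrite pE // eqxx.
have -> : Fmx s s = \sum_(k < size p) ((p.[c ^+ s])^-1 * p`_k) *:
    \sum_(t < R.+1) (c ^+ k) ^+ t *: Fmx t t.
  transitivity (\sum_(t < R.+1) ((p.[c ^+ s])^-1 * p.[c ^+ t]) *: Fmx t t).
    rewrite (bigD1 (Ordinal lt)) //= big1 ?addr0 ?mulVf ?scale1r // => t ne.
    have /eqP-> : p.[c ^+ t] == 0 by rewrite pE // -val_eqE in ne *.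
    by rewrite mulr0 scale0r.
  under [RHS]eq_bigr do rewrite scaler_sumr.
  rewrite exchange_big /=; apply: eq_bigr => t _.
  rewrite (horner_coef p (c ^+ t)) mulr_sumr scaler_suml; apply: eq_bigr => k _.
  by rewrite scalerA mulrA -!exprM mulnC.
apply: S_sum => k _; apply: S_scale; apply: torus_mem.
by rewrite expf_neq0.
Qed.

(** T of the unipotent matrix is the sum of all the F s t, and the idempotents
    F s s isolate its components. *)
Lemma Fmx_mem s t : Fmx s t \in S.
Proof.
have [/andP[le_st le_tR]|out] := boolP (s <= t <= R)%N; last by rewrite Fmx_out ?S0.
pose U : E := \sum_(s' < R.+1) \sum_(t' < R.+1) Fmx s' t'.
have SU : U \in S.
  have := tensor_rep_mem (upper2_borel 1 (oner_neq0 K) (oner_neq0 K)).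
  rewrite tensor_rep_Fmx ?upper2_borel ?oner_neq0 //.
  congr (_ \in S); apply: eq_bigr => s' _; apply: eq_bigr => t' _.
  by rewrite !mxE /= !expr1n !mulr1 scale1r.
have lts : (s < R.+1)%N by rewrite ltnS (leq_trans le_st).
have ltt : (t < R.+1)%N by rewrite ltnS.
have -> : Fmx s t = (Fmx t t *m U) *m Fmx s s.
  rewrite mulmx_sumr mulmx_suml (bigD1 (Ordinal lts)) //= [X in _ + X]big1 ?addr0.
    rewrite mulmx_sumr mulmx_suml (bigD1 (Ordinal ltt)) //= [X in _ + X]big1 ?addr0.
      by rewrite Fmx_idl Fmx_idr.
    by move=> t' ne; rewrite Fmx_orth ?mul0mx.
  move=> s' ne; rewrite mulmx_sumr mulmx_suml big1 // => t' _.
  by rewrite -mulmxA [X in _ *m X]Fmx_orth ?mulmx0 // eq_sym.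
by apply: Smul; first apply: Smul; rewrite ?Fmx_mem_diag.
Qed.

Definition F s t : A := BorelSchur (Fmx_mem s t).

Definition weightword s : I := setword [set k : 'I_R | (k < s)%N].

(** F s t has entry 1 at the words 0^s 1...1 and 0^t 1...1, so one entry
    reads off each coordinate. *)
Definition coef (a : A) s t : K := (borel_schur_val a) (weightword t) (weightword s).

Lemma zeros_weightword s : zeros (weightword s) = [set k : 'I_R | (k < s)%N].
Proof. exact: setwordK. Qed.

Lemma card_weightword s : (s <= R)%N -> #|zeros (weightword s)| = s.
Proof.
move=> le_s; rewrite zeros_weightword -sum1dep_card (big_ord_narrow le_s).
by rewrite sum1_card card_ord.
Qed.

Lemma Fmx_weightword s t s' t' : (s <= t)%N -> (s' <= R)%N -> (t' <= R)%N ->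
  Fmx s t (weightword t') (weightword s') = ((s' == s) && (t' == t))%:R.
Proof.
move=> le_st le_s' le_t'; rewrite !mxE !card_weightword //.
case: (s' =P s) => [->|_]; last by rewrite andbF.
case: (t' =P t) => [->|_]; last by rewrite !andbF.
rewrite !zeros_weightword !andbT; case: subsetP => // -[] k; rewrite !inE.
by move=> h; apply: leq_trans le_st.
Qed.

Lemma S_span (a : E) : a \in S -> exists c : nat -> nat -> K,
  a = \sum_(s < R.+1) \sum_(t < R.+1) c s t *: Fmx s t.
Proof.
case/asboolP=> k [c [g [Bg ->]]].
exists (fun s t => \sum_i c i * (g i 0 0 ^+ s * g i 0 1 ^+ (t - s) * g i 1 1 ^+ (R - t))).
under [RHS]eq_bigr => s _ do under eq_bigr => t _ do rewrite scaler_suml.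
under [RHS]eq_bigr => s _ do rewrite exchange_big /=.
rewrite exchange_big /=; apply: eq_bigr => i _.
rewrite tensor_rep_Fmx // scaler_sumr; apply: eq_bigr => s _.
by rewrite scaler_sumr; apply: eq_bigr => t _; rewrite scalerA.
Qed.

Lemma coef_expand (a : A) : a = \sum_(s < R.+1) \sum_(t < R.+1) coef a s t *: F s t.
Proof.
apply: val_inj; rewrite /= borel_schur_val_sum.
under eq_bigr do rewrite borel_schur_val_sum.
case: a => a Sa; rewrite /coef /=; have [c aE] := S_span Sa.
rewrite [LHS]aE; apply: eq_bigr => s _; apply: eq_bigr => t _.
rewrite -[RHS]/(_ *: Fmx s t).
have [le_st|lt] := leqP s t; last first.
  by rewrite Fmx_out ?scaler0 // negb_and -ltnNge lt.
congr (_ *: _); rewrite aE summxE (bigD1 s) //= [X in _ + X]big1 ?addr0.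
  rewrite summxE (bigD1 t) //= [X in _ + X]big1 ?addr0.
    by rewrite mxE (Fmx_weightword le_st (leq_ord s) (leq_ord t)) !eqxx mulr1.
  move=> t' ne; rewrite mxE; have [le|lt] := leqP s t'; last first.
    by rewrite Fmx_out ?mxE ?mulr0 // negb_and -ltnNge lt.
  rewrite (Fmx_weightword le (leq_ord s) (leq_ord t)) eqxx /=.
  by rewrite eq_sym; move: ne; rewrite -val_eqE => /negPf->; rewrite mulr0.
move=> s' ne; rewrite summxE big1 // => t' _; rewrite mxE.
have [le|lt] := leqP s' t'; last first.
  by rewrite Fmx_out ?mxE ?mulr0 // negb_and -ltnNge lt.
rewrite (Fmx_weightword le (leq_ord s) (leq_ord t)) (eq_sym (val s)).
by move: ne; rewrite -val_eqE => /negPf->; rewrite mulr0.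
Qed.

Lemma coef_lin c a b s t : coef (c *: a + b) s t = c * coef a s t + coef b s t.
Proof. by rewrite /coef /= !mxE. Qed.

Lemma coefF s t s' t' : (s <= t)%N -> (s' <= R)%N -> (t' <= R)%N ->
  coef (F s t) s' t' = ((s' == s) && (t' == t))%:R.
Proof. exact: Fmx_weightword. Qed.

Lemma F_graded_basis :
  graded_basis R F (fun s t u => 'C(u - s, t - s)%:R).
Proof.
split.
- by move=> s t u v ne; apply: val_inj; rewrite /= -[LHS]/(Fmx u v *m Fmx s t) Fmx_orth.
- by move=> s t u le; apply: val_inj; rewrite /= -[LHS]/(Fmx t u *m Fmx s t) Fmx_comp.
- by move=> s t out; apply: val_inj; rewrite /= Fmx_out.
- by apply: val_inj; rewrite /= borel_schur_val_sum Fmx_one.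
- by move=> s t; rewrite subnn bin0.
by move=> s t; rewrite binn.
Qed.

End Rank2.

(** * Finite type *)
(** Vandermonde's identity: the terms with a proper binomial of p vanish. *)
Lemma bin_addp p j k : prime p -> (k < p)%N -> 'C(p + j, k) = 'C(j, k) %[mod p].
Proof.
move=> pr_p lt_kp; rewrite -binomial.Vandermonde big_ord_recl /= bin0 mul1n subn0.
rewrite -[in RHS](addn0 'C(j, k)) -modnDmr; congr ((_ + _) %% _)%N.
apply/eqP; apply: dvdn_sum => i _.
by apply: dvdn_mulr; apply: prime_dvd_bin => //; rewrite /= (leq_ltn_trans _ lt_kp).
Qed.

Lemma pchar_bin (K : fieldType) p j k : p \in [pchar K] -> (k < p)%N ->
  'C(p + j, k)%:R = 'C(j, k)%:R :> K.
Proof.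
move=> pK lt_kp; have pr_p := pcharf_prime pK.
by rewrite -(GRing.natr_mod_pchar pK) bin_addp // (GRing.natr_mod_pchar pK).
Qed.

Section Rank2Finite.
Variables (K : fieldType) (r p : nat).
Hypothesis infK : infinite_set [set: K]%classic.
Local Notation R := r.+1.
Local Notation A := (borel_schur K 2 R).
Local Notation F := (F r infK).
Hypothesis natp : forall m, (0 < m < p)%N -> m%:R != 0 :> K.
Hypothesis p_gt0 : (0 < p)%N.

(** A gap below p is climbed one step at a time, dividing by its length.  If the
    gap is p + j with j < p, the long arrow followed by j steps does it, since
    'C(p + j, j) = 1 in K. *)
Lemma F_generates : (R < p)%N \/ p \in [pchar K] /\ (R < 2 * p)%N ->
  generates (arrows (r := R) F (arrow R p)).
Proof.
move=> hR P P1 Plin PM Pg.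
have [orth comp out one _ _] := F_graded_basis r infK.
have P0 : P 0 by have := Plin (-1) 1 1 P1 P1; rewrite scaleN1r addNr.
have PZ c a : P a -> P (c *: a) by move=> Pa; rewrite -[c *: a]addr0; apply: Plin.
have PD a b : P a -> P b -> P (a + b) by move=> Pa Pb; rewrite -[a]scale1r; apply: Plin.
have PFgen s t : (s <= R)%N -> (t <= R)%N -> (s == t) || arrow R p s t -> P (F s t).
  move=> les let_ Qst; have := Pg (inord s, inord t); rewrite /arrows /=.
  by rewrite -val_eqE /= !inordK // Qst.
have short m s : (m < p)%N -> (s + m <= R)%N -> P (F s (s + m)%N).
  elim: m => [|m IH] lt_mp le; first by rewrite addn0 in le *; apply: PFgen; rewrite ?eqxx.
  have := comp s (s + m)%N (s + m.+1)%N.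
  rewrite leq_addr leq_add2l leqnSn => /(_ isT).
  rewrite !addKn binSn => /(congr1 (fun x => m.+1%:R^-1 *: x)).
  rewrite scalerA mulVf ?natp //= scale1r => <-; apply: PZ; apply: PM.
    by apply: PFgen => //; rewrite ?/arrow; lia.
  by apply: IH; lia.
have PF s t : P (F s t).
  have [/andP[le_st le_tR]|h] := boolP (s <= t <= R)%N; last by rewrite out.
  have [lt|le] := ltnP (t - s)%N p.
    by have := short (t - s)%N s lt; rewrite subnKC //; apply.
  case: hR => [lt_Rp|[pK lt_R2p]]; first by lia.
  have [j tE] : exists j, t = (s + p + j)%N by exists (t - (s + p))%N; lia.
  subst t; have lt_jp : (j < p)%N by lia.
  have := comp s (s + p)%N (s + p + j)%N.
  rewrite !leq_addr => /(_ isT); rewrite -addnA !addKn.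
  rewrite -bin_sub ?leq_addr // addKn pchar_bin // binn scale1r => <-.
  apply: PM; first by rewrite addnA; apply: short => //; lia.
  by apply: PFgen; rewrite /arrow; lia.
move=> a; rewrite (coef_expand infK a).
apply: (big_ind P) => // s _; apply: (big_ind P) => // t _.
exact: PZ.
Qed.

End Rank2Finite.

Section Paths.
Variables (K : fieldType) (r p : nat).
Local Notation R := r.+1.
Variables (d : nat -> nat) (X : forall s t, 'M[K]_(d s, d t)).
Hypothesis gX : graded_rep R (fun s t u => 'C(u - s, t - s)%:R) X.
(** The composite of the t - s steps from s to t. *)
Definition path s t : 'M[K]_(d s, d t) := (t - s)`!%:R *: X s t.

Lemma path1 s : path s s = 1%:M.
Proof. by case: gX => _ h _; rewrite /path subnn scale1r h. Qed.

Lemma pathM s t u : (s <= t <= u)%N -> path s t *m path t u = path s u.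
Proof.
case: gX => _ _ h le; have /andP[le_st le_tu] := le.
rewrite /path -scalemxAl -scalemxAr h // !scalerA -!natrM; congr (_%:R *: _).
rewrite -(@bin_fact (u - s) (t - s)) ?leq_sub2r //.
have -> : (u - s - (t - s) = u - t)%N by lia.
by rewrite mulnC.
Qed.

Lemma path_step s : X s s.+1 = path s s.+1.
Proof. by rewrite /path subSnn scale1r. Qed.

Lemma path_p s : p \in [pchar K] -> path s (s + p) = 0.
Proof.
move=> pK; have p_gt0 := prime_gt0 (pcharf_prime pK); rewrite /path addKn.
have /eqP-> : p`!%:R == 0 :> K.
  by rewrite -(dvdn_pcharf pK) dvdn_fact // p_gt0 leqnn.
by rewrite scale0r.
Qed.

Lemma X_out v : (R < v)%N -> d v = 0%N. Proof. by case: gX => h _ _; apply: h. Qed.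

Lemma std_linear : (forall s t, arrow R p s t -> t = s.+1 \/ X s t = 0) ->
  rep_indec (arrow R p) X -> rep_std (arrow R p) X 1.
Proof. exact: (linear_std X_out path1 pathM path_step). Qed.

End Paths.

Section Rank2Conclusion.
Variables (K : fieldType) (r : nat).
Hypothesis infK : infinite_set [set: K]%classic.
Local Notation R := r.+1.
Local Notation A := (borel_schur K 2 R).

Lemma finite_type_rank2 p N : (forall m, (0 < m < p)%N -> m%:R != 0 :> K) -> (0 < p)%N ->
  (R < p)%N \/ p \in [pchar K] /\ (R < 2 * p)%N ->
  (forall d X, @graded_rep K R (fun s t u => 'C(u - s, t - s)%:R) d X ->
    rep_indec (arrow R p) X -> rep_std (arrow R p) X N) -> finite_type A.
Proof.
move=> natp p_gt0 hR std.
apply: (finite_type_graded (F_graded_basis r infK) (F_generates natp p_gt0 hR) _ std).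
by move=> s t /andP[_ /orP[]/eqP->]; rewrite // -{1}[s]addn0 ltn_add2l.
Qed.

Lemma finite_type_small p : (forall m, (0 < m < p)%N -> m%:R != 0 :> K) -> (R < p)%N ->
  finite_type A.
Proof.
move=> natp lt_Rp; apply: (finite_type_rank2 (N := 1) natp); [lia|by left|].
move=> d X gX iX; apply: (std_linear gX _ iX) => s t /andP[le_t /orP[/eqP->|/eqP e]].
  by left.
by exfalso; lia.
Qed.

Lemma finite_type_char0 : [pchar K] =i pred0 -> finite_type A.
Proof.
move/pcharf0P => h; apply: (@finite_type_small R.+1) => // m /andP[m_gt0 _].
by rewrite h -lt0n.
Qed.

Lemma natr_lt_pchar p m : p \in [pchar K] -> (0 < m < p)%N -> m%:R != 0 :> K.
Proof.
move=> pK /andP[m_gt0 lt_mp]; rewrite -(dvdn_pcharf pK).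
by apply/negP => /(dvdn_leq m_gt0); rewrite leqNgt lt_mp.
Qed.

Lemma finite_type_le p : p \in [pchar K] -> (R <= p)%N -> finite_type A.
Proof.
move=> pK; rewrite leq_eqVlt => /orP[/eqP e|lt]; last first.
  by apply: (@finite_type_small p) => // m; apply: natr_lt_pchar.
have p_gt1 := prime_gt1 (pcharf_prime pK).
have p_gt0 : (0 < p)%N by lia.
apply: (@finite_type_rank2 p 2) => //; [by move=> m; apply: natr_lt_pchar|by right; split=> //; lia|].
move=> d X gX.
rewrite -[in arrow R p]e; apply: (loop_std (X_out gX) (path1 gX) (pathM gX) (path_step X)).
  by rewrite e.
by have := path_p X 0 pK; rewrite add0n -e.
Qed.

End Rank2Conclusion.

Lemma finite_type_3_4 (K : fieldType) : infinite_set [set: K]%classic ->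
  3 \in [pchar K] -> finite_type (borel_schur K 2 4).
Proof.
move=> infK pK; have e3 : 3%:R = 0 :> K := pcharf0 pK.
apply: (@finite_type_rank2 K 3 infK 3 3) => //; first by move=> m; apply: natr_lt_pchar.
  by right.
move=> d X gX iX; have [_ X1 XM] := gX.
have a012 : X 0 1 *m X 1 2 *m X 2 3 = 0.
  by rewrite (XM 0 1 2)%N // -scalemxAl (XM 0 2 3)%N // [X in _ *: (X *: _)](e3 : 'C(3 - 0, 2 - 0)%:R = 0) scale0r scaler0.
have a123 : X 1 2 *m X 2 3 *m X 3 4 = 0.
  by rewrite (XM 1 2 3)%N // -scalemxAl (XM 1 3 4)%N // [X in _ *: (X *: _)](e3 : 'C(4 - 1, 3 - 1)%:R = 0) scale0r scaler0.
have ab : X 0 1 *m X 1 4 = X 0 3 *m X 3 4.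
  by rewrite (XM 0 1 4)%N // (XM 0 3 4)%N.
have [[b10 b00]|//] := pentagon_std iX a012 a123 ab.
apply: (@rep_std_leq _ _ _ _ 1) => //.
apply: (std_linear gX _ iX) => s t /andP[le_t /orP[/eqP->|/eqP e]]; first by left.
right; have {le_t} : (s < 2)%N by lia.
by subst t; case: s => [|[|s]].
Qed.

Lemma finite_type_2_3 (K : fieldType) : infinite_set [set: K]%classic ->
  2 \in [pchar K] -> finite_type (borel_schur K 2 3).
Proof.
move=> infK pK; have e2 : 2%:R = 0 :> K := pcharf0 pK.
apply: (@finite_type_rank2 K 2 infK 2 27) => //; first by move=> m; apply: natr_lt_pchar.
  by right.
move=> d X gX iX; have [_ X1 XM] := gX.
have a01 : X 0 1 *m X 1 2 = 0.
  by rewrite (XM 0 1 2)%N // [X in X *: _](e2 : 'C(2 - 0, 1 - 0)%:R = 0) scale0r.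
have a12 : X 1 2 *m X 2 3 = 0.
  by rewrite (XM 1 2 3)%N // [X in X *: _](e2 : 'C(3 - 1, 2 - 1)%:R = 0) scale0r.
have ab : X 0 1 *m X 1 3 = X 0 2 *m X 2 3.
  by rewrite (XM 0 1 3)%N // (XM 0 2 3)%N.
have [[b10 b00]|//] := square_std iX (X1 2) a01 a12 ab.
apply: (@rep_std_leq _ _ _ _ 1) => //.
apply: (std_linear gX _ iX) => s t /andP[le_t /orP[/eqP->|/eqP e]]; first by left.
right; have {le_t} : (s < 2)%N by lia.
by subst t; case: s => [|[|s]].
Qed.

(** In degree 1 the algebra is that of upper triangular matrices.  It has the
    graded basis of matrix units, with weights numbered from the bottom row so
    that arrows go up, and the step arrows form a linear quiver. *)
Section DegreeOne.
Variables (K : fieldType) (m : nat).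
Hypothesis infK : infinite_set [set: K]%classic.
Local Notation A := (borel_schur K m.+1 1).
Local Notation M := 'M[K]_m.+1.
Local Notation S := (@borel_schur_pred K m.+1 1).

(** Subtract the identity from an invertible upper triangular matrix that
    differs from it in one entry only; on the diagonal this takes an element
    of K other than 0 and 1. *)
Lemma elementary_mem (i j : 'I_m.+1) : (i <= j)%N -> (delta_mx i j : M) \in S.
Proof.
move=> le_ij.
have [c cn] := infinite_notin infK [:: 0; 1].
move: cn; rewrite !inE negb_or => /andP[nzc nc1].
pose u : K := if i == j then c - 1 else 1.
have nzu : u != 0 by rewrite /u; case: ifP; rewrite ?subr_eq0 ?oner_neq0.
pose g : M := 1%:M + u *: delta_mx i j.
have tg : is_trig_mx g^T.
  apply/is_trig_mxP => k l lt_kl; rewrite !mxE.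
  rewrite -val_eqE /= (gtn_eqF lt_kl) add0r.
  case: andP => [[/eqP e1 /eqP e2]|_]; last by rewrite mulr0.
  by move: lt_kl; rewrite e1 e2 ltnNge le_ij.
have Bg : g \in @borel K m.+1.
  rewrite inE tg andbT unitmxE -det_tr det_trig // unitfE prodf_seq_neq0.
  apply/allP => k _ /=; rewrite !mxE eqxx /u.
  have [eij|nij] := eqVneq i j; last first.
    suff -> : (k == i) && (k == j) = false by rewrite mulr0 addr0 oner_neq0.
    by apply/negbTE/negP => /andP[/eqP-> ]; apply/negP.
  rewrite -eij andbb; case: (k == i); last by rewrite mulr0 addr0 oner_neq0.
  by rewrite mulr1 addrC subrK.
have [S1 Slin _] := borel_schur_subalg K m.+1 1.
have Sg : (g : tensor_end K m.+1 1) \in S.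
  by have := @borel_schur_gen K m.+1 1 1 g Bg; rewrite scale1r.
have -> : (delta_mx i j : M) = u^-1 *: ((-1) *: 1%:M + g) + 0.
  by rewrite addr0 scaleN1r /g addKr scalerA mulVf // scale1r.
have S0 : (0 : tensor_end K m.+1 1) \in S.
  by have := Slin (-1) _ _ S1 S1; rewrite scaleN1r addNr.
by apply: (Slin _ _ _ _ S0); apply: (Slin (-1) _ _ S1 Sg).
Qed.

Definition Umx s t : M :=
  if (s <= t <= m)%N then delta_mx (inord (m - t)) (inord (m - s)) else 0.

Lemma Umx_mem s t : Umx s t \in S.
Proof.
rewrite /Umx; case: ifP => [/andP[le1 le2]|_].
  by apply: elementary_mem; rewrite !inordK; lia.
have [S1 Slin _] := borel_schur_subalg K m.+1 1.
by have := Slin (-1) _ _ S1 S1; rewrite scaleN1r addNr.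
Qed.

Definition U s t : A := BorelSchur (Umx_mem s t).

Lemma S_trig (a : M) : a \in S -> is_trig_mx a^T.
Proof.
case/asboolP=> k [c [g [Bg ->]]]; apply/is_trig_mxP => i j lt_ij.
rewrite mxE summxE big1 // => l _; rewrite !mxE.
have := Bg l; rewrite inE => /andP[_ /is_trig_mxP/(_ i j lt_ij)].
by rewrite !mxE => e; rewrite -[X in _ * X]/(g l j i) e mulr0.
Qed.

Lemma elementary_graded_basis : graded_basis m U (fun _ _ _ => 1).
Proof.
split=> //.
- move=> s t u v ne; apply: val_inj; rewrite /= -[LHS]/(Umx u v *m Umx s t) /Umx.
  case: ifP => h1; last by rewrite mul0mx.
  case: ifP => h2; last by rewrite mulmx0.
  rewrite mul_delta_mx_0 // -val_eqE /= !inordK; lia.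
- move=> s t u /andP[le_st le_tu]; apply: val_inj; rewrite scale1r /=.
  rewrite -[LHS]/(Umx t u *m Umx s t) /Umx le_st le_tu (leq_trans le_st le_tu) /=.
  case: (leqP u m) => h1; last by rewrite mul0mx.
  by rewrite (leq_trans le_tu h1) mul_delta_mx.
- by move=> s t out; apply: val_inj; rewrite /= /Umx (negPf out).
apply: val_inj; rewrite /= borel_schur_val_sum /= -[RHS]/(1%:M : M).
rewrite (reindex_inj rev_ord_inj) /=.
rewrite [RHS](mx1_sum_delta K m.+1).
apply: eq_bigr => i _; rewrite /Umx subSS leqnn leq_subr subKn; last exact: leq_ord.
by rewrite inord_val.
Qed.

Lemma elementary_expand (a : A) : exists c : nat -> nat -> K,
  a = \sum_(s < m.+1) \sum_(t < m.+1) c s t *: U s t.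
Proof.
case: a => a Sa; exists (fun s t => (a : M) (inord (m - t)) (inord (m - s))).
apply: val_inj; rewrite /= borel_schur_val_sum; under eq_bigr do rewrite borel_schur_val_sum.
rewrite [LHS](matrix_sum_delta (a : M)) exchange_big /=.
rewrite (reindex_inj rev_ord_inj) /=; apply: eq_bigr => s _.
rewrite (reindex_inj rev_ord_inj) /=; apply: eq_bigr => t _.
have e (i : 'I_m.+1) : inord (m - i) = rev_ord i.
  by apply: val_inj; rewrite /= inordK ?subSS // ltnS leq_subr.
rewrite -[RHS]/(_ *: Umx s t) !e /Umx !e.
case: ifP => [//|/negbT]; rewrite (leq_ord t) andbT -ltnNge => lt_ts.
have /is_trig_mxP/(_ (rev_ord s) (rev_ord t)) := S_trig Sa.
by rewrite mxE /= => ->; rewrite ?scale0r ?scaler0 //; have := ltn_ord s; lia.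
Qed.

Theorem finite_type_degree1 : finite_type A.
Proof.
have [orth comp out one _ _] := elementary_graded_basis.
(* with p = m + 1 there is no room for a long arrow *)
apply: (@finite_type_graded K A m U _ (arrow m m.+1) 1 elementary_graded_basis).
- move=> P P1 Plin PM Pg.
  have P0 : P 0 by have := Plin (-1) 1 1 P1 P1; rewrite scaleN1r addNr.
  have PZ c a : P a -> P (c *: a) by move=> Pa; rewrite -[c *: a]addr0; apply: Plin.
  have PD a b : P a -> P b -> P (a + b) by move=> Pa Pb; rewrite -[a]scale1r; apply: Plin.
  have PFgen s t : (s <= m)%N -> (t <= m)%N -> (s == t) || arrow m m.+1 s t -> P (U s t).
    move=> les let_ Qst; have := Pg (inord s, inord t); rewrite /arrows /=.
    by rewrite -val_eqE /= !inordK // Qst.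
  have PF k s : (s + k <= m)%N -> P (U s (s + k)%N).
    elim: k => [|k IH] le; first by rewrite addn0 in le *; apply: PFgen; rewrite ?eqxx.
    have := comp s (s + k)%N (s + k.+1)%N.
    rewrite leq_addr leq_add2l leqnSn scale1r => /(_ isT) <-; apply: PM.
      by apply: PFgen => //; rewrite ?/arrow; lia.
    by apply: IH; lia.
  move=> a; have [c ->] := elementary_expand a.
  apply: (big_ind P) => // s _; apply: (big_ind P) => // t _; apply: PZ.
  have [le_st|lt] := leqP s t; last by rewrite out // negb_and -ltnNge lt.
  by have := PF (t - s)%N s; rewrite subnKC // => h; apply: h; rewrite -ltnS.
- by move=> s t /andP[le_t /orP[]/eqP e]; lia.
move=> d X [dout X1 XM] iX.
apply: (linear_std dout X1 _ (fun s => erefl) _ iX).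
  by move=> s t u le; rewrite XM // scale1r.
by move=> s t /andP[le_t /orP[]/eqP e]; [left|exfalso; lia].
Qed.

End DegreeOne.

(** * One-parameter families of modules *)
Section ModuleOfMatrices.
Variables (K : fieldType) (A : algType K) (n : nat) (R : A -> 'M[K]_n).
Hypothesis mR : mxmodule R.

(** The module of row vectors defined by R, the converse of taking coordinates. *)
Definition mxmod of mxmodule R : Type := 'rV[K]_n.
Local Notation V := (mxmod mR).

HB.instance Definition _ := GRing.Zmodule.on V.

Definition mxmod_scale (a : A) (v : V) : V := (v : 'rV[K]_n) *m R a.

Fact mxmod_scalerA a b v : mxmod_scale a (mxmod_scale b v) = mxmod_scale (a * b) v.
Proof. have [_ _ M] := mR; rewrite /mxmod_scale M mulmxA //. Qed.
Fact mxmod_scale1r : left_id 1 mxmod_scale.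
Proof. by have [_ R1 _] := mR; move=> v; rewrite /mxmod_scale R1 mulmx1. Qed.
Fact mxmod_scalerDr : right_distributive mxmod_scale +%R.
Proof. by move=> a u v; apply: mulmxDl. Qed.
Fact mxmod_scalerDl v : {morph mxmod_scale^~ v : a b / a + b}.
Proof.
have [L _ _] := mR; move=> a b; rewrite /mxmod_scale -[a]scale1r L !scale1r.
exact: mulmxDr.
Qed.

HB.instance Definition _ := GRing.Zmodule_isLmodule.Build A V
  mxmod_scalerA mxmod_scale1r mxmod_scalerDr mxmod_scalerDl.

Lemma mxmod_scaleE (a : A) (v : V) : a *: v = (v : 'rV[K]_n) *m R a.
Proof. by []. Qed.

Lemma mxmod_scalar (c : K) (v : V) : c%:A *: v = (c *: (v : 'rV[K]_n)) :> 'rV[K]_n.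
Proof.
have [L R1 _] := mR; rewrite mxmod_scaleE.
have R0 : R 0 = 0.
  have := L (-1) 0 0; rewrite scaler0 addr0 scaleN1r => ->.
  by rewrite addNr.
by rewrite -[c%:A]addr0 L R1 R0 addr0 -scalemxAr mulmx1.
Qed.

Lemma mxmod_findim : findim_module V.
Proof.
exists [seq (delta_mx 0 i : 'rV[K]_n) | i <- enum 'I_n] => v.
have sz : size [seq (delta_mx 0 i : 'rV[K]_n) | i <- enum 'I_n] = n.
  by rewrite size_map size_enum_ord.
exists (fun i => (v : 'rV[K]_n) 0 (cast_ord sz i)).
rewrite [LHS](row_sum_delta (v : 'rV[K]_n)) (reindex (cast_ord sz)) /=; last first.
  by exists (cast_ord (esym sz)) => i _; rewrite ?cast_ordK ?cast_ordKV.
apply: eq_bigr => i _; rewrite [RHS]mxmod_scalar.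
apply: (congr1 (fun w : 'rV[K]_n => (v : 'rV[K]_n) 0 (cast_ord sz i) *: w)).
rewrite (nth_map (cast_ord sz i)) ?size_enum_ord -?[X in (_ < X)%N]sz //.
by congr (delta_mx 0 _); apply: val_inj; rewrite /= nth_enum_ord // -[X in (_ < X)%N]sz.
Qed.

(** The projection along a decomposition, written as the matrix of the components
    of the unit vectors, is an idempotent commuting with R. *)
Lemma mxmod_indec : mxindec R -> indecomposable_module V.
Proof.
move=> [n_gt0 ind]; split.
  have {}n_gt0 : (0 < n)%N by case: (n) n_gt0.
  exists (delta_mx 0 (Ordinal n_gt0) : 'rV[K]_n); apply/eqP => e.
  have /matrixP/(_ 0 (Ordinal n_gt0)) : (delta_mx 0 (Ordinal n_gt0) : 'rV[K]_n) = 0 by [].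
  by rewrite !mxE !eqxx => /eqP; rewrite oner_eq0.
move=> U W [U0 Ulin] [W0 Wlin] [dec UW0].
have UZ a x : x \in U -> a *: x \in U.
  by move=> Ux; rewrite -[a *: x]addr0; apply: Ulin.
have WZ a x : x \in W -> a *: x \in W.
  by move=> Wx; rewrite -[a *: x]addr0; apply: Wlin.
have UD x y : x \in U -> y \in U -> x + y \in U.
  by move=> Ux Uy; rewrite -[x]scale1r; apply: Ulin.
have WD x y : x \in W -> y \in W -> x + y \in W.
  by move=> Wx Wy; rewrite -[x]scale1r; apply: Wlin.
have UN x : x \in U -> - x \in U by move=> Ux; rewrite -scaleN1r; apply: UZ.
have WN x : x \in W -> - x \in W by move=> Wx; rewrite -scaleN1r; apply: WZ.
have UK (c : K) (x : 'rV[K]_n) : (x : V) \in U -> (c *: x : V) \in U.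
  by move=> Ux; rewrite -(mxmod_scalar c x); apply: UZ.
have WK (c : K) (x : 'rV[K]_n) : (x : V) \in W -> (c *: x : V) \in W.
  by move=> Wx; rewrite -(mxmod_scalar c x); apply: WZ.
have /choice[pr prE] : forall i : 'I_n, exists u : 'rV[K]_n,
    ((u : V) \in U) /\ ((delta_mx 0 i - u : V) \in W).
  move=> i; have [u [w [Uu Ww e]]] := dec (delta_mx 0 i : 'rV[K]_n).
  exists u; split=> //; suff -> : (delta_mx 0 i - u : V) = w by [].
  by rewrite (e : (delta_mx 0 i : V) = u + w) addrC addKr.
pose P : 'M[K]_n := \matrix_i pr i.
have PU (v : 'rV[K]_n) : (v *m P : V) \in U.
  rewrite mulmx_sum_row; apply: (big_ind (fun x : V => x \in U)) => // i _.
  by rewrite rowK; apply: UK; case: (prE i).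
have PW (v : 'rV[K]_n) : (v - v *m P : V) \in W.
  have -> : v - v *m P = \sum_i v 0 i *: (delta_mx 0 i - pr i).
    rewrite mulmx_sum_row {1}[v]row_sum_delta -sumrB; apply: eq_bigr => i _.
    by rewrite rowK scalerBr.
  apply: (big_ind (fun x : V => x \in W)) => // i _.
  by apply: WK; case: (prE i).
have Pid (v : 'rV[K]_n) : (v : V) \in U -> v *m P = v.
  move=> Uv; apply/eqP; rewrite eq_sym -subr_eq0; apply/eqP.
  apply: UW0; last exact: PW.
  by apply: (UD v (- (v *m P))) => //; apply: UN; apply: PU.
have P0 (v : 'rV[K]_n) : (v : V) \in W -> v *m P = 0.
  move=> Wv; apply: UW0; first exact: PU.
  have -> : v *m P = v - (v - v *m P) by rewrite opprB addrC subrK.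
  by apply: (WD v (- (v - v *m P))) => //; apply: WN; apply: PW.
have PP : P *m P = P.
  by apply/row_matrixP => i; rewrite row_mul Pid // rowE PU.
have PR a : P *m R a = R a *m P.
  apply/row_matrixP => i; rewrite !rowE !mulmxA.
  set v := delta_mx 0 i.
  have -> : v *m R a *m P = (v *m P *m R a) *m P + ((v - v *m P) *m R a) *m P.
    by rewrite -mulmxDl -mulmxDl addrC subrK.
  have Uv : ((v *m P) *m R a : V) \in U by apply: (UZ a (v *m P : V)); apply: PU.
  have Wv : ((v - v *m P) *m R a : V) \in W by apply: (WZ a (v - v *m P : V)); apply: PW.
  by rewrite (Pid _ Uv) (P0 _ Wv) addr0.
case: (ind P PP PR) => PE; [left|right] => x xin.
  by rewrite -[x](Pid x) // PE mulmx0.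
by have := P0 _ xin; rewrite PE mulmx1.
Qed.

End ModuleOfMatrices.

Lemma mxmod_iso (K : fieldType) (A : algType K) (n : nat) (R R' : A -> 'M[K]_n)
    (mR : mxmodule R) (mR' : mxmodule R') (N : lmodType A) :
  isomorphic_modules (mxmod mR) N -> isomorphic_modules (mxmod mR') N ->
  exists T S : 'M[K]_n, [/\ T *m S = 1%:M, S *m T = 1%:M
    & forall a, R a *m T = T *m R' a].
Proof.
move=> [f [g fK gK]] [f' [g' fK' gK']].
pose h (v : 'rV[K]_n) : 'rV[K]_n := g' (f v).
pose h' (v : 'rV[K]_n) : 'rV[K]_n := g (f' v).
have g'D x y : g' (x + y) = g' x + g' y.
  by apply: (can_inj fK'); rewrite linearD !gK'.
have g'Z a x : g' (a *: x) = a *: g' x.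
  by apply: (can_inj fK'); rewrite linearZ !gK'.
have gD x y : g (x + y) = g x + g y.
  by apply: (can_inj fK); rewrite linearD !gK.
have gZ a x : g (a *: x) = a *: g x.
  by apply: (can_inj fK); rewrite linearZ !gK.
have hR a v : h (v *m R a) = h v *m R' a.
  by rewrite /h -[v *m R a](mxmod_scaleE a (v : mxmod mR)) linearZ g'Z.
have hl : linear h.
  move=> c u v; rewrite /h -(mxmod_scalar c (u : mxmod mR)) -(mxmod_scalar c (g' (f u) : mxmod mR')).
  by rewrite (linearD f (c%:A *: (u : mxmod mR)) v) linearZ g'D g'Z.
have h'l : linear h'.
  move=> c u v; rewrite /h' -(mxmod_scalar c (u : mxmod mR')) -(mxmod_scalar c (g (f' u) : mxmod mR)).
  by rewrite (linearD f' (c%:A *: (u : mxmod mR')) v) linearZ gD gZ.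
pose hL : {linear 'rV[K]_n -> 'rV[K]_n} := HB.pack h (GRing.isLinear.Build K _ _ _ h hl).
pose h'L : {linear 'rV[K]_n -> 'rV[K]_n} := HB.pack h' (GRing.isLinear.Build K _ _ _ h' h'l).
have TE v : v *m lin1_mx hL = h v by rewrite mul_rV_lin1.
have SE v : v *m lin1_mx h'L = h' v by rewrite mul_rV_lin1.
exists (lin1_mx hL), (lin1_mx h'L); split.
- apply/row_matrixP => i; rewrite !rowE mulmxA TE SE /h /h' gK' fK.
  by rewrite mulmx1.
- apply/row_matrixP => i; rewrite !rowE mulmxA TE SE /h /h' gK fK'.
  by rewrite mulmx1.
by move=> a; apply/row_matrixP => i; rewrite !rowE !mulmxA !TE hR.
Qed.

(** Pigeonhole: k + 1 different parameters cannot have their modules among k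
    isomorphism classes. *)
Theorem infinite_type_family (K : fieldType) (A : algType K) (n : nat)
    (R : K -> A -> 'M[K]_n) :
  infinite_set [set: K]%classic ->
  (forall lam, mxmodule (R lam)) -> (forall lam, mxindec (R lam)) ->
  (forall lam mu (T S : 'M[K]_n), T *m S = 1%:M ->
     (forall a, R lam a *m T = T *m R mu a) -> lam = mu) ->
  ~ finite_type A.
Proof.
move=> infK mR iR inj [k [N hN]].
have [t [st ut _]] := infinite_uniq infK [::] k.+1.
have /choice[c cE] : forall i : 'I_k.+1, exists j : 'I_k,
    isomorphic_modules (mxmod (mR t`_i)) (N j).
  by move=> i; apply: hN; [apply: mxmod_findim|apply/mxmod_indec/iR].
have injc : injective c.
  move=> i j e; have hi := cE i; have := cE j; rewrite -e => hj.
  have [T [S [TS _ RT]]] := mxmod_iso hi hj.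
  have /eqP := inj _ _ _ _ TS RT; rewrite nth_uniq ?st // => /eqP.
  exact: val_inj.
by have := leq_card c injc; rewrite !card_ord ltnn.
Qed.

Section Blocks.
Variables (K : fieldType) (r : nat).
Hypothesis infK : infinite_set [set: K]%classic.
Local Notation R := r.+1.
Local Notation A := (borel_schur K 2 R).
Local Notation F := (F r infK).

Lemma coef_sum (J : Type) (l : seq J) (f : J -> A) s t :
  coef (\sum_(j <- l) f j) s t = \sum_(j <- l) coef (f j) s t.
Proof.
have c0 : coef (0 : A) s t = 0 by rewrite /coef /= mxE.
elim: l => [|j l IH]; first by rewrite !big_nil c0.
by rewrite !big_cons -[f j]scale1r coef_lin IH mul1r scale1r.
Qed.

Lemma coefZ c (a : A) s t : coef (c *: a) s t = c * coef a s t.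
Proof.
have c0 : coef (0 : A) s t = 0 by rewrite /coef /= mxE.
by rewrite -[c *: a]addr0 coef_lin c0 addr0.
Qed.

Lemma coef_out (a : A) s t : (s <= R)%N -> (t < s)%N -> coef a s t = 0.
Proof.
move=> le_s lt_ts; have le_t : (t <= R)%N by lia.
rewrite (coef_expand infK a) coef_sum big1 // => s' _.
rewrite coef_sum big1 // => t' _; rewrite coefZ.
have [le|lt] := leqP s' t'; last first.
  have -> : F s' t' = 0.
    by apply: val_inj; rewrite /= Fmx_out // negb_and -ltnNge lt.
  by rewrite /coef /= mxE mulr0.
rewrite coefF //; case: andP => [[/eqP e1 /eqP e2]|_]; last by rewrite mulr0.
by move: lt_ts; rewrite e1 e2 ltnNge le.
Qed.

(** The idempotents cut a down to a single term of its expansion. *)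
Lemma coef_corner (a : A) s t : (s <= R)%N -> (t <= R)%N ->
  F t t * a * F s s = coef a s t *: F s t.
Proof.
move=> le_s le_t; have [orth comp out _ ul ur] := F_graded_basis r infK.
have lts : (s < R.+1)%N by []. have ltt : (t < R.+1)%N by [].
rewrite {1}(coef_expand infK a) mulr_sumr mulr_suml (bigD1 (Ordinal lts)) //=.
rewrite [X in _ + X]big1 ?addr0 => [|s' ne]; last first.
  rewrite mulr_sumr mulr_suml big1 // => t' _.
  by rewrite -mulrA -scalerAl orth ?scaler0 ?mulr0 //; rewrite -val_eqE eq_sym in ne.
rewrite mulr_sumr mulr_suml (bigD1 (Ordinal ltt)) //= [X in _ + X]big1 ?addr0 => [|t' ne].
  have [le|lt] := leqP s t; last by rewrite (out s t) ?scaler0 ?mulr0 ?mul0r // negb_and -ltnNge lt.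
  by rewrite -scalerAr -scalerAl comp ?le ?leqnn // ur scale1r comp ?le ?leqnn // ul scale1r.
by rewrite -scalerAr orth ?scaler0 ?mul0r //; rewrite -val_eqE in ne.
Qed.

Lemma coef_mul (a b : A) s u : (s <= u <= R)%N ->
  coef (a * b) s u =
    \sum_(t < R.+1 | (s <= t <= u)%N) 'C(u - s, t - s)%:R * (coef b s t * coef a t u).
Proof.
case/andP=> le_su le_uR; have le_sR := leq_trans le_su le_uR.
have [_ comp out one _ _] := F_graded_basis r infK.
suff /(congr1 (fun z : A => coef z s u)) : coef (a * b) s u *: F s u =
    (\sum_(t < R.+1 | (s <= t <= u)%N)
       'C(u - s, t - s)%:R * (coef b s t * coef a t u)) *: F s u.
  by rewrite !coefZ coefF // !eqxx !mulr1.
have -> : a * b = \sum_(t < R.+1) a * F t t * b.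
  by rewrite -mulr_suml -mulr_sumr one mulr1.
rewrite -coef_corner // mulr_sumr mulr_suml.
rewrite scaler_suml [RHS]big_mkcond /=; apply: eq_bigr => t _.
have -> : F u u * (a * F t t * b) * F s s = (F u u * a * F t t) * (F t t * b * F s s).
  have ee : F t t * F t t = F t t by rewrite comp ?leqnn // subnn bin0 scale1r.
  by rewrite -{1}ee !mulrA.
have le_tR : (t <= R)%N by rewrite -ltnS.
rewrite !coef_corner // -scalerAl -scalerAr scalerA.
case: ifP => [le|/negbT h].
  by rewrite comp // scalerA mulrC [coef a _ _ * _]mulrC.
have [lt|lt] : (t < s)%N \/ (u < t)%N by lia.
  by rewrite (out s t) ?mulr0 ?scaler0 // negb_and -ltnNge lt.
by rewrite (out t u) ?mul0r ?scaler0 // negb_and -ltnNge lt.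
Qed.

Lemma coef1 s t : (s <= R)%N -> (t <= R)%N -> coef (1 : A) s t = (s == t)%:R.
Proof.
move=> le_s le_t; have [_ _ _ one _ _] := F_graded_basis r infK.
rewrite -one coef_sum; have lt_s : (s < R.+1)%N by [].
rewrite (bigD1 (Ordinal lt_s)) //= big1 ?addr0.
  by rewrite coefF // eqxx andTb eq_sym.
move=> s' ne; rewrite coefF //; case: eqP => // e.
by case/negP: ne; apply/eqP/val_inj.
Qed.

Variables (m : nat) (D w : nat -> nat).
Hypothesis w_le : forall g : 'I_m, (w g <= R)%N.

(** The block g lives in weight w g, and F s t acts from the blocks of weight s
    to those of weight t by the maps Y. *)
Definition blocks (Y : forall g h, 'M[K]_(D g, D h)) (a : A) :
    'M[K]_(\sum_(g < m) D g) :=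
  \mxblock_(g < m, h < m) (coef a (w g) (w h) *: Y g h).

(** The conditions on Y for blocks to be a module; for b equal to w g or w h the
    composition rule holds automatically, by the first two conditions. *)
Record weighted (Y : forall g h, 'M[K]_(D g, D h)) : Prop := Weighted {
  wt_id : forall g : 'I_m, Y g g = 1%:M;
  wt_zero : forall g h : 'I_m, g != h -> (w h <= w g)%N -> Y g h = 0;
  wt_comp : forall (g h : 'I_m) b, (w g < b < w h)%N ->
    \sum_(k < m | w k == b) Y g k *m Y k h = 'C(w h - w g, b - w g)%:R *: Y g h }.

Lemma wt_full Y : weighted Y -> forall (g h : 'I_m) b, (w g <= b <= w h)%N ->
  \sum_(k < m | w k == b) Y g k *m Y k h = 'C(w h - w g, b - w g)%:R *: Y g h.
Proof.
move=> [Y1 Y0 Yc] g h b /andP[le1 le2].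
have [lt1|ge1] := ltnP (w g) b; last first.
  have eb : b = w g by apply/eqP; rewrite eqn_leq ge1 le1.
  rewrite (bigD1 g) ?eb //= big1 ?addr0; last first.
    move=> k /andP[/eqP ek ne]; rewrite (Y0 g k) ?mul0mx ?ek //.
    by rewrite eq_sym.
  by rewrite Y1 mul1mx subnn bin0 scale1r.
have [lt2|ge2] := ltnP b (w h); first by apply: Yc; rewrite lt1.
have eb : b = w h by apply/eqP; rewrite eqn_leq ge2 le2.
rewrite (bigD1 h) ?eb //= big1 ?addr0; last first.
  by move=> k /andP[/eqP ek ne]; rewrite (Y0 k h) ?mulmx0 ?ek.
by rewrite Y1 mulmx1 binn scale1r.
Qed.

Lemma blocks_mxmodule Y : weighted Y -> mxmodule (blocks Y).
Proof.
move=> wY; have [Y1 Y0 _] := wY; split.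
- move=> c a b; apply/matrixP => i j.
  by rewrite !mxE coef_lin mulrDl mulrA.
- rewrite -mxdiagZ; apply: eq_mxblock => g h.
  rewrite coef1 //; have [<-|ne] := eqVneq g h.
    by rewrite eqxx scale1r Y1 conform_mx_id.
  case: eqP => [e|_]; last by rewrite scale0r.
  by rewrite Y0 ?e ?scaler0.
move=> a b; rewrite mul_mxblock; apply: eq_mxblock => g h.
under [RHS]eq_bigr do rewrite -scalemxAl -scalemxAr scalerA.
have [le|lt] := leqP (w g) (w h); last first.
  rewrite coef_out // scale0r big1 // => k _.
  have [lt1|ge1] := ltnP (w k) (w g); first by rewrite coef_out // mul0r scale0r.
  by rewrite [X in _ * X]coef_out ?mulr0 ?scale0r //; lia.
rewrite coef_mul ?le ?w_le //.
rewrite (bigID (fun k : 'I_m => (w g <= w k <= w h)%N)) /= [X in _ + X]big1 ?addr0; last first.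
  move=> k h1; have [h2|h2] : (w k < w g)%N \/ (w h < w k)%N by lia.
    by rewrite coef_out // mul0r scale0r.
  by rewrite [X in _ * X]coef_out ?mulr0 ?scale0r.
rewrite scaler_suml.
rewrite (partition_big (fun k : 'I_m => inord (w k) : 'I_R.+1)
   (fun t => (w g <= val t <= w h)%N)) /=; last first.
  by move=> k; rewrite inordK // ltnS.
apply: eq_bigr => t le_t; rewrite (mulrC 'C(_, _)%:R) -scalerA.
rewrite -(wt_full wY) // scaler_sumr.
apply: eq_big => [k|k /eqP <- //].
rewrite -val_eqE /= inordK ?ltnS //; case: eqP => [->|]; rewrite ?andbF //.
by rewrite le_t.
Qed.

Section Intertwiner.
Variables (Y Y' : forall g h, 'M[K]_(D g, D h)).
Hypotheses (wY : weighted Y) (wY' : weighted Y').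
Variable T : 'M[K]_(\sum_(g < m) D g).
Hypothesis TY : forall a, blocks Y a *m T = T *m blocks Y' a.
Local Notation "T [ g , h ]" := (submxblock T g h) (at level 2, format "T [ g ,  h ]").

Lemma intertwiner_block s t (g h : 'I_m) : (s <= t)%N ->
  \sum_(k < m) ((w g == s) && (w k == t))%:R *: (Y g k *m T[k, h]) =
  \sum_(k < m) ((w k == s) && (w h == t))%:R *: (T[g, k] *m Y' k h).
Proof.
move=> le_st; have := TY (F s t).
rewrite -[T]submxblockK !mul_mxblock => /eq_mxblockP/(_ g h).
under eq_bigr do rewrite -scalemxAl coefF //.
under [in RHS]eq_bigr do rewrite -scalemxAr coefF //.
by rewrite submxblockK.
Qed.

Lemma intertwiner_weight (g h : 'I_m) : w g != w h -> T[g, h] = 0.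
Proof.
move=> ne; have := intertwiner_block g h (leqnn (w g)).
rewrite [RHS]big1; last by move=> k _; rewrite (eq_sym (w h)) (negPf ne) andbF scale0r.
rewrite (bigD1 g) //= big1 ?addr0; last first.
  move=> k nk; case: (w k =P w g) => [e|_]; last by rewrite andbF scale0r.
  by rewrite (wt_zero wY) ?e ?mul0mx ?scaler0 // eq_sym.
by rewrite eqxx scale1r (wt_id wY) mul1mx.
Qed.

(** Off-diagonal blocks between blocks of the same weight disappear from the
    equation for (g, h) when no other block of these weights is linked to h
    or g. *)
Lemma intertwiner_diag (g h : 'I_m) : (w g <= w h)%N ->
  (forall k : 'I_m, k != h -> w k = w h -> Y g k = 0) ->
  (forall k : 'I_m, k != g -> w k = w g -> Y' k h = 0) ->
  Y g h *m T[h, h] = T[g, g] *m Y' g h.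
Proof.
move=> le Yg Yh; have := intertwiner_block g h le.
rewrite (bigD1 h) //= [X in _ + X]big1 ?addr0; last first.
  move=> k nk; case: (w k =P w h) => [e|_]; last by rewrite andbF scale0r.
  by rewrite Yg // mul0mx scaler0.
rewrite (bigD1 g) //= [X in _ = _ + X]big1 ?addr0; last first.
  move=> k nk; case: (w k =P w g) => [e|_]; last by rewrite scale0r.
  by rewrite Yh // mulmx0 scaler0.
by rewrite !eqxx !scale1r.
Qed.

End Intertwiner.

Lemma submxblock_mul (S T : 'M[K]_(\sum_(g < m) D g)) (g h : 'I_m) :
  submxblock (S *m T) g h = \sum_k submxblock S g k *m submxblock T k h.
Proof. by rewrite -{1}[S]submxblockK -{1}[T]submxblockK mul_mxblock mxblockK. Qed.

(** A homomorphism T has blocks only between equal weights, and its diagonal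
    blocks satisfy the equations of the links Ar; so they are all the same
    scalar c.  For an idempotent c is 0 or 1; subtracting it leaves an
    idempotent with zero diagonal blocks, which is nilpotent, hence zero,
    because no weight carries more than two blocks.  The block g0, alone in
    its weight, detects c. *)
Theorem blocks_infinite_type (Y : K -> forall g h, 'M[K]_(D g, D h)) (g0 : 'I_m)
    (Ar : rel 'I_m) :
  (forall lam, weighted (Y lam)) ->
  D g0 <> 0%N -> (forall h : 'I_m, w h = w g0 -> h = g0) ->
  (forall g h k : 'I_m, w g = w h -> w g = w k -> [|| g == h, h == k | g == k]) ->
  (forall g h : 'I_m, Ar g h -> [/\ (w g <= w h)%N,
     forall lam (k : 'I_m), k != h -> w k = w h -> Y lam g k = 0
   & forall lam (k : 'I_m), k != g -> w k = w g -> Y lam k h = 0]) ->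
  (forall lam mu (T : forall g : 'I_m, 'M[K]_(D g)),
     (forall g h : 'I_m, Ar g h -> Y lam g h *m T h = T g *m Y mu g h) ->
     exists c, (forall g, T g = c%:M) /\ (c != 0 -> lam = mu)) ->
  ~ finite_type A.
Proof.
move=> wY Dg0 g0_uniq two ArP endY.
have D0 : (0 < D g0)%N by case: (D g0) Dg0.
have diag lam mu T : (forall a, blocks (Y lam) a *m T = T *m blocks (Y mu) a) ->
    exists c, (forall g : 'I_m, submxblock T g g = c%:M) /\ (c != 0 -> lam = mu).
  move=> TY; apply: endY => g h /ArP[le h1 h2].
  by apply: (intertwiner_diag TY le) => // k; [apply: h1|apply: h2].
have nil lam P : P *m P = P -> (forall a, P *m blocks (Y lam) a = blocks (Y lam) a *m P) ->
    (forall g : 'I_m, submxblock P g g = 0) -> P = 0.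
  move=> PP cP P0.
  have PY a : blocks (Y lam) a *m P = P *m blocks (Y lam) a by rewrite cP.
  rewrite -[P]submxblockK -[RHS]submxblockK; apply: eq_mxblock => g h.
  rewrite submxblock0 -PP submxblock_mul big1 // => k _.
  have [egk|ngk] := eqVneq (w g) (w k); last first.
    by rewrite (intertwiner_weight (wY lam) PY) ?mul0mx.
  have [ekh|nkh] := eqVneq (w k) (w h); last first.
    by rewrite [X in _ *m X](intertwiner_weight (wY lam) PY) ?mulmx0.
  have [<-|ngk] := eqVneq g k; first by rewrite P0 mul0mx.
  have [->|nkh] := eqVneq k h; first by rewrite P0 mulmx0.
  have [egh|ngh] := eqVneq g h; last first.
    have egh : w g = w h by rewrite egk.
    by have := two _ _ _ egh egk; rewrite (eq_sym h) (negPf ngk) (negPf ngh) (negPf nkh).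
  have := congr1 (fun Z => submxblock Z g g) PP; rewrite /= P0 submxblock_mul.
  rewrite (bigD1 k) //= big1 ?addr0 => [e0|]; first by rewrite -egh e0.
  move=> l nl; have [egl|ngl] := eqVneq (w g) (w l); last first.
    by rewrite (intertwiner_weight (wY lam) PY) ?mul0mx.
  have := two _ _ _ egk egl; rewrite (negPf ngk) (eq_sym k) (negPf nl) /=.
  by move/eqP->; rewrite P0 mul0mx.
apply: (infinite_type_family (R := fun lam => blocks (Y lam)) infK).
- by move=> lam; apply: blocks_mxmodule.
- move=> lam; split.
    apply/eqP; rewrite -lt0n (bigD1 g0) //= ; apply: leq_trans (leq_addr _ _).
    exact: D0.
  move=> P PP cP.
  have PY a : blocks (Y lam) a *m P = P *m blocks (Y lam) a by rewrite cP.
  have [c [Pc _]] := diag _ _ _ PY.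
  have cc : c * c = c.
    have := congr1 (fun Z => submxblock Z g0 g0) PP; rewrite /= submxblock_mul.
    rewrite (bigD1 g0) //= big1 ?addr0 => [|k nk]; last first.
      rewrite (intertwiner_weight (wY lam) PY) ?mul0mx //.
      by apply: contraNneq nk => e; apply/eqP/g0_uniq.
    rewrite Pc -scalar_mxM => /matrixP/(_ (Ordinal D0) (Ordinal D0)).
    by rewrite !mxE eqxx.
  have [c0|nc] := eqVneq c 0; first by left; apply: (nil lam) => // g; rewrite Pc c0 raddf0.
  have c1 : c = 1 by apply: (mulfI nc); rewrite cc mulr1.
  right; apply/eqP; rewrite eq_sym -subr_eq0; apply/eqP; apply: (nil lam).
  - by rewrite mulmxBl mul1mx mulmxBr mulmx1 PP subrr subr0.
  - by move=> a; rewrite mulmxBl mulmxBr mul1mx mulmx1 cP.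
  move=> g; rewrite submxblockB Pc c1.
  have -> : submxblock (1%:M : 'M[K]_(\sum_(g < m) D g)) g g = 1%:M.
    by rewrite -mxdiagZ mxblockK eqxx conform_mx_id.
  by rewrite subrr.
move=> lam mu T S TS TY.
have [c [Tc]] := diag _ _ _ TY; apply.
apply/eqP => c0; have := congr1 (fun Z => submxblock Z g0 g0) TS.
rewrite /= submxblock_mul big1 => [|k _].
  rewrite -mxdiagZ mxblockK eqxx conform_mx_id => /matrixP/(_ (Ordinal D0) (Ordinal D0)).
  by rewrite !mxE eqxx => /eqP; rewrite eq_sym oner_eq0.
have [->|nk] := eqVneq k g0; first by rewrite Tc c0 raddf0 mul0mx.
rewrite (intertwiner_weight (wY lam) TY) ?mul0mx //.
by apply: contraNneq nk => e; apply/eqP/g0_uniq.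
Qed.

End Blocks.

(** * Families for two letters *)
(** The entries of the maps Y of a family, as data: the conditions on Y become
    identities between small integers, checked by evaluation. *)
Inductive table_symbol := Zero | One | Opp | Lam | OppLam.

(** The symbol x stands for a + b lam with (a, b) its code. *)
Definition code_int (x : table_symbol) : int * int :=
  match x with
  | Zero => (0, 0) | One => (1, 0) | Opp => (-1, 0) | Lam => (0, 1) | OppLam => (0, -1)
  end.

(** Indexing by natural numbers lets sums over small matrices unfold. *)
Definition nat_entry (K : fieldType) n (T : 'M[K]_n) (i j : nat) : K :=
  if (insub i, insub j) is (Some i', Some j') then T i' j' else 0.
Arguments nat_entry : simpl never.

Lemma nat_entryE (K : fieldType) n (T : 'M[K]_n) (i j : 'I_n) : nat_entry T i j = T i j.
Proof. by rewrite /nat_entry !valK. Qed.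

Lemma nat_entry_scalar (K : fieldType) n (T : 'M[K]_n) (c : K) :
  (forall i j, (i < n)%N -> (j < n)%N -> nat_entry T i j = c *+ (i == j)) ->
  T = c%:M.
Proof. by move=> h; apply/matrixP => i j; rewrite -nat_entryE h // mxE. Qed.

Lemma sum_iota (V : nmodType) n (F : nat -> V) :
  \sum_(l <- iota 0 n) F l = \sum_(l < n) F l.
Proof. by rewrite -(big_mkord predT) /index_iota subn0. Qed.

(** The map from block g to block h is the matrix (y g h).2 divided by the
    integer (y g h).1, which divides N; identities between the maps are
    verified modulo M, where M = 0 in K, after multiplication by N^2. *)
Section Tables.
Variables (K : fieldType) (M N m : nat) (D w : nat -> nat).
Variable y : nat -> nat -> nat * seq (seq table_symbol).
Hypotheses (M0 : M%:R = 0 :> K) (N_neq0 : N%:R != 0 :> K).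

Definition code_eval (lam : K) (x : table_symbol) : K :=
  match x with
  | Zero => 0 | One => 1 | Opp => -1 | Lam => lam | OppLam => - lam
  end.

Definition den g h := if g == h then 1%N else (y g h).1.

Definition code g h i j : table_symbol :=
  if g == h then (if i == j then One else Zero)
  else nth Zero (nth [::] (y g h).2 i) j.

Definition table lam g h : 'M[K]_(D g, D h) :=
  \matrix_(i, j) (code_eval lam (code g h i j) / (den g h)%:R).

Definition zsum (s : seq int) : int := foldr +%R 0 s.

Definition codef (f : int * int -> int * int -> int) g h (ks : seq nat) i j : int :=
  zsum [seq (N %/ den g k)%:Z * (N %/ den k h)%:Z *
     zsum [seq f (code_int (code g k i l)) (code_int (code k h l j)) | l <- iota 0 (D k)]
    | k <- ks].

(** Compares the composite maps from g to h through the blocks ks with c times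
    the map from g to h, separately for the coefficients of 1, lam and
    lam^2. *)
Definition check (c : nat) g h (ks : seq nat) : bool :=
  all (fun i => all (fun j =>
    let z := code_int (code g h i j) in
    let n := (c * N * (N %/ den g h))%N%:Z in
    [&& (M %| codef (fun a b => a.1 * b.1) g h ks i j - n * z.1)%Z,
        (M %| codef (fun a b => a.1 * b.2 + a.2 * b.1) g h ks i j - n * z.2)%Z
      & (M %| codef (fun a b => a.2 * b.2) g h ks i j)%Z])
    (iota 0 (D h))) (iota 0 (D g)).

Hypothesis den_dvd : forall g h, (g < m)%N -> (h < m)%N -> (den g h %| N)%N.

Lemma code_evalE lam x :
  code_eval lam x = (code_int x).1%:~R + (code_int x).2%:~R * lam.
Proof. by case: x => /=; ring. Qed.

Lemma dvdz_intr (z : int) : (M %| z)%Z -> z%:~R = 0 :> K.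
Proof. by case/dvdzP => q ->; rewrite intrM -[M%:~R]/(M%:R) M0 mulr0. Qed.

Lemma zsumE (J : Type) (s : seq J) (f : J -> int) :
  (zsum [seq f k | k <- s])%:~R = \sum_(k <- s) (f k)%:~R :> K.
Proof.
rewrite /zsum foldrE big_map.
exact: (big_morph (fun z : int => z%:~R : K) (intrD K)).
Qed.

Lemma den_neq0 g h : (g < m)%N -> (h < m)%N -> (den g h)%:R != 0 :> K.
Proof.
move=> lg lh; apply: contraNneq N_neq0 => e.
by rewrite -(divnK (den_dvd lg lh)) natrM e mulr0.
Qed.

Lemma div_den g h : (g < m)%N -> (h < m)%N ->
  (den g h)%:R^-1 = (N %/ den g h)%:R / N%:R :> K.
Proof.
move=> lg lh; have nz := den_neq0 lg lh.
apply: (mulIf N_neq0); rewrite divfK //.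
by rewrite -{1}(divnK (den_dvd lg lh)) natrM mulrCA mulVf ?mulr1.
Qed.

Lemma table_comp lam c (g h b : nat) : (g < m)%N -> (h < m)%N ->
  check c g h [seq k <- iota 0 m | w k == b] ->
  \sum_(k < m | w k == b) table lam g k *m table lam k h = c%:R *: table lam g h.
Proof.
move=> lg lh ch; apply/matrixP => i j.
have {ch} := allP (allP ch i _) j _; rewrite !mem_iota !ltn_ord => /(_ isT isT).
set z := code_int _; set n := (_ * _)%N; move=> /= /and3P[].
set ks := [seq _ <- _ | _].
set Q1 := codef _ _ _ _ _ _; set Q2 := codef _ _ _ _ _ _; set Q3 := codef _ _ _ _ _ _.
move=> /dvdz_intr; rewrite intrB => /eqP; rewrite subr_eq0 intrM => /eqP e1.
move=> /dvdz_intr; rewrite intrB => /eqP; rewrite subr_eq0 intrM => /eqP e2.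
move=> /dvdz_intr e3.
rewrite summxE; transitivity ((Q1%:~R + Q2%:~R * lam + Q3%:~R * lam ^+ 2) / N%:R ^+ 2 : K).
  rewrite -(big_mkord (fun k => w k == b) (fun k => (table lam g k *m table lam k h) i j)).
  rewrite /index_iota subn0 -big_filter -/ks.
  rewrite /Q1 /Q2 /Q3 /codef !zsumE !mulr_suml -!big_split /= mulr_suml.
  rewrite !big_seq; apply: eq_bigr => k; rewrite mem_filter mem_iota => /andP[_ /= lk].
  have -> : (table lam g k *m table lam k h) i j =
      \sum_(l <- iota 0 (D k)) code_eval lam (code g k i l) / (den g k)%:R
        * (code_eval lam (code k h l j) / (den k h)%:R).
    rewrite mxE sum_iota; by apply: eq_bigr => l _; rewrite !mxE.
  rewrite !intrM !zsumE !mulr_sumr !mulr_suml -!big_split mulr_suml /=.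
  apply: eq_bigr => l _; rewrite !div_den // !code_evalE.
  rewrite !(intrM, intrD) -!pmulrn; field.
  exact: N_neq0.
rewrite e1 e2 e3 !mxE div_den // code_evalE -/z /n.
rewrite -!pmulrn !natrM; field.
exact: N_neq0.
Qed.

(** The intertwining equation for a map with denominator 1, entry by entry. *)
Lemma table_entry lam mu (g h : nat) (S : 'M[K]_(D g)) (T : 'M[K]_(D h)) :
  table lam g h *m T = S *m table mu g h -> den g h = 1%N ->
  forall i j, (i < D g)%N -> (j < D h)%N ->
  foldr +%R 0 [seq code_eval lam (code g h i l) * nat_entry T l j | l <- iota 0 (D h)]
  = foldr +%R 0 [seq nat_entry S i l * code_eval mu (code g h l j) | l <- iota 0 (D g)].
Proof.
move=> E d1 i j li lj; move/matrixP/(_ (Ordinal li) (Ordinal lj)): E; rewrite !mxE.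
rewrite !foldrE !big_map !sum_iota.
move=> e; transitivity (\sum_l table lam g h (Ordinal li) l * T l (Ordinal lj)).
  by apply: eq_bigr => l _; rewrite !mxE d1 divr1 (nat_entryE T l (Ordinal lj)).
by rewrite e; apply: eq_bigr => l _; rewrite !mxE d1 divr1 (nat_entryE S (Ordinal li) l).
Qed.

Lemma table_nil lam g h : g != h -> nilp (y g h).2 -> table lam g h = 0.
Proof.
move=> ne /nilP e; apply/matrixP => i j.
by rewrite !mxE /code (negPf ne) e nth_nil nth_nil mul0r.
Qed.

Lemma table_diag lam g : table lam g g = 1%:M.
Proof.
apply/matrixP => i j; rewrite !mxE /code /den eqxx divr1 -val_eqE.
by case: (val i == val j).
Qed.

End Tables.

Definition check_table M N m D w y B : bool :=
  all (fun g => all (fun h =>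
    [&& den y g h %| N, (g != h) && (w h <= w g) ==> nilp (y g h).2, (w h <= B)
      & all (fun b => (w g < b < w h) ==>
          check M N D y 'C(w h - w g, b - w g) g h [seq k <- iota 0 m | w k == b])
        (iota 0 B)]%N) (iota 0 m)) (iota 0 m).

Lemma check_table_weighted (K : fieldType) M N m D w y B (lam : K) :
  M%:R = 0 :> K -> N%:R != 0 :> K -> check_table M N m D w y B ->
  @weighted K m D w (table D y lam).
Proof.
move=> M0 Nn ch.
have im (g : 'I_m) : val g \in iota 0 m by rewrite mem_iota /=.
have chP (g h : 'I_m) := allP (allP ch g (im g)) h (im h).
split=> [g|g h ne le|g h b lt].
- exact: table_diag.
- apply: table_nil => //; have /and4P[_] := chP g h.
  by rewrite -val_eqE in ne; rewrite ne le.
have /and4P[_ _ lB /allP/(_ b)] := chP g h; rewrite mem_iota lt /= => c.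
apply: (table_comp (M := M) (N := N)) => //.
- by move=> i j li lj; have /and4P[] := chP (Ordinal li) (Ordinal lj).
by apply: c; case/andP: lt => _ lt; apply: leq_trans lt lB.
Qed.

(** The combinatorial hypotheses of [blocks_infinite_type]; only the order of the
    weights matters for them. *)
Definition check_shape m (D w : nat -> nat)
    (y : nat -> nat -> nat * seq (seq table_symbol)) g0 (Ar : seq (nat * nat)) : bool :=
  let I := iota 0 m in
  [&& (g0 < m)%N, D g0 != 0%N, all (fun h => (w h == w g0) ==> (h == g0)) I,
      all (fun g => all (fun h => all (fun k => (w g == w h) && (w g == w k) ==>
        [|| g == h, h == k | g == k]) I) I) I
    & all (fun a => [&& (a.1 < m)%N, (a.2 < m)%N, a.1 != a.2, (w a.1 <= w a.2)%N,
        (y a.1 a.2).1 == 1%N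
      & all (fun k =>
          ((k != a.2) && (w k == w a.2) ==> (a.1 != k) && nilp (y a.1 k).2) &&
          ((k != a.1) && (w k == w a.1) ==> (k != a.2) && nilp (y k a.2).2)) I]) Ar].

(** The weights w may be replaced by order-equivalent ones w' in the shape
    conditions, which makes them computable when w contains variables. *)
Theorem table_infinite_type (K : fieldType) r (infK : infinite_set [set: K]%classic)
    m (D w w' : nat -> nat) (y : nat -> nat -> nat * seq (seq table_symbol))
    (g0 : nat) (Ar : seq (nat * nat)) :
  (forall g, (g < m)%N -> (w g <= r.+1)%N) ->
  (forall g h, (g < m)%N -> (h < m)%N -> (w g <= w h)%N = (w' g <= w' h)%N) ->
  (forall lam : K, @weighted K m D w (table D y lam)) ->
  check_shape m D w' y g0 Ar ->
  (forall (lam mu : K) (t : nat -> nat -> nat -> K),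
     (forall g h, (g, h) \in Ar -> forall i j, (i < D g)%N -> (j < D h)%N ->
       foldr +%R 0 [seq code_eval lam (code y g h i l) * t h l j | l <- iota 0 (D h)]
       = foldr +%R 0 [seq t g i l * code_eval mu (code y g h l j) | l <- iota 0 (D g)]) ->
     exists c, (forall g, (g < m)%N -> forall i j, (i < D g)%N -> (j < D g)%N ->
                  t g i j = c *+ (i == j))
       /\ (c != 0 -> lam = mu)) ->
  ~ finite_type (borel_schur K 2 r.+1).
Proof.
move=> w_le ww' wY /and5P[lg0 Dg0 uniq0 two shape] endY.
have im (g : 'I_m) : val g \in iota 0 m by rewrite mem_iota /=.
have eqw (g h : 'I_m) : (w g == w h) = (w' g == w' h) by rewrite !eqn_leq !ww'.
pose Ar' : rel 'I_m := fun g h => (val g, val h) \in Ar.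
apply: (@blocks_infinite_type K r infK m D w _ (table D y) (Ordinal lg0) Ar') => //.
- by move=> g; apply: w_le.
- by apply/eqP.
- move=> h /eqP; rewrite eqw => e; apply/val_inj/eqP.
  by have := allP uniq0 h (im h); rewrite e.
- move=> g h k /eqP e1 /eqP e2; rewrite !eqw in e1 e2.
  by have := allP (allP (allP two g (im g)) h (im h)) k (im k); rewrite e1 e2.
- move=> g h /(allP shape) /= /and5P[_ _ ne le /andP[_ /allP hk]].
  split=> [|lam k nk ek|lam k nk ek]; first by rewrite ww'.
  - rewrite -val_eqE in nk; move: ek => /eqP; rewrite eqw => ek.
    by have := hk k (im k); rewrite nk ek => /andP[/andP[n1 n2] _]; apply: table_nil.
  rewrite -val_eqE in nk; move: ek => /eqP; rewrite eqw => ek.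
  have := hk k (im k); rewrite nk ek => /andP[_ /andP[n1 n2]]; apply: table_nil => //.
move=> lam mu T E.
pose t g i j := if insub g is Some g' then nat_entry (T g') i j else 0.
have tE (g : 'I_m) i j : t g i j = nat_entry (T g) i j by rewrite /t valK.
have [|c [cT cz]] := endY lam mu t.
  move=> g h gh i j li lj.
  have /and5P[/= lg lh ne _ /andP[/eqP d1 _]] := allP shape _ gh.
  have := table_entry (E (Ordinal lg) (Ordinal lh) gh).
  rewrite /den /= (negPf ne) => /(_ d1 i j li lj).
  rewrite -/(nat_of_ord (Ordinal lg)) -/(nat_of_ord (Ordinal lh)) => e.
  under eq_map do rewrite (tE (Ordinal lh)).
  by under [in RHS]eq_map do rewrite (tE (Ordinal lg)).
exists c; split=> // g; apply: nat_entry_scalar => i j li lj.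
by rewrite -tE; apply: cT.
Qed.

Definition lookup (T : Type) (d : T) (s : seq (nat * nat * T)) g h : T :=
  (head (0%N, 0%N, d) [seq x <- s | (x.1.1 == g) && (x.1.2 == h)]).2.

Definition weight2 g := nth 0%N [:: 0; 1; 2; 2; 3; 4]%N g.
(** Six lines 0 - 3 - 1 - 4 - 2 - 5 - 0 in a hexagon, with lam on the edge
    from 0 to 5. *)
Definition maps2 := lookup (1%N, [::])
  [:: (0, 3, (1, [:: [:: One]])); (1, 3, (1, [:: [:: One]]));
      (1, 4, (1, [:: [:: One]])); (2, 4, (1, [:: [:: One]]));
      (2, 5, (1, [:: [:: One]])); (0, 5, (1, [:: [:: Lam]]))]%N.

Lemma check2 : check_table 2 1 6 (fun=> 1%N) weight2 maps2 4.
Proof. by vm_compute. Qed.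

Definition weight3 g := nth 0%N [:: 0; 1; 2; 1; 2; 3; 4; 3; 4; 5]%N g.
Definition dim3 g := nth 0%N [:: 2; 2; 1; 1; 3; 3; 1; 1; 2; 2]%N g.
Definition id2 := [:: [:: One; Zero]; [:: Zero; One]].
Definition id3 := [:: [:: One; Zero; Zero]; [:: Zero; One; Zero]; [:: Zero; Zero; One]].
Definition inc23 := [:: [:: One; Zero; Zero]; [:: Zero; One; Zero]].
Definition prj32 := [:: [:: One; Zero]; [:: Zero; One]; [:: Zero; Zero]].
(** A plane in weight 0, with a copy of it in weight 1.  The vectors
    given by 3 -> 4 and 7 -> 8 and the functionals given by 5 -> 6 and 1 -> 2
    determine four lines in it, the last of which depends on lam.  The blocks
    8 and 9 are further copies of the plane, and 4 and 5 extend it by one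
    dimension.  A map over two steps is half the composite, hence the
    denominators 2. *)
Definition maps3 := lookup (1%N, [::])
  [:: (0, 1, (1, id2)); (1, 2, (1, [:: [:: Lam]; [:: Opp]]));
      (0, 2, (2, [:: [:: Lam]; [:: Opp]])); (0, 5, (1, inc23));
      (1, 6, (1, [:: [:: One]; [:: Zero]])); (0, 6, (1, [:: [:: One]; [:: Zero]]));
      (3, 4, (1, [:: [:: One; Zero; One]])); (4, 5, (1, id3));
      (3, 5, (2, [:: [:: One; Zero; One]])); (4, 9, (1, prj32));
      (3, 8, (1, [:: [:: One; Zero]])); (3, 9, (1, [:: [:: One; Zero]]));
      (7, 8, (1, [:: [:: One; One]])); (8, 9, (1, id2));
      (7, 9, (2, [:: [:: One; One]])); (5, 6, (1, [:: [:: One]; [:: Zero]; [:: Opp]]));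
      (4, 6, (2, [:: [:: One]; [:: Zero]; [:: Opp]]))]%N.

Lemma check3 : check_table 3 2 10 dim3 weight3 maps3 5.
Proof. by vm_compute. Qed.

Definition links2 := [:: (0, 3); (1, 3); (1, 4); (2, 4); (2, 5); (0, 5)]%N.
Definition links3 := [:: (0, 1); (1, 2); (0, 5); (3, 4); (4, 5); (5, 6); (4, 9); (7, 8); (8, 9)]%N.

(** The entry (i, j) of the equation E for the link from g to h, simplified. *)
Ltac entry E g h i j e :=
  have e := E g h isT i j isT isT;
  rewrite /= ?mul0r ?mulr0 ?mul1r ?mulr1 ?mulN1r ?mulrN1 ?add0r ?addr0 in e.

Section Families.
Local Open Scope nat_scope.
Variable K : fieldType.
Hypothesis infK : infinite_set [set: K]%classic.
Variable r : nat.

Theorem infinite_type_2 : 2 \in [pchar K] -> (4 <= r.+1)%N ->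
  ~ finite_type (borel_schur K 2 r.+1).
Proof.
move=> K2 r_ge.
apply: (@table_infinite_type K r infK 6 (fun=> 1%N) weight2 weight2 maps2 0 links2) => //.
- by move=> g lg; apply: leq_trans r_ge; do 6! [case: g lg => [|g] lg //].
- move=> lam; apply: (check_table_weighted (M := 2) (N := 1) lam _ (oner_neq0 K) check2).
  exact: pcharf0.
move=> lam mu t E.
entry E 0 3 0 0 e3; entry E 1 3 0 0 e1; entry E 1 4 0 0 e4.
entry E 2 4 0 0 e2; entry E 2 5 0 0 e5; entry E 0 5 0 0 e.
rewrite -e2 e4 -e1 in e5; rewrite e3 in e1; rewrite -e1 in e4; rewrite e4 in e2.
exists (t 0 0 0); split.
  move=> g lg [|i] [|j] // _ _; rewrite mulr1n.
  case: g lg => [|[|[|[|[|[|//]]]]]] lg; rewrite ?e3 ?e4 -?e1 -?e2 ?e5 ?e3 //.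
by move=> nz; apply: (mulIf nz); rewrite -{1}e3 -e5 e mulrC.
Qed.

Theorem infinite_type_3 : 3 \in [pchar K] -> (5 <= r.+1)%N ->
  ~ finite_type (borel_schur K 2 r.+1).
Proof.
move=> K3 r_ge.
apply: (@table_infinite_type K r infK 10 dim3 weight3 weight3 maps3 0 links3) => //.
- by move=> g lg; apply: leq_trans r_ge; do 10! [case: g lg => [|g] lg //].
- move=> lam; apply: (check_table_weighted (M := 3) (N := 2) lam _ _ check3).
    exact: pcharf0.
  by rewrite -(dvdn_pcharf K3).
move=> lam mu t E.
entry E 0 1 0 0 e100; entry E 0 1 0 1 e101; entry E 0 1 1 0 e110; entry E 0 1 1 1 e111.
entry E 0 5 0 0 e500; entry E 0 5 0 1 e501; entry E 0 5 0 2 e502.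
entry E 0 5 1 0 e510; entry E 0 5 1 1 e511; entry E 0 5 1 2 e512.
entry E 4 5 0 0 f00; entry E 4 5 0 1 f01; entry E 4 5 0 2 f02.
entry E 4 5 1 0 f10; entry E 4 5 1 1 f11; entry E 4 5 1 2 f12.
entry E 4 5 2 0 f20; entry E 4 5 2 1 f21; entry E 4 5 2 2 f22.
entry E 4 9 0 0 h00; entry E 4 9 0 1 h01; entry E 4 9 1 0 h10; entry E 4 9 1 1 h11.
entry E 4 9 2 0 h20; entry E 4 9 2 1 h21.
entry E 8 9 0 0 k00; entry E 8 9 0 1 k01; entry E 8 9 1 0 k10; entry E 8 9 1 1 k11.
entry E 3 4 0 0 l0; entry E 3 4 0 1 l1; entry E 3 4 0 2 l2.
entry E 5 6 0 0 m0; entry E 5 6 1 0 m1.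
entry E 7 8 0 0 s0; entry E 7 8 0 1 s1.
entry E 1 2 0 0 q0; entry E 1 2 1 0 q1.
(* blocks 1, 8, 9 repeat the block 0, and the blocks 4 and 5 extend it by
   one diagonal entry *)
have a00 : t 4 0 0 = t 0 0 0 by rewrite -f00.
have a01 : t 4 0 1 = t 0 0 1 by rewrite -f01.
have a02 : t 4 0 2 = 0%R by rewrite -f02.
have a10 : t 4 1 0 = t 0 1 0 by rewrite -f10.
have a11 : t 4 1 1 = t 0 1 1 by rewrite -f11.
have a12 : t 4 1 2 = 0%R by rewrite -f12.
rewrite a00 -h20 addr0 in l0; rewrite a01 -h21 addr0 in l1.
rewrite a02 add0r -l0 in l2; rewrite e500 e502 subr0 in m0.
rewrite e510 e512 subr0 in m1.
rewrite -k00 h00 a00 -k10 h10 a10 -m1 addr0 in s0.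
rewrite -k01 h01 a01 l1 -k11 h11 a11 add0r -s0 in s1.
rewrite e110 e111 -m1 mul0r sub0r s1 in q1; move/oppr_inj: q1 => q1.
rewrite q1 e100 e101 l1 subr0 in q0.
exists (t 0 0 0); split=> [g lg i j|nz]; last by apply: (mulIf nz); rewrite q0 mulrC.
by case: g lg => [|[|[|[|[|[|[|[|[|[|//]]]]]]]]]] lg;
   case: i => [|[|[|i]]] //=; case: j => [|[|[|j]]] //= _ _;
   rewrite ?mulr1n ?mulr0n ?e100 ?e101 ?e110 ?e111 ?e500 ?e501 ?e502 ?e510 ?e511 ?e512
     ?f20 ?f21 ?f22 ?a00 ?a01 ?a02 ?a10 ?a11 ?a12 -?h20 -?h21 ?l2 ?l1 -?m1 ?s1
     ?q1 -?l0 ?m0 -?s0 -?k00 -?k01 -?k10 -?k11 ?h00 ?h01 ?h10 ?h11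
     ?a00 ?a01 ?a10 ?a11 ?l1 -?m1 ?s1.
Qed.

Definition dim_large g := nth 0 [:: 2; 3; 2; 1; 1; 2; 3; 2] g.
Definition weight_large q g := nth 0 [:: 0; 1; 2; 3; q + 3; q + 4; q + 5; q + 6] g.
(** Characteristic p = q + 5.  A plane in weights 0 and p + 1 and its extensions
    to three dimensions in weights 1 and p.  The maps 1 -> 2 -> 3 single out
    the two axes of the plane, and 4 -> 5 -> 6 the lines spanned by (1, 1)
    and (1, lam).  Maps over two and three steps are the composites divided by
    2 and 6; the gaps p and p + 1 are crossed by 0 -> 6, 1 -> 7 and 0 -> 7. *)
Definition maps_large := lookup (1, [::])
  [:: (0, 1, (1, inc23)); (0, 6, (1, inc23)); (1, 7, (1, prj32)); (6, 7, (1, prj32));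
      (0, 7, (1, id2)); (1, 2, (1, [:: [:: One; Zero]; [:: Zero; One]; [:: Opp; Zero]]));
      (2, 3, (1, [:: [:: One]; [:: Zero]])); (0, 2, (2, id2));
      (1, 3, (2, [:: [:: One]; [:: Zero]; [:: Opp]])); (0, 3, (6, [:: [:: One]; [:: Zero]]));
      (4, 5, (1, [:: [:: One; Zero]]));
      (5, 6, (1, [:: [:: One; One; One]; [:: One; Lam; Zero]]));
      (4, 6, (2, [:: [:: One; One; One]]));
      (5, 7, (2, [:: [:: One; One]; [:: One; Lam]])); (4, 7, (6, [:: [:: One; One]]))].
Definition links_large := [:: (0, 1); (1, 2); (2, 3); (4, 5); (5, 6); (0, 6); (6, 7); (1, 7)].

(** The order of the weights; those of the blocks 3 and 4 coincide when p = 5. *)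
Definition rank_large (z : bool) g := nth 0 [:: 0; 1; 2; 3; if z then 3 else 4; 5; 6; 7] g.
(** As elements of K the binomial coefficients that occur do not depend on p: they
    are those for p = 5, reduced modulo 5. *)
Definition bin_large g h k := 'C(weight_large 0 h - weight_large 0 g, weight_large 0 k - weight_large 0 g) %% 5.

Definition check_large z : bool :=
  all (fun g => all (fun h =>
    [&& den maps_large g h %| 6, (g != h) && (rank_large z h <= rank_large z g) ==> nilp (maps_large g h).2
      & all (fun k => (rank_large z g < rank_large z k < rank_large z h) ==>
          check 0 6 dim_large maps_large (bin_large g h k) g h [seq l <- iota 0 8 | rank_large z l == rank_large z k])
        (iota 0 8)]) (iota 0 8)) (iota 0 8).

Lemma check_largeP z : check_large z.
Proof. by case: z; vm_compute. Qed.

Lemma rank_largeP q g h : g < 8 -> h < 8 ->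
  (weight_large q g <= weight_large q h) = (rank_large (q == 0) g <= rank_large (q == 0) h).
Proof.
by case: g => [|[|[|[|[|[|[|[|g]]]]]]]] // _; case: h => [|[|[|[|[|[|[|[|h]]]]]]]] // _;
  rewrite /weight_large /rank_large /=; case: q => [|q]; rewrite ?eqxx //=; lia.
Qed.

Section LargeCharacteristic.
Variable q : nat.
Hypothesis Kp : q + 5 \in [pchar K].

Lemma bin_prime b : 0 < b < q + 5 -> 'C(q + 5, b)%:R = 0%R :> K.
Proof. by move=> lt; apply: bin_lt_pcharf_0. Qed.

Lemma bin_prime_succ b : 1 < b < q + 5 -> 'C(q + 6, b)%:R = 0%R :> K.
Proof.
case: b => // b lt; rewrite addnS binS natrD !bin_prime ?addr0 //; lia.
Qed.

Lemma bin_large_weight g h k : g < 8 -> h < 8 -> k < 8 -> ~~ nilp (maps_large g h).2 ->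
  weight_large q g < weight_large q k < weight_large q h ->
  'C(weight_large q h - weight_large q g, weight_large q k - weight_large q g)%:R = (bin_large g h k)%:R :> K.
Proof.
case: g => [|[|[|[|[|[|[|[|g]]]]]]]] // _; case: h => [|[|[|[|[|[|[|[|h]]]]]]]] // _;
  case: k => [|[|[|[|[|[|[|[|k]]]]]]]] // _ _; rewrite /weight_large /= => lt; try by exfalso; lia.
all: rewrite /weight_large ?subnDl ?subn0 //=.
1-5: by rewrite bin_prime //; lia.
1: by rewrite bin1 addnS -addn1 natrD (pcharf0 Kp) add0r.
1-4: by rewrite bin_prime_succ //; lia.
1: by rewrite addnS binSn -addn1 natrD (pcharf0 Kp) add0r.
all: by rewrite (_ : q + 6 - 1 = q + 5); [rewrite bin_prime //; lia | lia].
Qed.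

Lemma bin_large_gap g h b : g < 8 -> h < 8 -> ~~ nilp (maps_large g h).2 ->
  weight_large q g < b < weight_large q h -> (forall k, k < 8 -> weight_large q k != b) ->
  'C(weight_large q h - weight_large q g, b - weight_large q g)%:R = 0%R :> K.
Proof.
move=> lg lh ne lt gap.
have := (gap 0 isT, gap 1 isT, gap 2 isT, gap 3 isT, (gap 4 isT, gap 5 isT, gap 6 isT, gap 7 isT)).
case=> [[[[g0 g1] g2] g3] [[[g4 g5] g6] g7]] {gap}.
rewrite /weight_large /= in g0 g1 g2 g3 g4 g5 g6 g7.
case: g lg ne lt => [|[|[|[|[|[|[|[|g]]]]]]]] // _; case: h lh => [|[|[|[|[|[|[|[|h]]]]]]]] // _ _;
  rewrite /weight_large /= => lt; try by exfalso; lia.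
- by rewrite !subn0 bin_prime //; lia.
- by rewrite !subn0 bin_prime_succ //; lia.
by rewrite (_ : q + 6 - 1 = q + 5); [rewrite bin_prime //; lia | lia].
Qed.

Lemma weighted_large (lam : K) : 6%:R != 0%R :> K ->
  @weighted K 8 dim_large (weight_large q) (table dim_large maps_large lam).
Proof.
move=> nz6; have ch := check_largeP (q == 0); set z := q == 0 in ch *.
have im (g : 'I_8) : val g \in iota 0 8 by rewrite mem_iota /=.
have chP (g h : 'I_8) := allP (allP ch g (im g)) h (im h).
have eqw g h : g < 8 -> h < 8 -> (weight_large q g == weight_large q h) = (rank_large z g == rank_large z h).
  by move=> lg lh; rewrite !eqn_leq !rank_largeP.
split=> [g|g h ne le|g h b lt].
- exact: table_diag.
- apply: table_nil => //; have /and3P[_] := chP g h.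
  by rewrite -val_eqE in ne; rewrite ne -rank_largeP ?le.
have dv i j : i < 8 -> j < 8 -> den maps_large i j %| 6.
  by move=> li lj; have /and3P[] := chP (Ordinal li) (Ordinal lj).
have ne : g != h by apply: contraTneq lt => ->; apply/negP; lia.
have nz0 : 0%:R = 0%R :> K by [].
have [/existsP[k /eqP ek]|] := boolP [exists k : 'I_8, weight_large q k == b]; last first.
  rewrite negb_exists => /forallP gap.
  rewrite big_pred0 => [|k]; last exact/negbTE/(gap k).
  have [nil|nnil] := boolP (nilp (maps_large g h).2).
    by rewrite (table_nil _ _ ne nil) scaler0.
  rewrite [X in X *: _]bin_large_gap ?scale0r // => k lk; exact: (gap (Ordinal lk)).
subst b.
have -> : ('C(weight_large q h - weight_large q g, weight_large q k - weight_large q g)%:R *: table dim_large maps_large lam g h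
    = (bin_large g h k)%:R *: table dim_large maps_large lam g h)%R.
  have [nil|nnil] := boolP (nilp (maps_large g h).2).
    by rewrite (table_nil _ _ ne nil) !scaler0.
  by rewrite bin_large_weight.
apply: (table_comp (M := 0) (N := 6)) => //.
have -> : [seq l <- iota 0 8 | weight_large q l == weight_large q k] =
    [seq l <- iota 0 8 | rank_large z l == rank_large z k].
  by apply: eq_in_filter => l; rewrite mem_iota => /= ll; rewrite eqw.
have /and3P[_ _ /allP/(_ k (im k))] := chP g h.
by rewrite !ltnNge -!rank_largeP // -!ltnNge lt.
Qed.

Theorem infinite_type_large : q + 6 <= r.+1 -> ~ finite_type (borel_schur K 2 r.+1).
Proof.
move=> r_ge.
apply: (@table_infinite_type K r infK 8 dim_large (weight_large q) (rank_large (q == 0)) maps_large 0 links_large) => //.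
- move=> g lg; apply: leq_trans r_ge.
  by case: g lg => [|[|[|[|[|[|[|[|g]]]]]]]] // _; rewrite /weight_large /=; lia.
- by move=> g h; apply: rank_largeP.
- move=> lam; apply: weighted_large.
  rewrite -[6]/(2 * 3) natrM mulf_neq0 // -(dvdn_pcharf Kp); apply/negP => /dvdn_leq; lia.
- by case: (q == 0).
move=> lam mu t E.
entry E 0 1 0 0 a00; entry E 0 1 0 1 a01; entry E 0 1 0 2 a02.
entry E 0 1 1 0 a10; entry E 0 1 1 1 a11; entry E 0 1 1 2 a12.
entry E 0 6 0 0 b00; entry E 0 6 0 1 b01; entry E 0 6 0 2 b02.
entry E 0 6 1 0 b10; entry E 0 6 1 1 b11; entry E 0 6 1 2 b12.
entry E 1 7 0 0 c00; entry E 1 7 0 1 c01; entry E 1 7 1 0 c10; entry E 1 7 1 1 c11.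
entry E 1 7 2 0 c20; entry E 1 7 2 1 c21.
entry E 6 7 2 0 d20; entry E 6 7 2 1 d21.
entry E 1 2 0 0 u00; entry E 1 2 0 1 u01; entry E 1 2 1 0 u10; entry E 1 2 1 1 u11.
entry E 1 2 2 0 u20; entry E 1 2 2 1 u21.
entry E 2 3 0 0 v0; entry E 2 3 1 0 v1.
entry E 4 5 0 0 x0; entry E 4 5 0 1 x1.
entry E 5 6 0 0 y00; entry E 5 6 0 1 y01; entry E 5 6 0 2 y02.
entry E 5 6 1 0 y10; entry E 5 6 1 1 y11; entry E 5 6 1 2 y12.
rewrite a00 a02 subr0 in u00; rewrite a01 in u01.
rewrite -c20 sub0r u00 in u20; move/oppr_inj: u20 => u20.
rewrite -c21 u01 in u21; move/eqP: u21; rewrite oppr_eq0 => /eqP z01.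
rewrite -v1 a10 a12 subr0 in u10.
rewrite b00 b10 -u10 -d20 x1 !addr0 in y00; rewrite b01 z01 b11 -d21 x1 mul0r add0r !addr0 -y00 in y01.
rewrite b02 b12 !add0r -y00 in y02; rewrite b02 b12 mulr0 addr0 in y12.
rewrite -y12 add0r b00 b10 -u10 mulr0 addr0 in y10.
rewrite -y12 add0r b01 z01 add0r b11 y01 -y10 in y11.
exists (t 0 0 0); split=> [g lg i j|nz]; last by apply: (mulIf nz); rewrite y11 mulrC.
by case: g lg => [|[|[|[|[|[|[|[|//]]]]]]]] lg; case: i => [|[|[|i]]] //=; case: j => [|[|[|j]]] //= _ _;
rewrite ?mulr1n ?mulr0n ?c00 ?c01 ?c10 ?c11 ?a00 ?a01 ?a02 ?a10 ?a11 ?a12 ?b00 ?b01 ?b02 ?b10 ?b11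
  ?b12 -?c20 -?c21 -?d20 -?d21 ?v0 ?u00 ?u01 -?v1 ?u11 ?a11 ?x1 ?y02 -?y12 -?y10 ?x0 -?x0 -?y00 -?u20
  ?z01 -?u10 ?y01.
Qed.

End LargeCharacteristic.
End Families.

(** * A family for three letters *)
Section ThreeLetters.
Variables (K : fieldType) (m r : nat).
Hypothesis infK : infinite_set [set: K]%classic.
Local Notation n := m.+3.
Local Notation E := (tensor_end K n r.+2).
Local Notation A := (borel_schur K n r.+2).

(** The word 0...0xy. *)
Definition last_two (x y : nat) : 'I_(n ^ r.+2) :=
  word r.+1 (fun k => if (k < r)%N then ord0 else if k == r then inord x else inord y : 'I_n).

Definition tail_entry (a : E) x y x' y' : K := a (last_two x y) (last_two x' y').

(** The basis is formed by the words ending in 12, 11, 02 and 01, in this order.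
    The entry (0, 3) mixes the coordinates at the pairs (01, 12) and (10, 12);
    this mixture is what makes the composite through 11, with coefficient 1,
    compatible with that through 02, with coefficient lam. *)
Definition diamond_entry (lam : K) (a : E) (i j : nat) : K :=
  match i, j with
  | 0, 0 => tail_entry a 1 2 1 2
  | 1, 1 => tail_entry a 1 1 1 1
  | 2, 2 => tail_entry a 0 2 0 2
  | 3, 3 => tail_entry a 0 1 0 1
  | 0, 1 => tail_entry a 1 1 1 2
  | 0, 2 => tail_entry a 0 2 1 2
  | 1, 3 => tail_entry a 0 1 1 1
  | 2, 3 => (lam * tail_entry a 0 1 0 2)%R
  | 0, 3 => (lam * tail_entry a 0 1 1 2 + (1 - lam) * tail_entry a 1 0 1 2)%R
  | _, _ => 0%R
  end%N.

Definition diamond (lam : K) (a : E) : 'M[K]_4 := \matrix_(i, j) diamond_entry lam a i j.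

Lemma letter_last_two x y k : (k <= r.+1)%N -> letter (last_two x y) k =
  if (k < r)%N then ord0 else if k == r then inord x else inord y.
Proof. exact: letter_word. Qed.

Lemma ord0_inord : ord0 = inord 0 :> 'I_n.
Proof. by apply/val_inj; rewrite /= inordK. Qed.

Lemma tail_entry_tensor (g : 'M[K]_n) x y x' y' :
  tail_entry (@tensor_rep K n r.+2 g) x y x' y' =
    g (inord 0) (inord 0) ^+ r * g (inord x) (inord x') * g (inord y) (inord y').
Proof.
transitivity (\prod_(k < r.+2) g (letter (last_two x y) k) (letter (last_two x' y') k)).
  exact: ntensmxE.
have le (k : 'I_r.+2) : (k <= r.+1)%N by rewrite -ltnS.
under eq_bigr => k _ do rewrite !(letter_last_two _ _ (le k)).
rewrite !big_ord_recr /= ltnn eqxx ltnNge leqnSn (gtn_eqF (ltnSn r)).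
congr (_ * _ * _); rewrite -ord0_inord (eq_bigr (fun=> g ord0 ord0)) ?prodr_const ?card_ord // => k _.
by rewrite ltn_ord.
Qed.

Lemma diamond_linear lam c a b :
  diamond lam (c *: a + b) = c *: diamond lam a + diamond lam b.
Proof.
apply/matrixP => i j; rewrite !mxE.
case: i j => [[|[|[|[|i]]]] li] [[|[|[|[|j]]]] lj] //=; rewrite /tail_entry ?mxE; ring.
Qed.

Lemma borel_low (g : 'M[K]_n) : g \in @borel K n -> forall i j : 'I_n, (j < i)%N -> g i j = 0.
Proof.
by rewrite inE => /andP[_ /is_trig_mxP tg] i j lt; have := tg j i lt; rewrite mxE.
Qed.

Lemma mulmx_inord (g h : 'M[K]_n) i j : h \in @borel K n -> (j < 3)%N ->
  (g *m h) (inord i) (inord j) =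
    g (inord i) (inord 0) * h (inord 0) (inord j) + g (inord i) (inord 1) * h (inord 1) (inord j)
    + g (inord i) (inord 2) * h (inord 2) (inord j).
Proof.
move=> Bh j3; rewrite mxE 3!big_ord_recl big1 ?addr0 => [|k _]; last first.
  rewrite [X in _ * X](borel_low Bh) ?mulr0 //.
  by rewrite inordK /= /bump /=; lia.
rewrite !addrA -!ord0_inord.
have -> : inord 1 = lift ord0 ord0 :> 'I_n by apply/val_inj; rewrite /= inordK.
by have -> : inord 2 = lift ord0 (lift ord0 ord0) :> 'I_n by apply/val_inj; rewrite /= inordK.
Qed.

Lemma inord_low (g : 'M[K]_n) i j : g \in @borel K n -> (j < i)%N -> (i < 3)%N ->
  g (inord i) (inord j) = 0.
Proof. by move=> Bg lt i3; apply: (borel_low Bg); rewrite !inordK //; lia. Qed.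

(** For upper triangular g only the letters 0, 1, 2 contribute, and the claim is
    an identity in the entries of the two matrices. *)
Lemma diamond_mul_borel lam g h : g \in @borel K n -> h \in @borel K n ->
  diamond lam (@tensor_rep K n r.+2 (g *m h)) =
  diamond lam (@tensor_rep K n r.+2 h) *m diamond lam (@tensor_rep K n r.+2 g).
Proof.
move=> Bg Bh; apply/matrixP => i j; rewrite !mxE !big_ord_recl big_ord0 !mxE /=.
have low k l (lt : (l < k)%N) (k3 : (k < 3)%N) : (g (inord k) (inord l) = 0) * (h (inord k) (inord l) = 0).
  by split; apply: inord_low.
case: i j => [[|[|[|[|i]]]] li] [[|[|[|[|j]]]] lj] //=;
  rewrite ?tail_entry_tensor ?mulmx_inord //;
  rewrite ?(low 1%N 0%N isT isT) ?(low 2%N 0%N isT isT) ?(low 2%N 1%N isT isT);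
  rewrite ?(mul0r, mulr0, add0r, addr0) ?exprMn; ring.
Qed.

(** The diagonal part is diag(1, x, y, 1, ...). *)
Definition shear (x y b c : K) : 'M[K]_n :=
  \matrix_(i, j) if i == j then nth 1 [:: 1; x; y] i
                 else if (val i == 0)%N && (val j == 1)%N then b
                 else if (val i == 1)%N && (val j == 2)%N then c else 0.

Lemma shear_borel x y b c : x != 0 -> y != 0 -> shear x y b c \in @borel K n.
Proof.
move=> nx ny; have tr : is_trig_mx (shear x y b c)^T.
  apply/is_trig_mxP => i j lt_ij; rewrite !mxE.
  case: eqP => [e|_]; first by rewrite e ltnn in lt_ij.
  do 2! [case: ifP => [/andP[/eqP e1 /eqP e2]|_]; first by move: lt_ij; rewrite /= in e1 e2; lia].
  by [].
rewrite inE tr andbT unitmxE -det_tr det_trig // unitfE prodf_seq_neq0.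
apply/allP => i _ /=; rewrite !mxE eqxx.
by case: (val i) => [|[|[|k]]] //=; rewrite ?oner_eq0 // nth_nil oner_eq0.
Qed.

Lemma shear_entry x y b c i j : (i < 3)%N -> (j < 3)%N ->
  shear x y b c (inord i) (inord j) =
    if i == j then nth 1 [:: 1; x; y] i
    else if (i == 0)%N && (j == 1)%N then b
    else if (i == 1)%N && (j == 2)%N then c else 0.
Proof. by move=> li lj; rewrite mxE -val_eqE /= !inordK //; lia. Qed.

Lemma shear1 : shear 1 1 0 0 = 1%:M.
Proof.
apply/matrixP => i j; rewrite !mxE; case: eqP => // _.
  by case: (val i) => [|[|[|k]]] //=; rewrite nth_nil.
by do 2! [case: ifP => // _].
Qed.

Lemma diamond_sum lam k (c : 'I_k -> K) (a : 'I_k -> E) :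
  diamond lam (\sum_i c i *: a i) = \sum_i c i *: diamond lam (a i).
Proof.
have d0 : diamond lam 0 = 0.
  have := diamond_linear lam (-1) 0 0.
  by rewrite scaler0 addr0 scaleN1r addNr.
have dD : {morph diamond lam : a b / a + b}.
  by move=> u v; rewrite -[u]scale1r diamond_linear !scale1r.
rewrite (big_morph _ dD d0); apply: eq_bigr => i _.
by rewrite -[_ *: a i]addr0 diamond_linear d0 addr0.
Qed.

Lemma diamond_shear lam x y b c :
  diamond lam (@tensor_rep K n r.+2 (shear x y b c)) =
  \matrix_(i, j) nth 0 (nth [::]
    [:: [:: x * y; x * c; b * y; lam * (b * c)]; [:: 0; x * x; 0; b * x];
        [:: 0; 0; y; lam * c]; [:: 0; 0; 0; x]] i) j.
Proof.
apply/matrixP => i j; rewrite !mxE.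
by case: i j => [[|[|[|[|//]]]] li] [[|[|[|[|//]]]] lj] //=;
  rewrite !tail_entry_tensor !shear_entry //= expr1n; ring.
Qed.

Lemma diamond_mxmodule lam : mxmodule (fun a : A => diamond lam (borel_schur_val a)).
Proof.
split=> [c a b||a b]; first exact: diamond_linear.
  rewrite -[borel_schur_val 1]/(1%:M : E) -(ntensmx_id K n r.+2) -shear1 diamond_shear.
  apply/matrixP => i j; rewrite !mxE.
  by case: i j => [[|[|[|[|//]]]] li] [[|[|[|[|//]]]] lj] //=; rewrite ?mulr0 ?mulr1.
have S (u : A) : borel_schur_val u \in @borel_schur_pred K n r.+2 by case: u.
have /asboolP[k [c [g [Bg aE]]]] := S a; have /asboolP[l [d [h [Bh bE]]]] := S b.
rewrite -[borel_schur_val (a * b)]/(borel_schur_val a * borel_schur_val b) aE bE.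
rewrite !diamond_sum mulmx_suml.
transitivity (diamond lam (\sum_i c i *: (\sum_j d j *: (@tensor_rep K n r.+2 (g i *m h j))))).
  congr (diamond lam _); rewrite mulr_suml; apply: eq_bigr => i _.
  rewrite -scalerAl mulr_sumr; congr (_ *: _); apply: eq_bigr => j _.
  by rewrite -scalerAr /tensor_rep ntensmx_mul.
rewrite diamond_sum.
under eq_bigr => i _ do rewrite diamond_sum scaler_sumr.
rewrite exchange_big; apply: eq_bigr => j _; rewrite mulmx_sumr; apply: eq_bigr => i _.
by rewrite diamond_mul_borel // -scalemxAl -scalemxAr !scalerA mulrC.
Qed.

Lemma tensor_mem g : g \in @borel K n -> @tensor_rep K n r.+2 g \in @borel_schur_pred K n r.+2.
Proof. by move=> Bg; rewrite -[tensor_rep _ _]scale1r; apply: borel_schur_gen. Qed.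

(** A torus element with four distinct eigenvalues makes T diagonal; the
    elementary unipotents in positions (0, 1) and (1, 2) then make its
    entries equal and compare lam with mu. *)
Lemma diamond_intertwiner lam mu (T : 'M[K]_4) :
  (forall a : A, diamond lam (borel_schur_val a) *m T = T *m diamond mu (borel_schur_val a)) ->
  exists c, T = c%:M /\ (c != 0 -> lam = mu).
Proof.
move=> TR; have [x] := infinite_notin infK [:: 0; 1].
rewrite !inE negb_or => /andP[x0 x1].
have [y] := infinite_notin infK [:: 0; 1; x; x * x].
rewrite !inE !negb_or => /and4P[y0 y1 yx yxx].
have eqT s t b c : s != 0 -> t != 0 ->
    diamond lam (@tensor_rep K n r.+2 (shear s t b c)) *m T =
    T *m diamond mu (@tensor_rep K n r.+2 (shear s t b c)).
  by move=> nx ny; apply: (TR (BorelSchur (tensor_mem (shear_borel b c nx ny)))).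
pose v (i : nat) : K := nth 0 [:: x * y; x * x; y; x] i.
have dg nu : diamond nu (@tensor_rep K n r.+2 (shear x y 0 0)) =
    diag_mx (\row_j v j).
  rewrite diamond_shear; apply/matrixP => i j; rewrite !mxE.
  by case: i j => [[|[|[|[|//]]]] li] [[|[|[|[|//]]]] lj] //=;
    rewrite ?mulr0 ?mul0r ?mulr0 ?mulr1n ?mulr0n.
have v_inj (i j : 'I_4) : v i = v j -> i = j.
  move=> e; apply/val_inj; move: e; rewrite /v.
  have y_1 : x * y = x -> y = 1 by move=> e; apply: (mulfI x0); rewrite e mulr1.
  have x_1 z : z != 0 -> x * z = z -> x = 1.
    by move=> nz e; apply: (mulIf nz); rewrite e mul1r.
  have e1 : x * y <> x by move/y_1/eqP; apply/negP.
  have e2 : x * y <> y by move/(x_1 _ y0)/eqP; apply/negP.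
  have e3 : x * x <> x by move/(x_1 _ x0)/eqP; apply/negP.
  have e4 : x * y <> x * x by move/(mulfI x0)/eqP; apply/negP.
  have e5 : x * x <> y by move/esym/eqP; apply/negP.
  have e6 : x <> y by move/esym/eqP; apply/negP.
  by case: i j => [[|[|[|[|//]]]] li] [[|[|[|[|//]]]] lj] //= e; congruence.
pose D : 'rV[K]_4 := \row_j T j j.
have TD : T = diag_mx D.
  apply/matrixP => i j; rewrite !mxE; have [->|ne] := eqVneq i j; first by rewrite mulr1n.
  have := eqT x y 0 0 x0 y0; rewrite !dg mul_diag_mx mul_mx_diag.
  move/matrixP/(_ i j); rewrite !mxE => e; apply/eqP; rewrite mulr0n.
  apply: contraNT ne => nz; apply/eqP/v_inj/(mulIf nz).
  by rewrite e mulrC.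
have entry b c (i j : 'I_4) :
    diamond lam (@tensor_rep K n r.+2 (shear 1 1 b c)) i j * T j j
    = T i i * diamond mu (@tensor_rep K n r.+2 (shear 1 1 b c)) i j.
  have h := eqT 1 1 b c (oner_neq0 K) (oner_neq0 K).
  rewrite TD mul_mx_diag mul_diag_mx in h; move/matrixP/(_ i j): h.
  rewrite [LHS]mxE [RHS]mxE [D 0 j]mxE [D 0 i]mxE //.
pose i0 : 'I_4 := Ordinal (isT : (0 < 4)%N); pose i1 : 'I_4 := Ordinal (isT : (1 < 4)%N).
pose i2 : 'I_4 := Ordinal (isT : (2 < 4)%N); pose i3 : 'I_4 := Ordinal (isT : (3 < 4)%N).
have e20 : T i2 i2 = T i0 i0.
  by have := entry 1 0 i0 i2; rewrite !diamond_shear !mxE /= !mulr1 mul1r.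
have e31 : T i3 i3 = T i1 i1.
  by have := entry 1 0 i1 i3; rewrite !diamond_shear !mxE /= !mulr1 mul1r.
have e10 : T i1 i1 = T i0 i0.
  by have := entry 0 1 i0 i1; rewrite !diamond_shear !mxE /= !mulr1 mul1r.
have elam : lam * T i3 i3 = T i2 i2 * mu.
  by have := entry 0 1 i2 i3; rewrite !diamond_shear !mxE /= !mulr1.
exists (T i0 i0); split.
  rewrite {1}TD; apply/matrixP => i j; rewrite !mxE.
  have [->|//] := eqVneq i j; rewrite !mulr1n.
  by case: j => [[|[|[|[|//]]]] lj]; rewrite (bool_irrelevance lj isT) ?e20 ?e31 ?e10.
by move=> nz; apply: (mulIf nz); rewrite -{1}e10 -e31 elam e20 mulrC.
Qed.

Theorem infinite_type_rank3 : ~ finite_type A.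
Proof.
apply: (infinite_type_family (R := fun lam a => diamond lam (borel_schur_val a)) infK).
- exact: diamond_mxmodule.
- move=> lam; split=> // P PP cP.
  have [c [PE _]] := diamond_intertwiner (fun a => esym (cP a)).
  move: PP; rewrite PE -scalar_mxM => /matrixP/(_ ord0 ord0); rewrite !mxE eqxx !mulr1n.
  move/eqP; rewrite -subr_eq0 -[X in _ - X]mulr1 -mulrBr mulf_eq0 subr_eq0.
  by case/orP=> /eqP->; [left; rewrite raddf0|right].
move=> lam mu T S TS RT; have [c [TE]] := diamond_intertwiner RT; apply.
apply: contraPneq TS => c0; rewrite TE c0 raddf0 mul0mx => /matrixP/(_ ord0 ord0)/eqP.
by rewrite !mxE eqxx eq_sym oner_eq0.
Qed.

End ThreeLetters.

(** * The classification *)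
Theorem theorem9p5 (K : fieldType) (infK : infinite_set [set: K]%classic)
    (n r : nat) (n_gt0 : (0 < n)%N) (r_gt0 : (0 < r)%N) :
  (finite_type (borel_schur K 2 r) <->
     [\/ [pchar K]%R =i pred0,
         exists p : nat, [/\ p \in [pchar K]%R, (5 <= p)%N & (r <= p)%N],
         3 \in [pchar K]%R /\ (r <= 4)%N
       | 2 \in [pchar K]%R /\ (r <= 3)%N])
  /\
  ((3 <= n)%N -> (finite_type (borel_schur K n r) <-> r = 1%N)).
Proof.
case: r r_gt0 => // r _; split; last first.
  case: n n_gt0 => [|[|[|m]]] // _ _; split=> [fin|[->]]; last exact: finite_type_degree1.
  by case: r fin => // r /(infinite_type_rank3 infK).
split=> [fin|[char0|[p [Kp _ le_p]]|[K3 le4]|[K2 le3]]].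
- have [[p Kp]|char0] := pselect (exists p, p \in [pchar K]%R); last first.
    by apply: Or41 => p; apply/negP => Kp; apply: char0; exists p.
  have p_pr := pcharf_prime Kp.
  have [p_ge5|p_lt5] := leqP 5 p.
    apply: Or42; exists p; split=> //; rewrite leqNgt; apply/negP => lt_p.
    by apply: (@infinite_type_large K infK r (p - 5)) fin; rewrite ?subnK //; lia.
  case: p Kp p_pr p_lt5 => [|[|[|[|[|p]]]]] // Kp _ _.
    apply: Or44; split=> //; rewrite leqNgt; apply/negP => lt_r.
    exact: (infinite_type_2 infK Kp lt_r).
  apply: Or43; split=> //; rewrite leqNgt; apply/negP => lt_r.
  exact: (infinite_type_3 infK Kp lt_r).
- exact: finite_type_char0.
- exact: finite_type_le Kp le_p.
- move: le4; rewrite leq_eqVlt => /predU1P[[->]|lt4]; first exact: finite_type_3_4.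
  exact: finite_type_le K3 lt4.
move: le3; rewrite leq_eqVlt => /predU1P[[->]|lt3]; first exact: finite_type_2_3.
exact: finite_type_le K2 lt3.
Qed.
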